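(* Let $\lambda>0$ and $f\in L^2(0,T)$. Then the equation $${}^c\partial_t^{\alpha_0}v+\lambda v+\lambda\, g'*v=I_t^{1-\alpha_0}f,\quad t\in(0,T],\qquad v(0)=0,$$ admits a unique solution $v\in H^1(0,T)$, and $$\|v\|_{H^1(0,T)}\le Q\|f\|_{L^2(0,T)},\qquad \|t^{\vartheta}v''\|_{L^2(0,T)}\le Q\big(\|f\|_{H^1(0,T)}+\lambda^{1-\gamma}|f(0)|\big),$$ where $\gamma\in(3/4,1)$ and $\vartheta\in(\vartheta_*,1/2)$ with $\vartheta_*:=\max\{\tfrac12-\alpha_0(1-\gamma),\ \alpha_0-\tfrac12\}$, and $Q>0$ is a constant independent of $\lambda$ and $f$.
   Context: $T>0$. $\alpha:[0,T]\to\mathbb R$ satisfies $0<\alpha(t)<1$, $|\alpha'(t)|\le Q_*$, and $\alpha_0:=\alpha(0)$. Convolution $(f*g)(t)=\int_0^t f(t-s)g(s)ds$. For $\mu>0$, $\beta_\mu(t)=t^{\mu-1}/\Gamma(\mu)$ and $I_t^\mu f=\beta_\mu*f$. Caputo derivative: ${}^c\partial_t^{\alpha_0}v=\beta_{1-\alpha_0}*v'$. With $k(t)=t^{\alpha(t)-1}/\Gamma(\alpha(t))$, $g:=\beta_{1-\alpha_0}*k$, i.e. $g(t)=\int_0^t\frac{(t-s)^{-\alpha_0}}{\Gamma(1-\alpha_0)}\frac{s^{\alpha(s)-1}}{\Gamma(\alpha(s))}ds$, and $g'$ is its derivative. *)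

(* Defs.v *)
From HB Require Import structures.
From mathcomp Require Import all_boot all_order all_algebra.
From mathcomp Require Import all_classical all_reals all_analysis.
Set Implicit Arguments. Unset Strict Implicit. Unset Printing Implicit Defensive.
Import Order.TTheory GRing.Theory Num.Theory.
Import numFieldNormedType.Exports.
Local Open Scope classical_set_scope.
Local Open Scope ring_scope.

Section Defs.
Variable R : realType.
Notation leb := (@lebesgue_measure R).

Definition Gamma (mu : R) : R :=
  Rintegral leb `]0%R, +oo[ (fun x => powR x (mu - 1) * expR (- x)).

Definition beta_ (mu : R) (t : R) : R := powR t (mu - 1) / Gamma mu.

Definition conv (f g : R -> R) (t : R) : R :=
  Rintegral leb `[0%R, t] (fun s => f (t - s) * g s).

Definition RLint (mu : R) (f : R -> R) : R -> R := conv (beta_ mu) f.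

Definition kker (alpha : R -> R) (t : R) : R :=
  powR t (alpha t - 1) / Gamma (alpha t).

Definition gker (alpha : R -> R) : R -> R :=
  conv (beta_ (1 - alpha 0)) (kker alpha).

Definition L2 (T : R) (f : R -> R) : Prop :=
  measurable_fun `]0%R, T[ f /\ leb.-integrable `]0%R, T[ (fun x => ((f x) ^+ 2)%:E).

Definition L2norm (T : R) (f : R -> R) : R :=
  Num.sqrt (Rintegral leb `]0%R, T[ (fun x => (f x) ^+ 2)).

(* v is in H^1(0,T) (v being its continuous representative on [0,T])
   with weak derivative v' = w *)
Definition H1D (T : R) (v w : R -> R) : Prop :=
  L2 T w /\ forall t, 0 <= t <= T -> v t = v 0 + Rintegral leb `[0%R, t] w.

Definition H1norm (T : R) (v w : R -> R) : R :=
  Num.sqrt (L2norm T v ^+ 2 + L2norm T w ^+ 2).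

(* v solves  ^c d_t^{alpha0} v + lam v + lam g' * v = I^{1-alpha0} f
   (a.e. on (0,T]), where v' = w and ^c d^{alpha0} v = beta_{1-alpha0} * v' *)
Definition solves (T : R) (alpha : R -> R) (lam : R) (f v w : R -> R) : Prop :=
  {ae leb, forall t, `]0%R, T]%classic t ->
     conv (beta_ (1 - alpha 0)) w t + lam * v t
       + lam * conv (derive1 (gker alpha)) v t
     = RLint (1 - alpha 0) f t}.
End Defs.

(* Main.v *)
(** Put [a = alpha 0] and work in [L^1(0,T)] under causal convolution, with a
    unit adjoined.  Since [beta_(1-a) * beta_a = 1] (the constant function) and
    [g = 1 + 1 * g'], one gets [k = beta_a + beta_a * g'], and with [v = 1 * w]
    the equation becomes [w + lam k * w = f], that is [w = f - rho * f] where
    [rho] is the resolvent of [lam k].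

    Let [r] be the resolvent of [lam beta_a].  A positivity principle for
    Volterra equations shows [0 <= r], [int r <= 1], [r <= lam beta_a] and
    [t r <= a], so [r = r^(1-gamma) r^gamma <= C lam^(1-gamma) t^(a(1-gamma)-1)].
    Moreover [rho = r + r * g' - rho * (r * g')]; an exponential weight chosen
    from [g'] alone makes [r * g'] small, which bounds [rho] in [L^1] uniformly
    in [lam] and bounds [t^theta rho] in [L^2] by [C lam^(1-gamma)].  Young's
    inequality gives the first estimate, and [w' = f' - rho * f' - f(0) rho] the
    second one.

    The bound [g' = O(t^(-1/4))] comes from [g(t) = int B(x) p(t x) dx], where
    [B] is the Beta density and [p = k / beta_a] tends to 1 at 0 and satisfies
    [p' = O(t^(-1/4))]. *)

(* Identities between resolvents are checked in a commutative ring. Convolution of L^1 functions is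
   associative only almost everywhere, since a divergent integral receives a default value, so the
   ring is built on classes modulo null sets; the adjoined unit turns a resolvent into an inverse,
   [(1 - rho) (1 + K) = 1]. The obstacle is uniformity in [lam]: an exponential weight that makes
   [lam k] small depends on [lam]. Hence the comparison with [r], whose norm is at most 1 for every
   [lam], and a weight that has only [g'] to tame. The bound [t r <= a] holds because multiplication
   by [t] is a derivation for convolution and [t beta_a = a (1 * beta_a)], which gives
   [t r = a (q - r * q)] with [q = 1 * r] between 0 and 1. The condition
   [theta > 1/2 - a (1 - gamma)] is exactly the square integrability of
   [t^(theta + a (1 - gamma) - 1)] near 0. The exponent -1/4 comes from [ln s = O(s^(-1/4))]; what
   matters is that it exceeds -1/2, so that [g'] is square integrable. *)
From HB Require Import structures.
From mathcomp Require Import all_boot all_order all_algebra.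
From mathcomp Require Import all_classical all_reals all_analysis.
From mathcomp Require Import measurable_realfun generic_quotient ring lra.
Require Import Defs.
Set Implicit Arguments. Unset Strict Implicit. Unset Printing Implicit Defensive.
Import Order.TTheory GRing.Theory Num.Theory.
Import numFieldNormedType.Exports.
Local Open Scope classical_set_scope.
Local Open Scope ring_scope.

(** * Convolution of nonnegative functions on the line *)

Section Affine.
Variable R : realType.
Notation leb := (@lebesgue_measure R).
Local Open Scope ereal_scope.

Lemma measurable_affine (a c : R) :
  measurable_fun [set: R] (fun x : R => (a * x + c)%R).
Proof. by apply: measurable_funD => //; exact: measurable_funM. Qed.

Lemma ge0_integral_affine (f : R -> \bar R) (a c : R) : (0 < a)%R ->
  measurable_fun setT f -> (forall x, 0 <= f x) ->
  \int[leb]_x f x = a%:E * \int[leb]_x f (a * x + c)%R.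
Proof.
move=> a0 mf f0.
pose h : measurableTypeR R -> measurableTypeR R := fun x : R => (a * x + c)%R.
have mh : measurable_fun setT h by exact: measurable_affine.
pose pm := @measure_function_pushforward__canonical__measure_function_Measure
  _ _ _ _ R leb h mh.
(* The scaled pushforward agrees with Lebesgue measure on half-open intervals, which determine
   it. *)
have E A : measurable A -> leb A = mscale (NngNum (ltW a0)) pm A.
  apply: lebesgue_measure_unique => _ [[u v]] _ <-.
  change (leb `]u, v]%classic = a%:E * leb (h @^-1` `]u, v]%classic)).
  have -> : h @^-1` `]u, v]%classic = `]((u - c) / a)%R, ((v - c) / a)%R]%classic.
    apply/seteqP; split => x /=; rewrite !in_itv/= /h.
      by rewrite ltr_pdivrMr// ler_pdivlMr// ltrBlDr lerBrDr mulrC.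
    by rewrite ltr_pdivrMr// ler_pdivlMr// ltrBlDr lerBrDr mulrC.
  rewrite !lebesgue_measure_itv/= !lte_fin.
  rewrite ltr_pM2r ?invr_gt0// ltrD2r; case: ifPn => uv; last by rewrite mule0.
  rewrite -!EFinD -EFinM; congr EFin.
  by field; rewrite gt_eqF.
rewrite (@eq_measure_integral _ _ _ _ (mscale (NngNum (ltW a0)) pm)); last first.
  by move=> A mA _; exact: E.
rewrite ge0_integral_mscale//; congr (_ * _).
by rewrite ge0_integral_pushforward.
Qed.

Lemma ge0_integral_opp (f : R -> \bar R) :
  measurable_fun setT f -> (forall x, 0 <= f x) ->
  \int[leb]_x f x = \int[leb]_x f (- x)%R.
Proof.
move=> mf f0.
have mh : measurable_fun setT (-%R : measurableTypeR R -> measurableTypeR R) by [].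
rewrite -(@ge0_integral_pushforward _ _ _ _ _ _ mh leb setT f)//.
by apply: eq_measure_integral => //= A mA _; exact/esym/lebesgue_measureN.
Qed.

Lemma integral_affine (f : R -> \bar R) (a c : R) : (0 < a)%R ->
  measurable_fun setT f ->
  \int[leb]_x f x = a%:E * \int[leb]_x f (a * x + c)%R.
Proof.
move=> a0 mf; rewrite integralE [in RHS]integralE.
rewrite (@ge0_integral_affine (f^\+) a c)//; last exact: measurable_funepos.
rewrite (@ge0_integral_affine (f^\-) a c)//; last exact: measurable_funeneg.
have -> : \int[leb]_x f^\+ (a * x + c)%R = \int[leb]_x (fun x => f (a * x + c)%R)^\+ x.
  by apply: eq_integral => x _; rewrite unlock.
have -> : \int[leb]_x f^\- (a * x + c)%R = \int[leb]_x (fun x => f (a * x + c)%R)^\- x.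
  by apply: eq_integral => x _; rewrite unlock.
(* Either part may be infinite; distributing [a > 0] over the difference is then a case check. *)
move: (integral _ _ _) (integral _ _ _) => x y.
case: x => [x||]; case: y => [y||] //=; rewrite ?gt0_muley ?gt0_muleNy ?lte_fin//=.
by rewrite -EFinM -!EFinD -EFinM mulrBr.
Qed.

Lemma integral_opp (f : R -> \bar R) :
  measurable_fun setT f -> \int[leb]_x f x = \int[leb]_x f (- x)%R.
Proof.
move=> mf; rewrite integralE [in RHS]integralE.
rewrite (@ge0_integral_opp (f^\+))//; last exact: measurable_funepos.
rewrite (@ge0_integral_opp (f^\-))//; last exact: measurable_funeneg.
by congr (_ - _); apply: eq_integral => x _; rewrite unlock.
Qed.

Lemma integral_reflect (f : R -> \bar R) (c : R) :
  measurable_fun setT f -> \int[leb]_x f (c - x)%R = \int[leb]_x f x.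
Proof.
move=> mf.
rewrite [in RHS]integral_opp// [in RHS](@integral_affine _ 1 (- c))//; last first.
  exact: measurableT_comp.
rewrite mul1e; apply: eq_integral => x _.
by rewrite mul1r opprD opprK addrC.
Qed.

Lemma integral_shift (f : R -> \bar R) (c : R) :
  measurable_fun setT f -> \int[leb]_x f (x - c)%R = \int[leb]_x f x.
Proof.
move=> mf; rewrite [in RHS](@integral_affine _ 1 (- c))//.
by rewrite mul1e; apply: eq_integral => x _; rewrite mul1r.
Qed.

End Affine.

Section Econv.
Variable R : realType.
Notation leb := (@lebesgue_measure R).
Local Open Scope ereal_scope.

Definition econv (F G : R -> \bar R) (t : R) : \bar R :=
  \int[leb]_s (F (t - s)%R * G s).

Implicit Types F G H : R -> \bar R.

Lemma measurable_sub2 :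
  measurable_fun [set: R * R] (fun z : R * R => (z.1 - z.2)%R).
Proof. exact: measurable_funB. Qed.

Lemma measurable_econv_kernel F G : measurable_fun setT F -> measurable_fun setT G ->
  measurable_fun [set: R * R] (fun z : R * R => F (z.1 - z.2)%R * G z.2).
Proof.
move=> mF mG; apply: emeasurable_funM.
  by apply: measurableT_comp => //; exact: measurable_sub2.
exact: measurableT_comp.
Qed.

Lemma econv_ge0 F G t : (forall x, 0 <= F x) -> (forall x, 0 <= G x) ->
  0 <= econv F G t.
Proof. by move=> F0 G0; apply: integral_ge0 => x _; exact: mule_ge0. Qed.

Lemma measurable_econv F G : measurable_fun setT F -> measurable_fun setT G ->
  (forall x, 0 <= F x) -> (forall x, 0 <= G x) ->
  measurable_fun setT (econv F G).
Proof.
move=> mF mG F0 G0.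
apply: (@measurable_fun_fubini_tonelli_F _ _ (measurableTypeR R) (measurableTypeR R) R leb
  (fun z : R * R => F (z.1 - z.2)%R * G z.2)).
  exact: measurable_econv_kernel.
by move=> z; exact: mule_ge0.
Qed.

Lemma integral_econv F G : measurable_fun setT F -> measurable_fun setT G ->
  (forall x, 0 <= F x) -> (forall x, 0 <= G x) ->
  \int[leb]_t econv F G t = (\int[leb]_t F t) * (\int[leb]_t G t).
Proof.
move=> mF mG F0 G0; rewrite /econv.
rewrite (@fubini_tonelli _ _ (measurableTypeR R) (measurableTypeR R) R leb leb
  (fun z : R * R => F (z.1 - z.2)%R * G z.2))//=; last 2 first.
- exact: measurable_econv_kernel.
- by move=> z; exact: mule_ge0.
rewrite -ge0_integralZl//; last exact: integral_ge0.
apply: eq_integral => s _ /=.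
rewrite ge0_integralZr//.
- by rewrite integral_shift.
- by apply: measurableT_comp => //; exact: measurable_funB.
Qed.

End Econv.

(** * Convolution of integrable functions *)

Section Conv.
Variable R : realType.
Notation leb := (@lebesgue_measure R).
Implicit Types u v w : R -> R.

(** Where the extended integral is infinite the value is 0 by default; for integrable [u] and [v]
    this happens on a null set only. *)
Definition cv u v (t : R) : R := \int[leb]_s (u (t - s) * v s).

Definition eabs u : R -> \bar R := fun x => `|u x|%:E.

Lemma eabs_ge0 u x : (0 <= eabs u x)%E. Proof. by rewrite lee_fin. Qed.

Lemma measurable_eabs u : measurable_fun setT u -> measurable_fun setT (eabs u).
Proof. by move=> mu; apply/measurable_EFinP; exact: measurableT_comp. Qed.

Lemma measurable_subl u t : measurable_fun setT u ->
  measurable_fun setT (fun s : R => u (t - s)).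
Proof. by move=> mu; apply: measurableT_comp => //; exact: measurable_funB. Qed.

Lemma measurable_cv_integrand u v t : measurable_fun setT u -> measurable_fun setT v ->
  measurable_fun setT (fun s : R => u (t - s) * v s).
Proof. by move=> mu mv; apply: measurable_funM => //; exact: measurable_subl. Qed.

Lemma measurable_cv_kernel u v : measurable_fun setT u -> measurable_fun setT v ->
  measurable_fun [set: R * R] (fun z : R * R => (u (z.1 - z.2) * v z.2)%:E).
Proof.
move=> mu mv; apply/measurable_EFinP; apply: measurable_funM.
  by apply: measurableT_comp => //; exact: measurable_sub2.
exact: measurableT_comp.
Qed.

Lemma eabs_cv_integrand u v t s :
  (`|(u (t - s) * v s)%:E| = eabs u (t - s)%R * eabs v s)%E.
Proof. by rewrite /eabs /= normrM EFinM. Qed.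

Lemma cv_integrableP u v t : measurable_fun setT u -> measurable_fun setT v ->
  leb.-integrable setT (fun s : R => (u (t - s) * v s)%:E) <->
  (econv (eabs u) (eabs v) t < +oo)%E.
Proof.
move=> mu mv; split => [/integrableP[_]|h].
  by under eq_integral do rewrite eabs_cv_integrand.
apply/integrableP; split.
  by apply/measurable_EFinP; exact: measurable_cv_integrand.
by under eq_integral do rewrite eabs_cv_integrand.
Qed.

Lemma measurable_cv u v : measurable_fun setT u -> measurable_fun setT v ->
  measurable_fun setT (cv u v).
Proof.
move=> mu mv; apply: measurableT_comp => //.
have mk := measurable_cv_kernel mu mv.
have -> : (fun t : R => (\int[leb]_s (u (t - s) * v s)%:E)%E) =
  (fun t : R => \int[leb]_s (fun z : R * R => (u (z.1 - z.2) * v z.2)%:E)^\+%E (t, s) -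
    \int[leb]_s (fun z : R * R => (u (z.1 - z.2) * v z.2)%:E)^\-%E (t, s))%E.
  by apply/funext => t; rewrite integralE; congr (_ - _)%E; apply: eq_integral => s _;
    rewrite unlock.
apply: emeasurable_funB.
  apply: (@measurable_fun_fubini_tonelli_F _ _ (measurableTypeR R) (measurableTypeR R) R leb
    (fun z : R * R => (u (z.1 - z.2) * v z.2)%:E)^\+%E) => //.
  exact: measurable_funepos.
apply: (@measurable_fun_fubini_tonelli_F _ _ (measurableTypeR R) (measurableTypeR R) R leb
  (fun z : R * R => (u (z.1 - z.2) * v z.2)%:E)^\-%E) => //.
exact: measurable_funeneg.
Qed.

(** Reflection preserves the extended integral, so this holds at every [t], default values
    included. *)
Lemma cvC u v t : measurable_fun setT u -> measurable_fun setT v ->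
  cv u v t = cv v u t.
Proof.
move=> mu mv; rewrite /cv /Rintegral; congr fine.
rewrite -(@integral_reflect _ (fun s : R => (u (t - s) * v s)%:E) t).
  by apply: eq_integral => s _; rewrite opprB addrC subrK mulrC.
by apply/measurable_EFinP; exact: measurable_cv_integrand.
Qed.

Lemma eabs_cv_le u v t : measurable_fun setT u -> measurable_fun setT v ->
  (eabs (cv u v) t <= econv (eabs u) (eabs v) t)%E.
Proof.
move=> mu mv; rewrite /eabs.
apply: (@le_trans _ _ `|\int[leb]_s (u (t - s) * v s)%:E|%E).
  by rewrite /cv /Rintegral; case: integral => [x||] //=; rewrite normr0 leey.
apply: le_trans (le_abse_integral _ _ _) _ => //.
  by apply/measurable_EFinP; exact: measurable_cv_integrand.
by under eq_integral do rewrite eabs_cv_integrand.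
Qed.

Lemma integral_eabs_fin u : leb.-integrable setT (EFin \o u) ->
  (\int[leb]_x eabs u x < +oo)%E.
Proof. by move=> /integrableP[]. Qed.

Lemma integrable_measurable u : leb.-integrable setT (EFin \o u) ->
  measurable_fun setT u.
Proof. by move=> /integrableP[/measurable_EFinP]. Qed.
Hint Resolve integrable_measurable measurable_eabs eabs_ge0 : core.

Lemma integral_econv_fin u v : leb.-integrable setT (EFin \o u) ->
  leb.-integrable setT (EFin \o v) ->
  (\int[leb]_t econv (eabs u) (eabs v) t < +oo)%E.
Proof.
move=> iu iv; rewrite integral_econv; [|by auto..].
by apply: lte_mul_pinfty; rewrite ?integral_eabs_fin ?integral_ge0//
  ge0_fin_numE ?integral_eabs_fin// integral_ge0.
Qed.

Lemma integrable_cv u v : leb.-integrable setT (EFin \o u) ->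
  leb.-integrable setT (EFin \o v) -> leb.-integrable setT (EFin \o cv u v).
Proof.
move=> iu iv; apply/integrableP; split.
  by apply/measurable_EFinP; apply: measurable_cv; auto.
apply: le_lt_trans (integral_econv_fin iu iv); apply: ge0_le_integral => //.
- by apply: (@measurable_eabs (cv u v)); apply: measurable_cv; auto.
- by apply: measurable_econv; auto.
- by move=> x _; apply: eabs_cv_le; auto.
Qed.

Lemma ae_econv_fin u v : leb.-integrable setT (EFin \o u) ->
  leb.-integrable setT (EFin \o v) ->
  {ae leb, forall t, (econv (eabs u) (eabs v) t < +oo)%E}.
Proof.
move=> iu iv.
have : leb.-integrable setT (econv (eabs u) (eabs v)).
  apply/integrableP; split; first by apply: measurable_econv; auto.
  under eq_integral do rewrite gee0_abs ?econv_ge0//.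
  exact: integral_econv_fin.
move=> /integrable_ae -/(_ measurableT); apply: filterS => t /(_ I).
by rewrite ge0_fin_numE// econv_ge0.
Qed.

Lemma cvDl u u' v t : measurable_fun setT u -> measurable_fun setT u' ->
  measurable_fun setT v -> (econv (eabs u) (eabs v) t < +oo)%E ->
  (econv (eabs u') (eabs v) t < +oo)%E ->
  cv (u \+ u') v t = cv u v t + cv u' v t.
Proof.
move=> mu mu' mv h h'; rewrite /cv; under eq_Rintegral do rewrite /= mulrDl.
by rewrite RintegralD//; exact/cv_integrableP.
Qed.

Lemma cvZl a u v t : measurable_fun setT u ->
  measurable_fun setT v -> (econv (eabs u) (eabs v) t < +oo)%E ->
  cv (fun x => a * u x) v t = a * cv u v t.
Proof.
move=> mu mv h; rewrite /cv; under eq_Rintegral do rewrite /= -mulrA.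
by rewrite RintegralZl//; exact/cv_integrableP.
Qed.

Lemma eq_cvr u v v' t : measurable_fun setT u -> measurable_fun setT v ->
  measurable_fun setT v' -> {ae leb, forall s, v s = v' s} -> cv u v t = cv u v' t.
Proof.
move=> mu mv mv' vv'; rewrite /cv /Rintegral; congr fine.
apply: ae_eq_integral => //.
- by apply/measurable_EFinP; exact: measurable_cv_integrand.
- by apply/measurable_EFinP; exact: measurable_cv_integrand.
- by move: vv'; apply: (@filterS _ _ (ae_filter_ringOfSetsType leb)) => s -> _.
Qed.

Lemma eq_cvl u u' v t : measurable_fun setT u -> measurable_fun setT v ->
  measurable_fun setT u' -> {ae leb, forall s, u s = u' s} -> cv u v t = cv u' v t.
Proof. by move=> mu mv mu' uu'; rewrite cvC// (eq_cvr _ _ _ _ uu')// cvC. Qed.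

(** Fubini for [F (r, s) = u (t - r) v (r - s) w s]; the finiteness assumption is its absolute
    integrability at this [t]. *)
Lemma cvA u v w t : measurable_fun setT u -> measurable_fun setT v ->
  measurable_fun setT w ->
  (econv (eabs u) (econv (eabs v) (eabs w)) t < +oo)%E ->
  cv u (cv v w) t = cv (cv u v) w t.
Proof.
move=> mu mv mw fin.
pose F : R * R -> \bar R := fun z => (u (t - z.1) * (v (z.1 - z.2) * w z.2))%:E.
have mF : measurable_fun setT F.
  apply/measurable_EFinP; apply: measurable_funM; last first.
    by have /measurable_EFinP := measurable_cv_kernel mv mw.
  by apply: measurableT_comp => //; exact: measurable_funB.
have iF : (leb \x leb)%E.-integrable setT F.
  apply/integrable12ltyP => //; apply: le_lt_trans fin.
  rewrite le_eqVlt; apply/orP; left; apply/eqP; apply: eq_integral => r _.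
  rewrite -ge0_integralZl//; first last.
  - by move=> s _; apply: mule_ge0.
  - by apply: emeasurable_funM; [apply: measurableT_comp => //; [exact: measurable_eabs|exact: measurable_funB]|exact: measurable_eabs].
  by apply: eq_integral => s _; rewrite /F /eabs /= !normrM !EFinM.
rewrite /cv /Rintegral; congr fine.
transitivity (\int[leb]_r \int[leb]_s F (r, s))%E.
  apply: ae_eq_integral => //.
  - by apply/measurable_EFinP; apply: measurable_cv_integrand => //; exact: measurable_cv.
  - exact: (measurable_fubini_F iF).
  - have := ae_integrable1 iF; apply: filterS => r ir _.
    (* Fubini only yields integrability of the inner integrand multiplied by [u (t - r)]; dividing
       by that factor requires a separate zero case. *)
    have [u0|u0] := eqVneq (u (t - r)) 0.
      rewrite u0 mul0r integral0_eq//= => s _.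
      by rewrite /F /= u0 mul0r.
    have ivw : leb.-integrable setT (fun s : R => (v (r - s) * w s)%:E).
      have := @integrableZl _ _ _ leb setT measurableT (u (t - r))^-1 _ ir.
      by apply: eq_integrable => // s _; rewrite /F /= -EFinM mulKf.
    rewrite EFinM fineK; last exact: integrable_fin_num.
    by rewrite -integralZl.
rewrite (Fubini iF).
apply: ae_eq_integral => //.
- exact: (measurable_fubini_G iF).
- apply/measurable_EFinP; apply: (@measurable_cv_integrand (cv u v)) => //.
  exact: measurable_cv.
- have := ae_integrable2 iF; apply: filterS => s ir _.
  have shift : (\int[leb]_r (u (t - s - r) * v r)%:E = \int[leb]_r (u (t - r) * v (r - s))%:E)%E.
    rewrite -(@integral_shift _ (fun r : R => (u (t - s - r) * v r)%:E) s).
      by apply: eq_integral => r _; rewrite opprB addrA subrK.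
    by apply/measurable_EFinP; exact: measurable_cv_integrand.
  have [w0|w0] := eqVneq (w s) 0.
    rewrite w0 mulr0 integral0_eq//= => r _.
    by rewrite /F /= w0 !mulr0.
  have ivw : leb.-integrable setT (fun r : R => (u (t - r) * v (r - s))%:E).
    have := @integrableZr _ _ _ leb setT measurableT (w s)^-1 _ ir.
    by apply: eq_integrable => // r _; rewrite /F /= -EFinM mulrA mulfK.
  rewrite EFinM shift fineK; last exact: integrable_fin_num.
  rewrite -integralZr//; apply: eq_integral => r _.
  by rewrite /F /= -EFinM mulrA.
Qed.

End Conv.

(** * The algebra L^1(0,T) under causal convolution *)

Section Ae.
Variable R : realType.
Notation leb := (@lebesgue_measure R).

Lemma ae_imply (P Q : R -> Prop) :
  (forall x, P x -> Q x) -> {ae leb, forall x, P x} -> {ae leb, forall x, Q x}.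
Proof. by move=> PQ; apply: (@filterS _ _ (ae_filter_ringOfSetsType leb)). Qed.

Lemma ae_and (P Q : R -> Prop) : {ae leb, forall x, P x} -> {ae leb, forall x, Q x} ->
  {ae leb, forall x, P x /\ Q x}.
Proof. exact: (@filterI _ _ (ae_filter_ringOfSetsType leb)). Qed.

Lemma ae_all (P : R -> Prop) : (forall x, P x) -> {ae leb, forall x, P x}.
Proof. by move=> h; exact: aeW. Qed.

Lemma ae_ltpinfty (G : R -> \bar R) : measurable_fun setT G ->
  (forall x, 0 <= G x)%E -> (\int[leb]_x G x < +oo)%E ->
  {ae leb, forall x, (G x < +oo)%E}.
Proof.
move=> mG G0 Gfin.
have : leb.-integrable setT G.
  apply/integrableP; split => //.
  by under eq_integral do rewrite gee0_abs//.
move=> /integrable_ae -/(_ measurableT); apply: ae_imply => t /(_ I).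
by rewrite ge0_fin_numE.
Qed.

End Ae.

Section Trunc.
Variables (R : realType) (T : R).
Notation leb := (@lebesgue_measure R).
Implicit Types u v w : R -> R.

(** Vanishing outside []0, T[] is required at every point: with such supports the full-line integral
    in [cv u v t] reduces to one over []0, t[]. *)
Definition inT u :=
  leb.-integrable setT (EFin \o u) /\ forall t, ~~ (0 < t < T) -> u t = 0.

Definition trunc u : R -> R := u \_ `]0, T[.

Definition tcv u v : R -> R := trunc (cv u v).

Lemma truncE u t : trunc u t = if 0 < t < T then u t else 0.
Proof. by rewrite /trunc patchE mem_setE in_itv. Qed.

Lemma trunc_in u t : 0 < t < T -> trunc u t = u t.
Proof. by rewrite truncE => ->. Qed.

Lemma trunc_out u t : ~~ (0 < t < T) -> trunc u t = 0.
Proof. by rewrite truncE => /negbTE ->. Qed.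

Lemma inT_measurable u : inT u -> measurable_fun setT u.
Proof. by case=> /integrable_measurable. Qed.
Hint Resolve inT_measurable : core.

Lemma inT_eabs u : inT u -> measurable_fun setT (eabs u).
Proof. by move=> /inT_measurable; exact: measurable_eabs. Qed.
Hint Resolve inT_eabs : core.


Lemma inT_trunc u : leb.-integrable `]0, T[ (EFin \o u) -> inT (trunc u).
Proof.
move=> iu; split; last exact: trunc_out.
rewrite /trunc -restrict_EFin.
by apply/integrable_restrict => //; rewrite setTI.
Qed.

Lemma inT_trunc' u : leb.-integrable setT (EFin \o u) -> inT (trunc u).
Proof. by move=> iu; apply: inT_trunc; exact: integrableS iu. Qed.

Lemma inTD u v : inT u -> inT v -> inT (u \+ v).
Proof.
move=> [iu u0] [iv v0]; split; last by move=> t ht /=; rewrite u0// v0// addr0.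
by have := integrableD measurableT iu iv.
Qed.

Lemma inTZ a u : inT u -> inT (fun x => a * u x).
Proof.
move=> [iu u0]; split; last by move=> t ht /=; rewrite u0// mulr0.
by have := integrableZl measurableT a iu.
Qed.

Lemma inT0 : inT (fun=> 0).
Proof. by split => //; exact: integrable0. Qed.

Lemma cv_causal u v t : inT u -> inT v -> t <= 0 -> cv u v t = 0.
Proof.
move=> [_ u0] [_ v0] t0; rewrite /cv /Rintegral integral0_eq// => s _.
have [s0|s0] := leP s 0.
  by rewrite (v0 s) ?mulr0// ltNge s0.
rewrite u0 ?mul0r// negb_and -leNgt (_ : t - s <= 0)//.
by rewrite subr_le0 (le_trans t0)// ltW.
Qed.

Lemma inT_tcv u v : inT u -> inT v -> inT (tcv u v).
Proof. by move=> [iu _] [iv _]; apply: inT_trunc'; exact: integrable_cv. Qed.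

Lemma tcvC u v : inT u -> inT v -> tcv u v = tcv v u.
Proof. by move=> iu iv; congr trunc; apply/funext => t; rewrite cvC//; auto. Qed.

Lemma eq_tcv u u' v v' : inT u -> inT u' -> inT v -> inT v' ->
  {ae leb, forall t, u t = u' t} -> {ae leb, forall t, v t = v' t} ->
  tcv u v = tcv u' v'.
Proof.
move=> iu iu' iv iv' uu vv; congr trunc; apply/funext => t.
by rewrite (@eq_cvl _ u u')//; auto; rewrite (@eq_cvr _ _ v v')//; auto.
Qed.

(** Causality: below [T], a convolution reads its factors only at arguments below [T], so truncating
    an inner convolution loses nothing. *)
Lemma cv_tcvl u v w t : inT u -> inT v -> inT w -> 0 < t < T ->
  cv (tcv u v) w t = cv (cv u v) w t.
Proof.
move=> iu iv [_ w0] /andP[t0 tT]; apply: eq_Rintegral => s _.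
have [s0|s0] := boolP (0 < s); last by rewrite w0 ?(negbTE s0)// !mulr0.
rewrite /tcv truncE; case: ifPn => //.
rewrite negb_and => /orP[|]; rewrite -leNgt => h.
  by rewrite cv_causal.
by move: (lt_le_trans tT h); rewrite ltrBrDr gtrDl ltNge ltW.
Qed.

Lemma cv_tcvr u v w t : inT u -> inT v -> inT w -> 0 < t < T ->
  cv u (tcv v w) t = cv u (cv v w) t.
Proof.
move=> iu iv iw tT; rewrite cvC; auto; last by apply: inT_measurable; exact: inT_tcv.
by rewrite cv_tcvl// cvC//; auto; apply: measurable_cv; auto.
Qed.

Lemma ae_econv3_fin u v w : inT u -> inT v -> inT w ->
  {ae leb, forall t, (econv (eabs u) (econv (eabs v) (eabs w)) t < +oo)%E}.
Proof.
move=> iu iv iw.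
have mv : measurable_fun setT (econv (eabs v) (eabs w)).
  by apply: measurable_econv; auto => x; exact: eabs_ge0.
have v0 : forall x, (0 <= econv (eabs v) (eabs w) x)%E by move=> x; apply: econv_ge0 => y //; exact: eabs_ge0.
apply: ae_ltpinfty.
- by apply: measurable_econv; auto => x; exact: eabs_ge0.
- by move=> x; apply: econv_ge0 => y //; exact: eabs_ge0.
- rewrite integral_econv; auto; last by move=> x; exact: eabs_ge0.
  apply: lte_mul_pinfty.
  + by apply: integral_ge0 => x _; exact: eabs_ge0.
  + rewrite ge0_fin_numE; last by apply: integral_ge0 => x _; exact: eabs_ge0.
    by case: iu => iu _; exact: integral_eabs_fin.
  + by case: iv iw => iv _ [iw _]; exact: integral_econv_fin.
Qed.

(** Only almost everywhere: at exceptional [t] the two sides may carry different default values.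
    This is the reason for the quotient below. *)
Lemma tcvA u v w : inT u -> inT v -> inT w ->
  {ae leb, forall t, tcv u (tcv v w) t = tcv (tcv u v) w t}.
Proof.
move=> iu iv iw; have := ae_econv3_fin iu iv iw; apply: ae_imply => t fin.
rewrite /tcv !truncE; case: ifPn => // tT.
by rewrite -/(tcv v w) -/(tcv u v) cv_tcvr// cv_tcvl// cvA//; auto.
Qed.

Lemma tcvDl u u' v : inT u -> inT u' -> inT v ->
  {ae leb, forall t, tcv (u \+ u') v t = tcv u v t + tcv u' v t}.
Proof.
move=> iu iu' iv; have := ae_and (ae_econv_fin iu.1 iv.1) (ae_econv_fin iu'.1 iv.1).
apply: ae_imply => t [h h']; rewrite /tcv !truncE; case: ifPn => [tT|]; last by rewrite addr0.
by rewrite cvDl; auto.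
Qed.

Lemma tcvZl a u v : inT u -> inT v ->
  {ae leb, forall t, tcv (fun x => a * u x) v t = a * tcv u v t}.
Proof.
move=> iu iv; have := ae_econv_fin iu.1 iv.1.
apply: ae_imply => t h; rewrite /tcv !truncE; case: ifPn => [tT|]; last by rewrite mulr0.
by rewrite cvZl; auto.
Qed.

End Trunc.

Local Open Scope quotient_scope.

(** * Classes modulo almost everywhere equality *)

Section Quotient.
Variables (R : realType) (T : R).
Notation leb := (@lebesgue_measure R).
Implicit Types u v w : R -> R.

Record L1fun := MkL1fun { L1val : R -> R ; L1valP : inT T L1val }.
HB.instance Definition _ := gen_eqMixin L1fun.
HB.instance Definition _ := gen_choiceMixin L1fun.

Definition L1eq (u v : L1fun) := `[< {ae leb, forall t, L1val u t = L1val v t} >].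

Let L1eq_refl : reflexive L1eq.
Proof. by move=> u; apply/asboolP; exact: ae_all. Qed.
Let L1eq_sym : symmetric L1eq.
Proof.
by move=> u v; apply/idP/idP => /asboolP h; apply/asboolP; move: h; apply: ae_imply => t ->.
Qed.
Let L1eq_trans : transitive L1eq.
Proof.
move=> v u w /asboolP h /asboolP h'; apply/asboolP; move: (ae_and h h').
by apply: ae_imply => t [-> ->].
Qed.
Canonical L1eq_equiv := EquivRel L1eq L1eq_refl L1eq_sym L1eq_trans.

Definition L1q : Type := {eq_quot L1eq}.
HB.instance Definition _ := Choice.on L1q.
HB.instance Definition _ := EqQuotient.on L1q.

Definition rep (q : L1q) : R -> R := L1val (repr q).

(** Defined on all functions, with the class of 0 as default outside [inT T], so that membership
    proofs stay out of the terms. *)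
Definition cls (u : R -> R) : L1q :=
  \pi_L1q (if pselect (inT T u) is left h then MkL1fun h else MkL1fun (inT0 T)).

Lemma rep_inT q : inT T (rep q). Proof. exact: L1valP. Qed.

Lemma cls_rep q : cls (rep q) = q.
Proof.
rewrite /cls; case: pselect => [h|[]]; last exact: rep_inT.
rewrite -[RHS]reprK; apply/eqmodP/asboolP.
exact: ae_all.
Qed.

Lemma cls_eq u v : inT T u -> inT T v ->
  (cls u = cls v) <-> {ae leb, forall t, u t = v t}.
Proof.
move=> iu iv; rewrite /cls; case: pselect => // hu; case: pselect => // hv.
by split => [/eqmodP/asboolP|h]//; apply/eqmodP/asboolP.
Qed.

Lemma rep_cls u : inT T u -> {ae leb, forall t, rep (cls u) t = u t}.
Proof. by move=> iu; apply/cls_eq => //; [exact: rep_inT|rewrite cls_rep]. Qed.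

Lemma clsP (P : L1q -> Prop) : (forall u, inT T u -> P (cls u)) -> forall q, P q.
Proof. by move=> h q; rewrite -(cls_rep q); apply: h; exact: rep_inT. Qed.

Definition qadd (x y : L1q) : L1q := cls (rep x \+ rep y).
Definition qscale a (x : L1q) : L1q := cls (fun t => a * rep x t).
Definition qmul (x y : L1q) : L1q := cls (tcv T (rep x) (rep y)).

Lemma qaddE u v : inT T u -> inT T v -> qadd (cls u) (cls v) = cls (u \+ v).
Proof.
move=> iu iv; apply/cls_eq; [by apply: inTD; exact: rep_inT|exact: inTD|].
by have := ae_and (rep_cls iu) (rep_cls iv); apply: ae_imply => t /= [-> ->].
Qed.

Lemma qscaleE a u : inT T u -> qscale a (cls u) = cls (fun t => a * u t).
Proof.
move=> iu; apply/cls_eq; [by apply: inTZ; exact: rep_inT|exact: inTZ|].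
by have := rep_cls iu; apply: ae_imply => t /= ->.
Qed.

Lemma qmulE u v : inT T u -> inT T v -> qmul (cls u) (cls v) = cls (tcv T u v).
Proof.
move=> iu iv; rewrite /qmul; congr cls; apply: eq_tcv => //; try exact: rep_inT.
  exact: rep_cls.
exact: rep_cls.
Qed.

Let qaddA : associative qadd.
Proof.
move=> x y z; elim/clsP: x => u iu; elim/clsP: y => v iv; elim/clsP: z => w iw.
rewrite !qaddE//; try exact: inTD.
by congr cls; apply/funext => t /=; rewrite addrA.
Qed.
Let qaddC : commutative qadd.
Proof. by move=> x y; congr cls; apply/funext => t /=; rewrite addrC. Qed.
Let qadd0 : left_id (cls (fun=> 0)) qadd.
Proof.
move=> x; elim/clsP: x => u iu; rewrite qaddE//; last exact: inT0.
by congr cls; apply/funext => t /=; rewrite add0r.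
Qed.
Let qaddN : left_inverse (cls (fun=> 0)) (qscale (-1)) qadd.
Proof.
move=> x; elim/clsP: x => u iu; rewrite qscaleE// qaddE//; last exact: inTZ.
by congr cls; apply/funext => t /=; rewrite mulN1r addNr.
Qed.
HB.instance Definition _ := GRing.isZmodule.Build L1q qaddA qaddC qadd0 qaddN.

Let qscaleA a b x : qscale a (qscale b x) = qscale (a * b) x.
Proof.
elim/clsP: x => u iu; rewrite !qscaleE//; last exact: inTZ.
by congr cls; apply/funext => t /=; rewrite mulrA.
Qed.
Let qscale1 : left_id 1 qscale.
Proof.
move=> x; elim/clsP: x => u iu; rewrite !qscaleE//.
by congr cls; apply/funext => t /=; rewrite mul1r.
Qed.
Let qscaleDr : right_distributive qscale +%R.
Proof.
move=> a x y; elim/clsP: x => u iu; elim/clsP: y => v iv.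
rewrite -![_ + _]/(qadd _ _) qaddE// !qscaleE//; last exact: inTD.
rewrite qaddE; try exact: inTZ.
by congr cls; apply/funext => t /=; rewrite mulrDr.
Qed.
Let qscaleDl x : {morph qscale^~ x : a b / a + b}.
Proof.
move=> a b; elim/clsP: x => u iu; rewrite !qscaleE//= [RHS]qaddE//; try exact: inTZ.
by congr cls; apply/funext => t /=; rewrite mulrDl.
Qed.
HB.instance Definition _ := GRing.Zmodule_isLmodule.Build R L1q qscaleA qscale1 qscaleDr qscaleDl.

Lemma clsD u v : inT T u -> inT T v -> cls (u \+ v) = cls u + cls v.
Proof. by move=> iu iv; rewrite -qaddE. Qed.

Lemma clsZ a u : inT T u -> cls (fun t => a * u t) = a *: cls u.
Proof. by move=> iu; rewrite -qscaleE. Qed.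

Lemma clsM u v : inT T u -> inT T v -> cls (tcv T u v) = qmul (cls u) (cls v).
Proof. by move=> iu iv; rewrite qmulE. Qed.

Lemma qmulC : commutative qmul.
Proof. by move=> x y; rewrite /qmul tcvC//; exact: rep_inT. Qed.

Lemma qmulA : associative qmul.
Proof.
move=> x y z; elim/clsP: x => u iu; elim/clsP: y => v iv; elim/clsP: z => w iw.
rewrite !qmulE//; try exact: inT_tcv.
by apply/cls_eq; [by do 2 apply: inT_tcv => //|by do 2 apply: inT_tcv => //|exact: tcvA].
Qed.

Lemma qmulDl : left_distributive qmul +%R.
Proof.
move=> x y z; elim/clsP: x => u iu; elim/clsP: y => v iv; elim/clsP: z => w iw.
rewrite -clsD// !qmulE//; try exact: inTD.
rewrite -clsD//; try exact: inT_tcv.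
apply/cls_eq; [by apply: inT_tcv => //; exact: inTD|by apply: inTD; exact: inT_tcv|].
exact: tcvDl.
Qed.

Lemma qmulZl a x y : qmul (a *: x) y = a *: qmul x y.
Proof.
elim/clsP: x => u iu; elim/clsP: y => v iv.
rewrite -clsZ// !qmulE//; try exact: inTZ.
rewrite -clsZ//; try exact: inT_tcv.
apply/cls_eq; [by apply: inT_tcv => //; exact: inTZ|by apply: inTZ; exact: inT_tcv|].
exact: tcvZl.
Qed.

End Quotient.

(** The vector component of associativity in the unitization, stated over an abstract module so that
    rewriting deals with variables rather than classes. *)
Lemma unitization_mulA (K : comNzRingType) (V : lmodType K) (m : V -> V -> V)
    (a b c : K) (x y z : V) :
  commutative m -> associative m -> left_distributive m +%R ->
  (forall a x y, m (a *: x) y = a *: m x y) ->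
  a *: (b *: z + c *: y + m y z) + (b * c) *: x + m x (b *: z + c *: y + m y z) =
  (a * b) *: z + c *: (a *: y + b *: x + m x y) + m (a *: y + b *: x + m x y) z.
Proof.
move=> mC mA mDl mZl.
rewrite (mC x) !mDl !mZl !scalerDr !scalerA (mC z x) (mC y x).
rewrite (mC _ x) mA (mulrC c a) (mulrC c b) !addrA.
by rewrite [LHS](ACl (1*2*4*6*3*5*7)).
Qed.

Section Unitization.
Variables (R : realType) (T : R).

(* The convolution algebra L^1(0,T) with a unit (the Dirac mass) adjoined. *)
Definition conv_alg : Type := (R * L1q T)%type.
HB.instance Definition _ := GRing.Zmodule.on conv_alg.

Definition amul (x y : conv_alg) : conv_alg :=
  (x.1 * y.1, x.1 *: y.2 + y.1 *: x.2 + qmul x.2 y.2).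
Definition aone : conv_alg := (1, 0).

Lemma qmul0 (x : L1q T) : qmul 0 x = 0.
Proof. by have := qmulZl 0 x x; rewrite !scale0r. Qed.

Let amulC : commutative amul.
Proof.
move=> [a x] [b y]; rewrite /amul/= mulrC; congr pair.
by rewrite (addrC (a *: y)) qmulC.
Qed.

Let amulDl : left_distributive amul +%R.
Proof.
move=> [a x] [b y] [c z]; rewrite /amul/=; congr pair => /=.
  by rewrite mulrDl.
rewrite qmulDl scalerDl scalerDr.
by rewrite !addrA [LHS](ACl (1*3*5*2*4*6)).
Qed.

Let amulA : associative amul.
Proof.
move=> [a x] [b y] [c z]; rewrite /amul/=; congr pair; first by rewrite mulrA.
exact: unitization_mulA (@qmulC R T) (@qmulA R T) (@qmulDl R T) (@qmulZl R T).
Qed.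

Let amul1 : left_id aone amul.
Proof. by move=> [a x]; rewrite /amul/= mul1r scale1r scaler0 addr0 qmul0 addr0. Qed.

Let aone_neq0 : aone != 0.
Proof. by apply/eqP => -[] /eqP; rewrite oner_eq0. Qed.

HB.instance Definition _ := GRing.Zmodule_isComNzRing.Build conv_alg
  amulA amulC amul1 amulDl aone_neq0.

Definition emb (u : R -> R) : conv_alg := (0, cls T u).
Definition scal (a : R) : conv_alg := (a, 0).

Lemma embD u v : inT T u -> inT T v -> emb (u \+ v) = emb u + emb v.
Proof. by move=> iu iv; rewrite /emb clsD//; congr pair; rewrite /= addr0. Qed.

Lemma embM u v : inT T u -> inT T v -> emb (tcv T u v) = emb u * emb v.
Proof.
move=> iu iv; rewrite /emb clsM// /GRing.mul/= /amul/=.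
by rewrite !scale0r !add0r mul0r.
Qed.

Lemma embZ a u : inT T u -> emb (fun t => a * u t) = scal a * emb u.
Proof.
move=> iu; rewrite /emb clsZ// /GRing.mul/= /amul/=.
by rewrite mulr0 scaler0 qmul0 !addr0.
Qed.

(** The passage, in both directions, between computations in the ring and almost everywhere
    identities of functions. *)
Lemma emb_eq u v : inT T u -> inT T v ->
  emb u = emb v <-> {ae @lebesgue_measure R, forall t, u t = v t}.
Proof.
move=> iu iv; rewrite -(cls_eq iu iv); split => [[]//|h]; by rewrite /emb h.
Qed.

End Unitization.

(** * Weighted L^1 norms *)

Section Norm.
Variables (R : realType) (T : R).
Notation leb := (@lebesgue_measure R).
Implicit Types u v w : R -> R.
Local Notation inT := (inT T).
Local Notation tcv := (tcv T).
Local Notation emb := (@emb R T).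

Definition L1norm u : \bar R := (\int[leb]_t eabs u t)%E.

Lemma L1norm_ge0 u : (0 <= L1norm u)%E.
Proof. by apply: integral_ge0 => x _; exact: eabs_ge0. Qed.

Lemma L1norm_fin u : inT u -> (L1norm u < +oo)%E.
Proof. by case=> iu _; exact: integral_eabs_fin. Qed.

Lemma L1norm_le u v : measurable_fun setT u -> measurable_fun setT v ->
  {ae leb, forall t, `|u t| <= `|v t|} -> (L1norm u <= L1norm v)%E.
Proof.
move=> mu mv uv; apply: ae_ge0_le_integral => //.
- by move=> x _; exact: eabs_ge0.
- exact: measurable_eabs.
- by move=> x _; exact: eabs_ge0.
- exact: measurable_eabs.
- by move: uv; apply: ae_imply => t h _; rewrite lee_fin.
Qed.

Lemma L1norm_ae u v : measurable_fun setT u -> measurable_fun setT v ->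
  {ae leb, forall t, u t = v t} -> L1norm u = L1norm v.
Proof.
move=> mu mv uv; apply/eqP; rewrite eq_le; apply/andP; split; apply: L1norm_le => //;
  by move: uv; apply: ae_imply => t ->.
Qed.

Lemma L1normD u v : measurable_fun setT u -> measurable_fun setT v ->
  (L1norm (u \+ v)%R <= L1norm u + L1norm v)%E.
Proof.
move=> mu mv; rewrite /L1norm -ge0_integralD//; last 4 first.
- by move=> x _; exact: eabs_ge0.
- exact: measurable_eabs.
- by move=> x _; exact: eabs_ge0.
- exact: measurable_eabs.
apply: ge0_le_integral => //.
- by move=> x _; exact: eabs_ge0.
- by apply: measurable_eabs; exact: measurable_funD.
- by apply: emeasurable_funD; exact: measurable_eabs.
- by move=> x _; rewrite /eabs -EFinD lee_fin ler_normD.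
Qed.

Lemma L1norm_eq0 u : measurable_fun setT u -> L1norm u = 0%E -> {ae leb, forall t, u t = 0}.
Proof.
move=> mu h.
have /ae_eq_integral_abs : (\int[leb]_x `|(EFin \o u) x| = 0)%E by exact: h.
move=> /(_ measurableT); have /[swap]/[apply] : measurable_fun setT (EFin \o u).
  exact/measurable_EFinP.
by apply: ae_imply => t /(_ I) [].
Qed.

Lemma L1norm_trunc_le u : measurable_fun setT u -> (L1norm (trunc T u) <= L1norm u)%E.
Proof.
move=> mu; apply: L1norm_le => //.
  by apply/(measurable_restrictT _ _).1 => //; exact: measurable_funTS.
by apply: ae_all => t; rewrite truncE; case: ifPn; rewrite ?normr0.
Qed.

Lemma L1norm_tcv u v : inT u -> inT v -> (L1norm (tcv u v) <= L1norm u * L1norm v)%E.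
Proof.
move=> iu iv; have mu := inT_measurable iu; have mv := inT_measurable iv.
apply: le_trans (L1norm_trunc_le _) _; first exact: measurable_cv.
rewrite -integral_econv; [|exact: measurable_eabs|exact: measurable_eabs|exact: eabs_ge0|exact: eabs_ge0].
apply: ge0_le_integral => //.
- by move=> x _; exact: eabs_ge0.
- by apply: measurable_eabs; exact: measurable_cv.
- by apply: measurable_econv; [exact: measurable_eabs|exact: measurable_eabs|exact: eabs_ge0|exact: eabs_ge0].
- by move=> x _; exact: eabs_cv_le.
Qed.

Lemma L1normZ a u : measurable_fun setT u -> L1norm (fun t => a * u t) = (`|a|%:E * L1norm u)%E.
Proof.
move=> mu; rewrite /L1norm -ge0_integralZl//; [|exact: measurable_eabs|by move=> x _; exact: eabs_ge0].
by apply: eq_integral => x _; rewrite /eabs normrM EFinM.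
Qed.

(* Exponential weights are multiplicative for convolution ([ew_tcv]) and make any
   fixed kernel small ([L1norm_ew_small]). *)
Definition ew (sg : R) u : R -> R := fun t => expR (- sg * t) * u t.

Lemma measurable_ew sg u : measurable_fun setT u -> measurable_fun setT (ew sg u).
Proof.
by move=> mu; apply: measurable_funM => //; apply: measurableT_comp.
Qed.

Lemma ew_bound sg t : 0 < t < T -> expR (- sg * t) <= expR (`|sg| * T).
Proof.
move=> /andP[t0 tT]; rewrite ler_expR.
apply: (le_trans (ler_norm _)); rewrite normrM normrN ler_wpM2l//.
by rewrite gtr0_norm// ltW.
Qed.

Lemma inT_ew sg u : inT u -> inT (ew sg u).
Proof.
move=> [iu u0]; split; last by move=> t h; rewrite /ew u0// mulr0.
have iw := integrableZl measurableT (expR (`|sg| * T)) iu.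
apply: (le_integrable measurableT _ _ iw).
  by apply/measurable_EFinP; apply: measurable_ew; exact: integrable_measurable.
move=> t _; rewrite /= lee_fin /ew !normrM.
have [tT|tT] := boolP (0 < t < T); last by rewrite u0// normr0 !mulr0.
by rewrite ler_wpM2r// !(ger0_norm (expR_ge0 _)) ew_bound.
Qed.

Lemma ew_tcv sg u v : inT u -> inT v ->
  {ae leb, forall t, tcv (ew sg u) (ew sg v) t = ew sg (tcv u v) t}.
Proof.
move=> iu iv; have := ae_econv_fin iu.1 iv.1; apply: ae_imply => t fin.
rewrite /tcv /ew !truncE; case: ifPn => _; last by rewrite mulr0.
rewrite /cv -RintegralZl//; last first.
  by apply/(cv_integrableP t (inT_measurable iu) (inT_measurable iv)).
apply: eq_Rintegral => s _.
rewrite mulrACA -expRD -mulrDr subrK; ring.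
Qed.

Lemma ewK sg u t : ew (- sg) (ew sg u) t = u t.
Proof. by rewrite /ew mulrA -expRD opprK -mulrDl subrr mul0r expR0 mul1r. Qed.

Lemma L1norm_ew_small h (e : R) : inT h -> 0 < e ->
  exists sg, 0 <= sg /\ (L1norm (ew sg h) <= e%:E)%E.
Proof.
move=> ih e0.
have mh := inT_measurable ih.
(* Along integer weights [e^(-n t)] is a geometric sequence, which tends to 0 because the support
   forces [t > 0]; [h] itself dominates. *)
have [] := @dominated_convergence _ _ R leb setT measurableT
  (fun n => eabs (ew n%:R h)) (cst 0%E) (eabs h).
- by move=> n; apply: measurable_eabs; exact: measurable_ew.
- exact: measurable_cst.
- apply: ae_all => t _.
  have [tT|tT] := boolP (0 < t < T); last first.
    rewrite (_ : (fun n => _) = cst 0%E); first exact: cvg_cst.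
    by apply/funext => n; rewrite /eabs /ew ih.2// mulr0 normr0.
  apply: cvg_EFin; first exact: nearW.
  rewrite /comp /= (_ : (fun n => _) = (fun n : nat => geometric (`|h t|) (expR (- t)) n)).
    apply: cvg_geometric; rewrite ger0_norm ?expR_ge0//.
    by rewrite -[ltRHS]expR0 ltr_expR oppr_lt0; case/andP: tT.
  apply/funext => n; rewrite /geometric/= /ew normrM ger0_norm ?expR_ge0// mulrC; congr (_ * _).
  by rewrite -expRM_natl mulNr -mulrN mulr_natl.
- case: ih => ih _; move: (integrable_abse ih) => //.
- apply: ae_all => t n _; rewrite /eabs abse_EFin normr_id lee_fin /ew normrM.
  have [tT|tT] := boolP (0 < t < T); last by rewrite ih.2// normr0 mulr0.
  rewrite ler_piMl// ger0_norm ?expR_ge0// -[leRHS]expR0 ler_expR mulNr oppr_le0.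
  by rewrite mulr_ge0//; case/andP: tT => /ltW.
move=> _ _; rewrite integral_cst// mul0e.
move=> /fine_cvgP [_] /cvgrPdist_lt /(_ _ e0) [N _ /(_ N (leqnn N))] /=.
rewrite sub0r normrN => hN; exists N%:R; split => //.
have fn : (L1norm (ew N%:R h) \is a fin_num)%E.
  by rewrite ge0_fin_numE ?L1norm_ge0//; apply: L1norm_fin; exact: inT_ew.
rewrite -(fineK fn) lee_fin; apply: le_trans (ltW hN).
exact: ler_norm.
Qed.

Lemma emb0 u : inT u -> emb u = 0 <-> {ae leb, forall t, u t = 0}.
Proof. by move=> iu; rewrite -(emb_eq iu (inT0 T)). Qed.

(** Young's inequality for L^1 against L^2: Cauchy-Schwarz on [|u| |v| = |u|^(1/2) (|u|^(1/2) |v|)]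
    gives the pointwise bound [pt], which is then integrated. *)
Lemma integral_sqr_tcv u v : inT u -> measurable_fun setT v ->
  (\int[leb]_t ((cv u v t) ^+ 2)%:E <= L1norm u * L1norm u * \int[leb]_t ((v t) ^+ 2)%:E)%E.
Proof.
move=> iu mv; have mu := inT_measurable iu.
pose v2 := fun t => v t ^+ 2.
have mv2 : measurable_fun setT v2 by exact: measurable_funX.
have pt t : (((cv u v t) ^+ 2)%:E <= L1norm u * econv (eabs u) (eabs v2) t)%E.
  have := eabs_cv_le t mu mv.
  pose f := fun s => Num.sqrt `|u (t - s)|.
  pose g := fun s => Num.sqrt `|u (t - s)| * `|v s|.
  have mf : measurable_fun setT f.
    apply: measurableT_comp; first by apply: continuous_measurable_fun; exact: sqrt_continuous.
    by apply: measurableT_comp => //; exact: measurable_subl.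
  have mg : measurable_fun setT g.
    by apply: measurable_funM => //; exact: measurableT_comp.
  have := @hoelder _ _ R leb f g 2 2 mf mg (@ltr0n R 2) (@ltr0n R 2).
  have -> : (2^-1 + 2^-1 = 1 :> R) by lra.
  move=> /(_ erefl); rewrite Lnorm1.
  have -> : (\int[leb]_x `|(EFin \o (f \* g)%R) x| = econv (eabs u) (eabs v) t)%E.
    apply: eq_integral => s _; rewrite /f /g /= /eabs mulrA -expr2 sqr_sqrtr//.
    by rewrite ger0_norm ?mulr_ge0// EFinM.
  move=> h1 h2; have {h1 h2} := le_trans h2 h1.
  have N2f : ('N[leb]_2%:E[EFin \o f] `^ 2 = L1norm u)%E.
    rewrite powR_Lnorm// /L1norm -[RHS](@integral_reflect _ (eabs u) t); last exact: measurable_eabs.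
    apply: eq_integral => s _ /=; rewrite ger0_norm ?sqrtr_ge0// ?poweR_EFin.
    by rewrite powR_mulrn ?sqrtr_ge0// sqr_sqrtr.
  have N2g : ('N[leb]_2%:E[EFin \o g] `^ 2 = econv (eabs u) (eabs v2) t)%E.
    rewrite powR_Lnorm// /econv; apply: eq_integral => s _ /=.
    rewrite ger0_norm ?mulr_ge0 ?sqrtr_ge0// ?poweR_EFin powR_mulrn ?mulr_ge0 ?sqrtr_ge0//.
    by rewrite exprMn sqr_sqrtr// EFinM /eabs /v2 normrX.
  move=> h; have : (eabs (cv u v) t `^ 2 <= ('N[leb]_2%:E[EFin \o f] * 'N[leb]_2%:E[EFin \o g]) `^ 2)%E.
    apply: gt0_ler_poweR => //.
      by rewrite in_itv/= eabs_ge0 leey.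
    by rewrite in_itv/= leey andbT mule_ge0// Lnorm_ge0.
  rewrite poweRM ?Lnorm_ge0// N2f N2g; apply: le_trans.
  by rewrite /eabs poweR_EFin powR_mulrn// lee_fin real_normK ?num_real.
apply: (@le_trans _ _ (\int[leb]_t (L1norm u * econv (eabs u) (eabs v2) t))%E).
  apply: ge0_le_integral => //.
  - by move=> x _; rewrite lee_fin sqr_ge0.
  - by apply/measurable_EFinP; apply: measurable_funX; exact: measurable_cv.
  - apply: emeasurable_funM => //; apply: measurable_econv; [exact: measurable_eabs|exact: measurable_eabs|exact: eabs_ge0|exact: eabs_ge0].
rewrite ge0_integralZl//; last 3 first.
- apply: measurable_econv; [exact: measurable_eabs|exact: measurable_eabs|exact: eabs_ge0|exact: eabs_ge0].
- by move=> x _; apply: econv_ge0; exact: eabs_ge0.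
- exact: L1norm_ge0.
rewrite integral_econv; [|exact: measurable_eabs|exact: measurable_eabs|exact: eabs_ge0|exact: eabs_ge0].
rewrite muleA le_eqVlt; apply/orP; left; apply/eqP; congr (_ * _)%E.
by apply: eq_integral => x _; rewrite /eabs /v2 ger0_norm ?sqr_ge0.
Qed.

End Norm.

(** * Resolvents *)

(** In the inverse form, [W + y W = F] is solved by [W = (1 - x) F]; the second form has no unit in
    it and can be read as an identity of functions. *)
Lemma resolventE (A : comNzRingType) (x y : A) :
  (1 - x) * (1 + y) = 1 <-> x + y * x = y.
Proof.
split=> h; apply/eqP; rewrite -subr_eq0; apply/eqP.
  by transitivity (1 - (1 - x) * (1 + y)); [ring|rewrite h subrr].
by transitivity (y - (x + y * x)); [ring|rewrite h subrr].
Qed.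

Section Resolvent.
Variables (R : realType) (T : R).
Notation leb := (@lebesgue_measure R).
Implicit Types u v w : R -> R.
Local Notation inT := (inT T).
Local Notation tcv := (tcv T).
Local Notation emb := (@emb R T).

Lemma embN u : inT u -> emb (fun t => - u t) = - emb u.
Proof.
move=> iu; have := embZ (-1) iu.
rewrite (_ : (fun t => -1 * u t) = (fun t => - u t)); last first.
  by apply/funext => t; rewrite mulN1r.
move=> ->; rewrite /scal /emb /GRing.mul/= /amul/=.
by rewrite mulr0 scaler0 qmul0 !addr0 scaleN1r -[RHS]/(- 0, - cls T u) oppr0.
Qed.

Lemma inTN u : inT u -> inT (fun t => - u t).
Proof.
move=> iu; have := inTZ (-1) iu.
by rewrite (_ : (fun t => -1 * u t) = (fun t => - u t))//; apply/funext => t; rewrite mulN1r.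
Qed.

Lemma inTB u v : inT u -> inT v -> inT (u \- v).
Proof. by move=> iu iv; apply: inTD => //; exact: inTN. Qed.

Lemma embB u v : inT u -> inT v -> emb (u \- v) = emb u - emb v.
Proof. by move=> iu iv; rewrite -embN// -embD//; exact: inTN. Qed.

Lemma nuN u : L1norm (fun t => - u t) = L1norm u.
Proof. by rewrite /L1norm /eabs; under eq_integral do rewrite normrN. Qed.

Section Neumann.
Variable K : R -> R.
Hypothesis iK : inT K.
Hypothesis K_small : (L1norm K <= (2^-1)%:E)%E.

(** The term [a n] is [(-1)^n] times the convolution power of [K] of exponent [n + 1]. *)
Let a := fix a n := if n is m.+1 then (fun t => - tcv K (a m) t) else K.

Let inTa n : inT (a n).
Proof. by elim: n => [//|n ih] /=; apply: inTN; exact: inT_tcv. Qed.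

Let ma n : measurable_fun setT (a n). Proof. exact: inT_measurable (inTa n). Qed.

Let nua n : (L1norm (a n) <= (2^-1 ^+ n.+1)%:E)%E.
Proof.
elim: n => [|n ih] /=; first by rewrite expr1.
rewrite nuN; apply: le_trans (L1norm_tcv iK (inTa n)) _.
by rewrite exprS EFinM; apply: lee_pmul => //; exact: L1norm_ge0.
Qed.

Let s n t := \sum_(i < n) a i t.

Let inTs n : inT (s n).
Proof.
elim: n => [|n ih].
  rewrite (_ : s 0 = fun=> 0); first exact: inT0.
  by apply/funext => t; rewrite /s big_ord0.
rewrite (_ : s n.+1 = s n \+ a n); first exact: inTD.
by apply/funext => t; rewrite /s big_ord_recr.
Qed.

(** Multiplying a partial sum by [K] reproduces, up to sign, all terms of the next one except the
    first. *)
Let embs n : emb (s n.+1) + emb K * emb (s n) = emb K.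
Proof.
have sS m : emb (s m.+1) = emb (s m) + emb (a m).
  rewrite -embD//; congr emb.
  by apply/funext => t; rewrite /s big_ord_recr.
have aS m : emb (a m.+1) = - (emb K * emb (a m)).
  by rewrite -embM// -embN//; exact: inT_tcv.
elim: n => [|n ih].
  have s0 : emb (s 0) = 0 by apply/emb0 => //; apply: ae_all => t; rewrite /s big_ord0.
  by rewrite sS s0 mulr0 addr0 add0r.
by rewrite sS aS -[RHS]ih sS; ring.
Qed.

(** A pointwise majorant of all partial sums, integrable because the norms of the terms decay
    geometrically. *)
Let M t : \bar R := (\sum_(n <oo) eabs (a n) t)%E.

Let mM : measurable_fun setT M.
Proof.
apply: ge0_emeasurable_sum => [n x _ _|n _]; first exact: eabs_ge0.
exact: measurable_eabs.
Qed.

Let M0 t : (0 <= M t)%E.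
Proof. by apply: nneseries_ge0 => n _ _; exact: eabs_ge0. Qed.

Let Mint : (\int[leb]_t M t < +oo)%E.
Proof.
rewrite integral_nneseries//; last 2 first.
- by move=> n; exact: measurable_eabs.
- by move=> n t _; exact: eabs_ge0.
apply: (@le_lt_trans _ _ (\sum_(0 <= n <oo) ((1 / (2 ^ n.+1)%:R)%:E))%E).
  apply: lee_nneseries => [n *|n *]; first exact: L1norm_ge0.
  by apply: le_trans (nua n) _; rewrite lee_fin exprVn div1r natrX.
by apply: le_lt_trans (@epsilon_trick0 R 1 xpredT ler01) _; exact: ltry.
Qed.

Let E : set R := M @^-1` (~` [set +oo%E]).
Let mE : measurable E.
Proof. by rewrite -[E]setTI; apply: mM => //; apply: measurableC; exact: emeasurable_set1. Qed.

Let EP t : E t <-> (M t < +oo)%E.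
Proof. by rewrite /E /= ltey; split => /eqP. Qed.

(** Setting the sums to 0 where [M] is infinite makes them converge at every point, and thereby the
    limit measurable. *)
Let b n : R -> R := s n \_ E.

Let s_le n t : E t -> \sum_(i < n) `|a i t| <= fine (M t).
Proof.
move=> /EP Mt; rewrite -lee_fin fineK; last by rewrite ge0_fin_numE.
rewrite -sumEFin.
by rewrite (le_trans _ (nneseries_lim_ge n _))//= => [|i _ _]; rewrite ?big_mkord//; exact: eabs_ge0.
Qed.

Let cvg_s t : E t -> cvgn (fun n => s n t).
Proof.
move=> Et.
have : cvgn (series (fun n => `|a n t|)).
  apply: nondecreasing_is_cvgn.
    by apply/nondecreasing_series => n _ _.
  exists (fine (M t)) => _ [n _ <-]; rewrite /series/= big_mkord; exact: s_le.
move/normed_cvg; rewrite (_ : (fun n => s n t) = series (fun n => a n t))//.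
by apply/funext => n; rewrite /series /s /= big_mkord.
Qed.

Let rho t : R := limn (fun n => b n t).

Let cvg_b t : b n t @[n --> \oo] --> rho t.
Proof.
have [Et|Et] := pselect (E t).
  have : cvgn (fun n => b n t).
    by under eq_fun do rewrite /b patchE mem_set//; exact: cvg_s.
  by [].
have -> : (fun n => b n t) = cst 0.
  by apply/funext => n; rewrite /b patchE memNset.
rewrite /rho (_ : (fun n => b n t) = cst 0); last first.
  by apply/funext => n; rewrite /b patchE memNset.
by rewrite lim_cst//; exact: cvg_cst.
Qed.

Let mb n : measurable_fun setT (b n).
Proof.
have : measurable_fun E (s n).
  by apply: measurable_funTS; exact: inT_measurable (inTs n).
by move=> /(measurable_restrictT _ mE).
Qed.

Let aeE : {ae leb, forall t, E t}.
Proof. by have := ae_ltpinfty mM M0 Mint; apply: ae_imply => t /EP. Qed.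

Let ae_b n : {ae leb, forall t, b n t = s n t}.
Proof. by have := aeE; apply: ae_imply => t Et; rewrite /b patchE mem_set. Qed.

Let DCT : leb.-integrable setT (EFin \o rho) /\
  (\int[leb]_t `|(b n t)%:E - (rho t)%:E| @[n --> \oo] --> 0)%E.
Proof.
have [] := @dominated_convergence _ _ R leb setT measurableT
  (fun n t => (b n t)%:E) (EFin \o rho) M.
- by move=> n; apply/measurable_EFinP; exact: mb.
- by apply/measurable_EFinP; apply: measurable_fun_cvg mb _ => t _; exact: cvg_b.
- by apply: ae_all => t _; apply: cvg_EFin; [exact: nearW|exact: cvg_b].
- apply/integrableP; split => //.
  by under eq_integral do rewrite gee0_abs//.
- have := aeE; apply: ae_imply => t Et n _.
  rewrite /b patchE mem_set// -[leRHS]fineK; last by rewrite ge0_fin_numE//; exact/EP.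
  by rewrite lee_fin; apply: le_trans (s_le n Et); exact: ler_norm_sum.
by [].
Qed.

Let irho : inT rho.
Proof.
split; first exact: DCT.1.
move=> t tT; rewrite /rho (_ : (fun n => b n t) = cst 0) ?lim_cst//.
apply/funext => n; rewrite /b patchE; case: ifPn => // _.
by rewrite /s big1// => i _; exact: (inTa i).2.
Qed.

Lemma neumann_resolvent : exists rho, inT rho /\ (1 - emb rho) * (1 + emb K) = 1.
Proof.
exists rho; split => //.
apply/resolventE.
(* By [embs], the defect [d] equals [e n.+1 + K * e n] for every [n], where [e n] is the error of
   the partial sum; its norm is therefore below every positive [eps]. *)
pose d := rho \+ tcv K rho \- K.
have id : inT d by apply: inTB => //; apply: inTD => //; exact: inT_tcv.
suff /(emb0 id).2 : {ae leb, forall t, d t = 0}.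
  rewrite embB//; last by apply: inTD => //; exact: inT_tcv.
  rewrite embD//; last exact: inT_tcv.
  by rewrite embM// => /eqP; rewrite subr_eq0 => /eqP.
apply: L1norm_eq0; first exact: inT_measurable id.
pose e n := rho \- s n.
have ie n : inT (e n) by exact: inTB.
have dE n : {ae leb, forall t, d t = (e n.+1 \+ tcv K (e n)) t}.
  have iKr := inT_tcv iK irho; have iKe := inT_tcv iK (ie n).
  have irK := inTD irho iKr.
  apply/(emb_eq id (inTD (ie n.+1) iKe)).
  rewrite (embB irK iK) (embD irho iKr) (embM iK irho) (embD (ie n.+1) iKe).
  rewrite (embM iK (ie n)) (embB irho (inTs n.+1)) (embB irho (inTs n)).
  by rewrite -[X in _ - X = _](embs n); ring.
have cvge : (L1norm (e n) @[n --> \oo] --> 0)%E.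
  have := DCT.2; apply: cvg_trans; apply: near_eq_cvg; apply: nearW => n.
  rewrite /L1norm; apply: ae_eq_integral => //.
  - by apply: measurableT_comp => //; apply: emeasurable_funB; apply/measurable_EFinP; [exact: mb|exact: inT_measurable irho].
  - by apply: measurable_eabs; exact: inT_measurable (ie n).
  - by have := ae_b n; apply: ae_imply => t h _; rewrite h /e /eabs -EFinB abse_EFin distrC.
apply/eqP; rewrite eq_le L1norm_ge0 andbT.
apply/lee_addgt0Pr => eps eps0; rewrite add0e.
have eps2 : 0 < eps / 2 by rewrite divr_gt0.
move: cvge => /fine_cvgP[_] /cvgrPdist_lt /(_ _ eps2) [N _ hN].
have small n : (N <= n)%N -> (L1norm (e n) <= (eps / 2)%:E)%E.
  move=> Nn; have := hN n Nn; rewrite /= sub0r normrN => h.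
  have fn : (L1norm (e n) \is a fin_num)%E by rewrite ge0_fin_numE ?L1norm_ge0//; exact: L1norm_fin.
  by rewrite -(fineK fn) lee_fin; apply: le_trans (ltW h); exact: ler_norm.
rewrite (L1norm_ae (inT_measurable id) _ (dE N)); last first.
  by apply: inT_measurable; apply: inTD => //; exact: inT_tcv.
apply: le_trans (L1normD _ _) _; [exact: inT_measurable (ie _)|by apply: inT_measurable; exact: inT_tcv|].
rewrite (splitr eps) EFinD; apply: leeD; first exact: small.
apply: le_trans (L1norm_tcv iK (ie N)) _.
apply: (@le_trans _ _ (1 * L1norm (e N))%E); last by rewrite mul1e; exact: small.
rewrite lee_wpmul2r ?L1norm_ge0//; apply: le_trans K_small _.
by rewrite lee_fin; lra.
Qed.

End Neumann.

(** Weights are multiplicative for convolution: the resolvent of the weighted, hence small, kernel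
    becomes that of [K] when the weight is removed. *)
Lemma resolvent_ex K : inT K ->
  exists rho, inT rho /\ (1 - emb rho) * (1 + emb K) = 1.
Proof.
move=> iK; have [sg [_ sm]] := L1norm_ew_small iK (ltac:(lra) : 0 < 2^-1 :> R).
have [r [ir hr]] := neumann_resolvent (inT_ew sg iK) sm.
have iwr : inT (ew (- sg) r) by exact: inT_ew.
exists (ew (- sg) r); split; first exact: iwr.
have ewr : ew sg (ew (- sg) r) = r.
  by apply/funext => t; have := ewK (- sg) r t; rewrite opprK.
apply/resolventE.
have h : emb r + emb (ew sg K) * emb r = emb (ew sg K).
  exact/resolventE.
rewrite -embM// -embD//; last exact: inT_tcv.
apply/emb_eq => //; first by apply: inTD => //; exact: inT_tcv.
move: h; rewrite -embM//; last exact: inT_ew.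
rewrite -embD//; last by apply: inT_tcv => //; exact: inT_ew.
move/emb_eq; move=> /(_ (inTD ir (inT_tcv (inT_ew sg iK) ir)) (inT_ew sg iK)).
move/ae_and => /(_ _ (ew_tcv sg iK iwr)).
apply: ae_imply => t /=; rewrite ewr => -[h1 h2].
have E : expR (- - sg * t) * expR (- sg * t) = 1.
  by rewrite -expRD -mulrDl addNr mul0r expR0.
move: h1; rewrite h2 /ew; set X := tcv _ _ _ => h1.
transitivity (expR (- - sg * t) * (r t + expR (- sg * t) * X)).
  by rewrite mulrDr [in RHS]mulrA E mul1r.
by rewrite h1 mulrA E mul1r.
Qed.

End Resolvent.

(** * The Gamma and Beta integrals *)

Section PowerKernel.
Variable R : realType.
Notation leb := (@lebesgue_measure R).

Lemma cvg_div_natS (t : R) : t / n.+1%:R @[n --> \oo] --> (0 : R).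
Proof.
rewrite -(mulr0 t); apply: cvgM; first exact: cvg_cst.
have := @cvg_harmonic R; rewrite /harmonic; exact.
Qed.

Lemma derivable_powR_div (mu x : R) : 0 < mu -> 0 < x ->
  is_derive x 1 (fun x : R => x `^ mu / mu) (x `^ (mu - 1)).
Proof.
move=> mu0 x0.
have -> : (fun x : R => x `^ mu / mu) = ((@powR R ^~ mu) * cst mu^-1)%R by [].
have h := is_derive1_powR mu x0.
apply: is_derive_eq.
by rewrite scaler0 add0r /GRing.scale/= mulrA mulVf ?mul1r// gt_eqF.
Qed.

Lemma integral_powR_cc (mu s t : R) : 0 < mu -> 0 < s -> s < t ->
  (\int[leb]_(x in `[s, t]) (x `^ (mu - 1))%:E = (t `^ mu / mu - s `^ mu / mu)%:E)%E.
Proof.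
move=> mu0 s0 st.
have pos x : x \in `[s, t] -> 0 < x.
  by rewrite in_itv/= => /andP[sx _]; exact: lt_le_trans sx.
have dF x : x \in `[s, t] -> is_derive x 1 (fun x : R => x `^ mu / mu) (x `^ (mu - 1)).
  by move=> /pos; exact: derivable_powR_div.
have cF : {within `[s, t], continuous (fun x : R => x `^ mu / mu)}.
  by apply: derivable_within_continuous => x xst; apply: ex_derive; exact: dF.
rewrite (@continuous_FTC2 _ _ (fun x : R => x `^ mu / mu))//.
- apply: derivable_within_continuous => x xst.
  by apply: ex_derive; exact: (is_derive1_powR (mu - 1) (pos _ xst)).
- have [_ c1 c2] := (continuous_within_itvP _ st).1 cF.
  split=> // x xst; apply: ex_derive; apply: dF.
  exact: subset_itv_oo_cc.
- move=> x xst; rewrite derive1E; apply: derive_val.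
  by apply: dF; exact: subset_itv_oo_cc.
Qed.

Lemma integral_powR (mu t : R) : 0 < mu -> 0 < t ->
  (\int[leb]_(x in `]0%R, t[) (x `^ (mu - 1))%:E = (t `^ mu / mu)%:E)%E.
Proof.
move=> mu0 t0.
have mp D : measurable_fun D (fun x : R => (x `^ (mu - 1))%:E).
  by apply/measurable_EFinP; apply: measurable_funTS; exact: measurable_powR.
rewrite integral_itv_bndo_bndc//.
(* Starting at [t / 2] keeps the left end strictly below [t], as [integral_powR_cc] requires; the
   sets increase to []0, t]]. *)
pose F n := `[t / n.+2%:R, t]%classic.
have FE : `]0, t]%classic = \bigcup_n F n.
  apply/seteqP; split => x /=.
    rewrite in_itv/= => /andP[x0 xt].
    have /cvgrPdist_lt /(_ x x0) [N _ /(_ N (leqnn N))] := cvg_div_natS t.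
    rewrite /= sub0r normrN gtr0_norm ?divr_gt0// => h.
    exists N => //; rewrite /F/= in_itv/= xt andbT (le_trans _ (ltW h))//.
    by rewrite ler_pM2l// lef_pV2 ?posrE ?ltr0n// ler_nat.
  move=> [n _]; rewrite /F/= !in_itv/= => /andP[h ->]; rewrite andbT.
  by apply: lt_le_trans h; rewrite divr_gt0.
have /cvg_lim <- // : (\int[leb]_(x in F n) (x `^ (mu - 1))%:E)%E @[n --> \oo] --> (t `^ mu / mu)%:E.
  rewrite (_ : (fun n => _) = fun n : nat => (t `^ mu / mu - (t / n.+2%:R) `^ mu / mu)%:E).
    apply: cvg_EFin; first exact: nearW.
    rewrite -[X in _ --> X]subr0; apply: cvgB; first exact: cvg_cst.
    rewrite -(mul0r mu^-1); apply: cvgMl.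
    have := @cvg_comp _ _ _ (fun n : nat => t / n.+2%:R) (fun x : R => x `^ mu) \oo _ _ _ (powR_cvg0 mu0).
    apply; move=> A [e /= e0 Ae].
    have /cvgrPdist_lt /(_ e e0) [N _ hN] := cvg_div_natS t.
    exists N => // n Nn /=; apply: Ae; rewrite /= ?divr_gt0//.
    by have := hN n.+1 (leqW Nn).
  apply/funext => n; rewrite integral_powR_cc ?divr_gt0//.
  by rewrite ltr_pdivrMr// ltr_pMr// ltr1n.
have := @ge0_nondecreasing_set_cvg_integral _ (measurableTypeR R) R F (fun x => (x `^ (mu - 1))%:E) leb.
rewrite FE => h; apply/esym/cvg_lim => //; apply: h => //.
- move=> m n mn; apply/subsetPset => x; rewrite /F /= !in_itv/= => /andP[h ->].
  rewrite andbT (le_trans _ h)// ler_pM2l// lef_pV2 ?posrE ?ltr0n// ler_nat.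
  by rewrite !ltnS.
- by move=> i; exact: measurable_itv.
- by move=> i; exact: mp.
- by move=> i x _; rewrite lee_fin powR_ge0.
Qed.

Lemma integrable_powR (mu t : R) : 0 < mu ->
  leb.-integrable `]0, t[ (fun x : R => (x `^ (mu - 1))%:E).
Proof.
move=> mu0; apply/integrableP; split.
  by apply/measurable_EFinP; apply: measurable_funTS; exact: measurable_powR.
have [t0|t0] := ltP 0 t; last first.
  by rewrite set_itv_ge ?integral_set0// -leNgt bnd_simp.
under eq_integral do rewrite gee0_abs ?lee_fin ?powR_ge0//.
by rewrite integral_powR// ltry.
Qed.

(** [powR] does not vanish at negative arguments, so it is cut there for use in full-line
    convolutions. *)
Definition pos_powR (a : R) : R -> R := (fun x => x `^ (a - 1)) \_ `]0, +oo[.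

Lemma pos_powRE a x : pos_powR a x = if 0 < x then x `^ (a - 1) else 0.
Proof. by rewrite /pos_powR patchE mem_setE in_itv/= andbT. Qed.

Lemma measurable_pos_powR a : measurable_fun setT (pos_powR a).
Proof.
have : measurable_fun (`]0, +oo[ : set R) (fun x : R => x `^ (a - 1)).
  by apply: measurable_funTS; exact: measurable_powR.
by move=> /(measurable_restrictT _ (measurable_itv _)).
Qed.

Lemma pos_powR_ge0 a x : 0 <= pos_powR a x.
Proof. by rewrite pos_powRE; case: ifP => // _; exact: powR_ge0. Qed.

Lemma pos_powRM a t x : 0 < t -> pos_powR a (t * x) = t `^ (a - 1) * pos_powR a x.
Proof.
move=> t0; rewrite !pos_powRE pmulr_rgt0//; case: ifP => x0; last by rewrite mulr0.
by rewrite powRM// ltW.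
Qed.

Definition Gamma_integrand (a : R) : R -> R := fun x => expR (- x) * pos_powR a x.

Lemma measurable_Gamma_integrand a : measurable_fun setT (Gamma_integrand a).
Proof.
apply: measurable_funM; last exact: measurable_pos_powR.
by apply: measurableT_comp => //; exact: measurable_oppr.
Qed.

Lemma Gamma_integrand_ge0 a x : 0 <= Gamma_integrand a x.
Proof. by rewrite mulr_ge0 ?expR_ge0// pos_powR_ge0. Qed.

Lemma integral_exp : (\int[leb]_x (Gamma_integrand 1 x)%:E = 1)%E.
Proof.
rewrite -(@integral_exponential_pdf R 1 ltr01).
transitivity (\int[leb]_(x in `]0%R, +oo[) (expR (- x))%:E)%E.
  rewrite [RHS]integral_mkcond; apply: eq_integral => x _.
  rewrite /Gamma_integrand /pos_powR !patchE; case: ifPn; rewrite ?mulr0// subrr powRr0 mulr1//.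
rewrite integral_itv_obnd_cbnd; last first.
  by apply/measurable_EFinP; apply: measurableT_comp => //; exact: measurable_oppr.
rewrite integral_mkcond; apply: eq_integral => x _.
by rewrite /exponential_pdf !patchE; case: ifPn => // _; rewrite mul1r mulN1r.
Qed.

(** Below 1 the power dominates the integrand, from 1 on the exponential does. *)
Lemma integrable_Gamma_integrand a : 0 < a <= 1 -> leb.-integrable setT (fun x => (Gamma_integrand a x)%:E).
Proof.
move=> /andP[a0 a1].
have i1 : leb.-integrable setT (EFin \o (pos_powR a \_ `]0, 1[)).
  rewrite -restrict_EFin; apply/integrable_restrict => //; rewrite setTI.
  apply: eq_integrable (integrable_powR 1 a0) => // x.
  by rewrite inE/= in_itv/= => /andP[x0 _]; rewrite pos_powRE x0.
have i2 : leb.-integrable setT (EFin \o Gamma_integrand 1).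
  apply/integrableP; split; first by apply/measurable_EFinP; exact: measurable_Gamma_integrand.
  under eq_integral do rewrite gee0_abs ?lee_fin ?Gamma_integrand_ge0//.
  by rewrite integral_exp ltry.
apply: (le_integrable measurableT _ _ (integrableD measurableT i1 i2)).
  by apply/measurable_EFinP; exact: measurable_Gamma_integrand.
move=> x _; rewrite lee_fin !ger0_norm ?Gamma_integrand_ge0//; last first.
  by rewrite addr_ge0 ?Gamma_integrand_ge0// patchE; case: ifP => // _; exact: pos_powR_ge0.
rewrite patchE mem_setE in_itv/= /Gamma_integrand !pos_powRE; case: ifPn => x0 /=; last by rewrite !mulr0 addr0.
have [x1|x1] := ltP x 1.
  rewrite ler_wpDr// ?mulr_ge0 ?expR_ge0 ?powR_ge0// ler_piMl ?powR_ge0//.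
  by rewrite -[leRHS]expR0 ler_expR oppr_le0 ltW.
rewrite add0r ler_wpM2l ?expR_ge0// subrr powRr0.
by rewrite -[leRHS](powRr0 x) ler_powR// subr_le0.
Qed.

Lemma GammaE a : (\int[leb]_x (Gamma_integrand a x)%:E)%E = (\int[leb]_(x in `]0%R, +oo[) (x `^ (a - 1) * expR (- x))%:E)%E.
Proof.
rewrite [RHS]integral_mkcond; apply: eq_integral => x _.
by rewrite /Gamma_integrand /pos_powR !patchE; case: ifP => _; rewrite ?mulr0// mulrC.
Qed.

Lemma GammaEFin a : 0 < a <= 1 -> (\int[leb]_x (Gamma_integrand a x)%:E)%E = (Gamma a)%:E.
Proof.
move=> a01; rewrite /Gamma /Rintegral -GammaE fineK//.
exact: integrable_fin_num (integrable_Gamma_integrand a01).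
Qed.

(** The integrand is at least [e^(-2) / 2] on [[1, 2]]. The bound is uniform in [a] and will control
    [1 / Gamma (alpha s)] for all [s]. *)
Lemma Gamma_lower (a : R) : 0 < a <= 1 -> expR (- 2) / 2 <= Gamma a.
Proof.
move=> a01; rewrite -lee_fin -GammaEFin//.
set c := expR (- 2) / 2.
have c0 : 0 <= c by rewrite divr_ge0 ?expR_ge0.
have -> : c%:E = (\int[leb]_x (c * \1_`[1, 2] x)%:E)%E.
  under eq_integral do rewrite EFinM.
  rewrite ge0_integralZl//; try exact/measurable_EFinP; try by move=> x _; rewrite lee_fin.
  have h : leb (`[1, 2]%classic : set R) = 1%E.
    by rewrite lebesgue_measure_itv/= lte_fin ltr1n -EFinD; congr EFin; lra.
  rewrite [X in (_ * X)%E](_ : _ = 1%E) ?mule1//.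
  by rewrite integral_indic// setIT; exact: h.
apply: ge0_le_integral => //.
- by move=> x _; rewrite lee_fin mulr_ge0.
- by apply/measurable_EFinP; exact: measurable_funM.
- by apply/measurable_EFinP; exact: measurable_Gamma_integrand.
move=> x _; rewrite lee_fin indicE.
case: (boolP (x \in _)) => [|_]; last by rewrite mulr0 Gamma_integrand_ge0.
rewrite inE/= in_itv/= mulr1 => /andP[x1 x2].
have x0 : 0 < x by rewrite (lt_le_trans _ x1).
rewrite /Gamma_integrand pos_powRE x0 ler_pM ?expR_ge0 ?invr_ge0//.
  by rewrite ler_expR lerN2.
case/andP: a01 => a0 _.
apply: (@le_trans _ _ (x `^ (-1))).
  by rewrite powR_inv1 ?(ltW x0)// lef_pV2 ?posrE.
by rewrite ler_powR// lerBrDr addNr ltW.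
Qed.

Lemma Gamma_gt0 (a : R) : 0 < a <= 1 -> 0 < Gamma a.
Proof. by move=> /Gamma_lower; apply: lt_le_trans; rewrite divr_gt0 ?expR_gt0. Qed.

(** The exponents [-a] and [a - 1] add up to -1, so by scaling the convolution is one constant [B]
    on the positive axis. With factors [e^(-x)] inserted it becomes [B e^(-s)], and integrating in
    [s] identifies [B] with the product of the two Gamma values. *)
Lemma beta_integral a t : 0 < a < 1 -> 0 < t ->
  (econv (EFin \o pos_powR (1 - a)) (EFin \o pos_powR a) t = (Gamma (1 - a) * Gamma a)%:E)%E.
Proof.
move=> /andP[a0 a1] t0.
set B := econv (EFin \o pos_powR (1 - a)) (EFin \o pos_powR a) 1.
have pos b x : (0 <= (EFin \o pos_powR b) x)%E by rewrite lee_fin pos_powR_ge0.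
have mE b : measurable_fun setT (EFin \o pos_powR b) by apply/measurable_EFinP; exact: measurable_pos_powR.
have scale s : 0 < s -> econv (EFin \o pos_powR (1 - a)) (EFin \o pos_powR a) s = B.
  move=> s0; rewrite /econv.
  rewrite (@ge0_integral_affine _ _ s 0)//; last 2 first.
  - apply: emeasurable_funM => //; apply: measurableT_comp => //; exact: measurable_funB.
  - by move=> x; exact: mule_ge0.
  rewrite -ge0_integralZl//; last 3 first.
  - apply/measurable_EFinP; apply: measurable_funM.
      by apply: measurableT_comp (measurable_pos_powR _) _; apply: measurable_funB => //; exact: measurable_affine.
    by apply: measurableT_comp (measurable_pos_powR _) _; exact: measurable_affine.
  - by move=> x _; exact: mule_ge0.
  - by rewrite lee_fin ltW.
  apply: eq_integral => x _ /=; rewrite addr0 -!EFinM; congr EFin.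
  have -> : s - s * x = s * (1 - x) by ring.
  rewrite !pos_powRM//; set p := pos_powR _ _; set q := pos_powR a x.
  have E : s * (s `^ (1 - a - 1) * s `^ (a - 1)) = 1.
    rewrite -{1}(powRr1 (ltW s0)) -!powRD ?(gt_eqF s0) ?implybT//.
    have -> : 1 + (1 - a - 1 + (a - 1)) = 0 :> R by ring.
    by rewrite powRr0.
  by transitivity (s * (s `^ (1 - a - 1) * s `^ (a - 1)) * (p * q)); [ring|rewrite E mul1r].
rewrite scale//.
have posphi b x : (0 <= (EFin \o Gamma_integrand b) x)%E by rewrite lee_fin Gamma_integrand_ge0.
have mphi b : measurable_fun setT (EFin \o Gamma_integrand b) by apply/measurable_EFinP; exact: measurable_Gamma_integrand.
have B0 : (0 <= B)%E by apply: econv_ge0.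
have eP s : econv (EFin \o pos_powR (1 - a)) (EFin \o pos_powR a) s = (B * (pos_powR 1 s)%:E)%E.
  rewrite pos_powRE; case: ifPn => s0.
    by rewrite scale// subrr powRr0 mule1.
  rewrite mule0 /econv integral0_eq// => x _ /=.
  rewrite !pos_powRE; case: ifPn => x1; last by rewrite mul0e.
  case: ifPn => x2; last by rewrite mule0.
  by exfalso; move: s0 x1 x2; rewrite -leNgt; lra.
have ephi s : econv (EFin \o Gamma_integrand (1 - a)) (EFin \o Gamma_integrand a) s = (B * (Gamma_integrand 1 s)%:E)%E.
  rewrite /Gamma_integrand EFinM muleCA -eP /econv -ge0_integralZl//.
  - apply: eq_integral => x _ /=; rewrite -!EFinM; congr EFin.
    by rewrite mulrACA -expRD; congr (expR _ * _); ring.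
  - by have /measurable_EFinP := measurable_cv_integrand s (measurable_pos_powR (1 - a)) (measurable_pos_powR a).
  - by move=> x _; exact: mule_ge0.
have := @integral_econv R (EFin \o Gamma_integrand (1 - a)) (EFin \o Gamma_integrand a) (mphi _) (mphi _) (posphi _) (posphi _).
under eq_integral do rewrite ephi.
move=> H; transitivity (\int[leb]_x (B * (Gamma_integrand 1 x)%:E))%E.
  have -> : (\int[leb]_x (B * (Gamma_integrand 1 x)%:E) = B * \int[leb]_x (Gamma_integrand 1 x)%:E)%E.
    by apply: ge0_integralZl; [exact: measurableT|exact: mphi|move=> x _; exact: posphi|exact: B0].
  by rewrite integral_exp mule1.
by rewrite H EFinM -!GammaEFin//; apply/andP; split; lra.
Qed.

End PowerKernel.

(** * Primitives and the kernels beta_a *)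

Section Primitive.
Variables (R : realType) (T : R).
Notation leb := (@lebesgue_measure R).
Implicit Types u v : R -> R.
Local Notation inT := (inT T).
Local Notation tcv := (tcv T).
Local Notation trunc := (trunc T).
Local Notation emb := (@emb R T).

Lemma measurable_trunc u : measurable_fun `]0, T[ u -> measurable_fun setT (trunc u).
Proof. by move=> /(measurable_restrictT _ (measurable_itv _)). Qed.

Lemma trunc_id u : inT u -> trunc u = u.
Proof.
by move=> [_ u0]; apply/funext => t; rewrite truncE; case: ifPn => // h; rewrite u0.
Qed.

(** Links [conv], an integral over [[0, t]], to the ring: truncation at [T] is invisible for
    [t < T], and the end points are negligible. *)
Lemma conv_tcv u v t : measurable_fun `]0, T[ u -> measurable_fun `]0, T[ v ->
  0 < t < T -> conv u v t = tcv (trunc u) (trunc v) t.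
Proof.
move=> /measurable_trunc mu /measurable_trunc mv tT.
have /andP[t0 tT'] := tT.
rewrite /tcv trunc_in// /conv /cv /Rintegral; congr fine.
have e s : s \in `]0, t[ -> trunc u (t - s) * trunc v s = u (t - s) * v s.
  rewrite in_itv/= => /andP[s0 st]; rewrite !trunc_in//; apply/andP; split=> //.
  - exact: lt_trans st tT'.
  - by rewrite subr_gt0.
  - by rewrite ltrBlDr (lt_le_trans tT')// lerDl ltW.
have M : measurable_fun (`]0, t[%classic : set R) (fun s : R => trunc u (t - s) * trunc v s).
  by apply: measurable_funTS; exact: measurable_cv_integrand.
rewrite integral_itv_bndoo; last first.
  apply/measurable_EFinP; apply: eq_measurable_fun M => s.
  by rewrite inE/= => hs; exact: e.
rewrite [LHS]integral_mkcond; apply: eq_integral => s _; rewrite patchE; case: ifPn.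
  by rewrite inE/= => hs; rewrite e.
rewrite notin_setE/= in_itv/= => /negP hs.
suff -> : trunc u (t - s) * trunc v s = 0 by [].
have [s0|s0] := leP s 0; first by rewrite (trunc_out v) ?mulr0// ltNge s0.
rewrite (trunc_out u) ?mul0r// negb_and -leNgt subr_le0.
by move: hs; rewrite negb_and s0 /= -leNgt => ->.
Qed.

Lemma lebesgue_oo_lty (a b : R) : (leb (`]a, b[%classic : set R) < +oo)%E.
Proof. by rewrite lebesgue_measure_itv/=; case: ifP => _; rewrite ?ltry. Qed.

Definition one : R -> R := trunc (cst 1).

Lemma inT_one : inT one.
Proof.
apply: inT_trunc; apply/integrableP; split.
  by apply/measurable_EFinP; exact: measurable_cst.
under eq_integral do rewrite /= normr1.
by rewrite integral_cst// mul1e; exact: lebesgue_oo_lty.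
Qed.

Lemma tcv_one u t : inT u -> 0 < t < T -> tcv one u t = \int[leb]_(s in `[0, t]) u s.
Proof.
move=> iu tT; rewrite -{1}(trunc_id iu) -conv_tcv//.
  by rewrite /conv; apply: eq_Rintegral => s _; rewrite mul1r.
by apply: measurable_funTS; exact: inT_measurable iu.
Qed.

Lemma inT_integrable u (A : set R) : measurable A -> inT u -> leb.-integrable A (EFin \o u).
Proof. by move=> mA [iu _]; exact: integrableS iu. Qed.

Lemma continuous_primitive u (a b : R) : a <= b ->
  leb.-integrable `[a, b] (EFin \o u) ->
  {within `[a, b], continuous (fun t => \int[leb]_(s in `[a, t]) u s)}.
Proof. by move=> ab iu; exact: parameterized_integral_continuous. Qed.

Lemma continuous_ae_eq0 (F : R -> R) :
  (forall t, 0 < t < T -> {for t, continuous F}) ->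
  {ae leb, forall t, 0 < t < T -> F t = 0} -> forall t, 0 < t < T -> F t = 0.
Proof.
move=> cF [N [mN N0 hN]] t tT; apply/eqP; apply: contraT => Ft.
have : \forall s \near t, F s != 0.
  have /cvgrPdist_lt /(_ `|F t|) := cF t tT.
  rewrite normr_gt0 Ft => /(_ isT); apply: filterS => s; apply: contraTneq => ->.
  by rewrite subr0 ltxx.
have tI : t \in `]0, T[ by rewrite in_itv.
move=> /(filterI (near_in_itvoo tI)) [e /= e0 he].
have sub : ball t e `<=` N.
  by move=> s /he [sI Fs]; apply: hN => /= /(_ sI)/eqP; exact/negP.
have : (leb (ball t e) <= leb N)%E.
  by apply: le_measure => //; rewrite inE//; exact: measurable_ball.
rewrite N0 lebesgue_measure_ball ?(ltW e0)// lee_fin leNgt.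
by rewrite pmulrn_lgt0 ?e0.
Qed.

(** The primitive is continuous, hence vanishes everywhere on []0, T[], and Lebesgue differentiation
    recovers [u]. *)
Lemma primitive_ae_eq0 u : inT u -> {ae leb, forall t, tcv one u t = 0} ->
  {ae leb, forall t, u t = 0}.
Proof.
move=> iu h.
pose F t := \int[leb]_(s in `[0, t]) u s.
have [T0|T0] := leP T 0.
  by apply: ae_all => t; apply: iu.2; apply/negP => /andP[h1 h2]; lra.
have cF : forall t, 0 < t < T -> {for t, continuous F}.
  have := continuous_primitive (ltW T0) (inT_integrable (measurable_itv _) iu).
  move=> /(continuous_within_itvP _ T0)[c _ _] t tT.
  by apply: c; rewrite in_itv.
have F0 : forall t, 0 < t < T -> F t = 0.
  apply: continuous_ae_eq0 => //.
  by move: h; apply: ae_imply => t h tT; rewrite /F -(tcv_one iu tT).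
have := @FTC1 R u (BLeft 0) _ _.
move=> /(_ (fun y => inT_integrable (measurable_itv _) iu)).
have li : locally_integrable setT u.
  have := @integrable_locally R u setT measurableT iu.1.
  by rewrite patch_setT.
move=> /(_ li); apply: ae_imply => t ht.
have [tT|] := boolP (0 < t < T); last exact: iu.2.
have [|_ <-] := ht; first by move: tT => /andP[t0 _]; first [exact: t0 | exact: (ltW t0)].
rewrite derive1E (@near_eq_derive _ _ _ _ (cst 0))//; first exact: derive_cst.
have tI : t \in `]0, T[ by rewrite in_itv.
by near=> s; apply: F0; have : s \in `]0, T[ by [near: s; exact: near_in_itvoo]; rewrite in_itv.
Unshelve. all: by end_near. Qed.

(** The constant function 1 is not a zero divisor. This undoes convolution with [beta_(1-a)] after
    multiplying by [beta_a], their product being 1. *)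
Lemma emb_one_inj u v : inT u -> inT v -> emb one * emb u = emb one * emb v -> emb u = emb v.
Proof.
move=> iu iv h; apply/eqP; rewrite -subr_eq0 -embB//; apply/eqP.
apply/emb0; first exact: inTB.
apply: primitive_ae_eq0; first exact: inTB.
apply/emb0; first by apply: inT_tcv; [exact: inT_one|exact: inTB].
by rewrite (embM inT_one (inTB iu iv)) (embB iu iv) mulrBr h subrr.
Qed.

Definition Bk (a : R) : R -> R := trunc (beta_ a).

Lemma BkE a t : 0 < t < T -> Bk a t = t `^ (a - 1) / Gamma a.
Proof. by move=> tT; rewrite /Bk trunc_in. Qed.

Lemma measurable_beta a (A : set R) : measurable_fun A (beta_ a).
Proof.
apply: measurable_funTS; apply: measurable_funM => //; exact: measurable_powR.
Qed.

Lemma inT_Bk a : 0 < a -> inT (Bk a).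
Proof.
move=> a0; apply: inT_trunc.
have := @integrableZr _ _ _ leb `]0, T[ (measurable_itv _) (Gamma a)^-1 _ (integrable_powR T a0).
by apply: eq_integrable => // t _; rewrite /beta_ /= EFinM.
Qed.

Lemma Bk_ge0 a t : 0 < a <= 1 -> 0 <= Bk a t.
Proof.
move=> a01; rewrite /Bk truncE; case: ifP => // _.
by rewrite divr_ge0 ?powR_ge0// ltW// Gamma_gt0.
Qed.

Lemma tcv_Bk a : 0 < a < 1 -> tcv (Bk (1 - a)) (Bk a) = one.
Proof.
move=> a01; apply/funext => t; rewrite /tcv /one !truncE; case: ifPn => // tT.
have /andP[t0 tT'] := tT; have /andP[a0 a1] := a01.
have g1 : 0 < Gamma (1 - a) by apply: Gamma_gt0; apply/andP; split; lra.
have g2 : 0 < Gamma a by apply: Gamma_gt0; apply/andP; split; lra.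
have G1 : Gamma (1 - a) != 0 by rewrite (gt_eqF g1).
have G2 : Gamma a != 0 by rewrite (gt_eqF g2).
have := beta_integral a01 t0.
rewrite /cv /Rintegral.
set c := (Gamma (1 - a) * Gamma a)^-1.
have c0 : 0 <= c by rewrite invr_ge0 (mulr_ge0 (ltW g1) (ltW g2)).
have -> : (\int[leb]_s (Bk (1 - a) (t - s) * Bk a s)%:E)%E =
   (c%:E * econv (EFin \o pos_powR (1 - a)) (EFin \o pos_powR a) t)%E.
  rewrite /econv -ge0_integralZl//.
  - apply: eq_integral => s _ /=; rewrite -!EFinM; congr EFin.
    have [s0|s0] := leP s 0.
      by rewrite /Bk (trunc_out (beta_ a)) ?pos_powRE ?ltNge ?s0//= !mulr0.
    have [st|st] := leP t s.
      have h : (0 < t - s) = false by rewrite subr_gt0 ltNge st.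
      by rewrite /Bk (trunc_out (beta_ (1 - a))) ?h// (pos_powRE (1 - a)) h !mul0r mulr0.
    rewrite !BkE ?pos_powRE ?s0 ?subr_gt0 ?st ?(lt_trans st)//; last first.
      by rewrite ltrBlDr (lt_le_trans tT')// lerDl ltW.
    by rewrite /c invfM; ring.
  - by have /measurable_EFinP := measurable_cv_integrand t (measurable_pos_powR (1 - a)) (measurable_pos_powR a).
  - by move=> s _; rewrite mule_ge0// lee_fin pos_powR_ge0.
move=> ->; rewrite -EFinM /= /c mulVf//.
by rewrite mulf_neq0.
Qed.

Definition tM u : R -> R := fun t => t * u t.

Lemma inT_tM u : inT u -> inT (tM u).
Proof.
move=> [iu u0]; split; last by move=> t h; rewrite /tM u0// mulr0.
have iw := integrableZl measurableT `|T| iu.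
apply: (le_integrable measurableT _ _ iw).
  by apply/measurable_EFinP; apply: measurable_funM => //; exact: integrable_measurable.
move=> t _; rewrite /= lee_fin /tM !normrM normr_id.
have [tT|tT] := boolP (0 < t < T); last by rewrite u0// normr0 !mulr0.
have /andP[t0 tT'] := tT.
by rewrite ler_wpM2r// !gtr0_norm// ?ltW// (lt_trans t0).
Qed.

(** Leibniz rule for multiplication by [t], from [t = (t - s) + s] under the integral. *)
Lemma tM_tcv u v : inT u -> inT v ->
  {ae leb, forall t, tM (tcv u v) t = tcv (tM u) v t + tcv u (tM v) t}.
Proof.
move=> iu iv; have iu' := inT_tM iu; have iv' := inT_tM iv.
have := ae_and (ae_econv_fin iu.1 iv.1) (ae_and (ae_econv_fin iu'.1 iv.1) (ae_econv_fin iu.1 iv'.1)).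
have mu := inT_measurable iu; have mv := inT_measurable iv.
have mu' := inT_measurable iu'; have mv' := inT_measurable iv'.
apply: ae_imply => t [h1 [h2 h3]]; rewrite {1}/tM /tcv !truncE.
case: ifPn => tT; last by rewrite mulr0 addr0.
rewrite /cv -RintegralD//; [|exact/cv_integrableP|exact/cv_integrableP].
rewrite -RintegralZl//; last exact/cv_integrableP.
by apply: eq_Rintegral => s _; rewrite /tM; ring.
Qed.

(** Both sides equal [t^a / Gamma a] on []0, T[]. With the Leibniz rule this yields the bound
    [t r <= al] on the resolvent. *)
Lemma tM_Bk a : 0 < a -> tM (Bk a) = fun t => a * tcv one (Bk a) t.
Proof.
move=> a0; apply/funext => t; rewrite /tM.
have [tT|tT] := boolP (0 < t < T); last by rewrite /tcv /Bk !trunc_out// !mulr0.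
have /andP[t0 tT'] := tT.
rewrite tcv_one//; last exact: inT_Bk.
have -> : \int[leb]_(s in `[0, t]) Bk a s = t `^ a / a / Gamma a.
  rewrite /Rintegral integral_itv_bndoo; last first.
    by apply/measurable_EFinP; apply: measurable_funTS; exact: inT_measurable (inT_Bk a0).
  have -> : (\int[leb]_(s in `]0%R, t[) (Bk a s)%:E =
      \int[leb]_(s in `]0%R, t[) ((s `^ (a - 1))%:E * ((Gamma a)^-1)%:E))%E.
    apply: eq_integral => s; rewrite inE/= in_itv/= => /andP[s0 st]; rewrite BkE ?EFinM//.
    by rewrite s0 (lt_trans st).
  rewrite integralZr//; last exact: integrable_powR.
  by rewrite integral_powR.
rewrite BkE// mulrA mulr_powRB1 ?(ltW t0)//.
by rewrite mulrA (mulrC a) divfK// gt_eqF.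
Qed.

End Primitive.

(** * Positivity for weakly singular Volterra equations *)

Lemma ler_powRl (R : realType) (r x y : R) : 0 <= r -> 0 <= x -> x <= y -> x `^ r <= y `^ r.
Proof. by move=> r0 x0 xy; rewrite ge0_ler_powR// nnegrE// (le_trans x0). Qed.

Section VolterraPos.
Variable R : realType.
Notation leb := (@lebesgue_measure R).

Lemma integral_powR_reflect (mu u t : R) : 0 < mu -> u < t ->
  (\int[leb]_(s in `]u, t[) ((t - s) `^ (mu - 1))%:E = ((t - u) `^ mu / mu)%:E)%E.
Proof.
move=> mu0 ut; have tu : 0 < t - u by rewrite subr_gt0.
rewrite -(integral_powR mu0 tu).
rewrite [LHS]integral_mkcond [RHS]integral_mkcond.
have mf : measurable_fun setT ((fun x : R => (x `^ (mu - 1))%:E) \_ `]0%R, (t - u)[).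
  have : measurable_fun (`]0%R, (t - u)[%classic : set R) (fun x : R => (x `^ (mu - 1))%:E).
    by apply/measurable_EFinP; apply: measurable_funTS; exact: measurable_powR.
  by move=> /(measurable_restrictT _ (measurable_itv _)).
rewrite -(integral_reflect t mf); apply: eq_integral => s _.
rewrite !patchE !mem_setE !in_itv/= subr_gt0 ltrD2l ltrN2 andbC.
by [].
Qed.

Lemma integrable_powR_reflect (mu u t : R) : 0 < mu ->
  leb.-integrable `]u, t[ (fun s : R => ((t - s) `^ (mu - 1))%:E).
Proof.
move=> mu0; apply/integrableP; split.
  apply/measurable_EFinP; apply: measurable_funTS.
  by apply: (@measurable_subl R (@powR R ^~ (mu - 1)) t); exact: measurable_powR.
have [ut|ut] := ltP u t; last first.
  by rewrite set_itv_ge ?integral_set0// -leNgt bnd_simp.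
under eq_integral do rewrite gee0_abs ?lee_fin ?powR_ge0//.
by rewrite integral_powR_reflect// ltry.
Qed.

Variables (mu c T1 : R).
Hypotheses (mu0 : 0 < mu) (mu1 : mu < 1) (c0 : 0 < c).
Let a (x : R) := c * x `^ (mu - 1).

Let a_gt0 x : 0 < x -> 0 < a x.
Proof. by move=> x0; rewrite mulr_gt0// powR_gt0. Qed.

Let a_le x y : 0 < x -> x <= y -> a y <= a x.
Proof.
move=> x0 xy; rewrite ler_pM2l//.
have y0 := lt_le_trans x0 xy.
rewrite -[mu - 1]opprB !powRN lef_pV2 ?posrE ?powR_gt0//.
by apply: ler_powRl => //; [rewrite subr_ge0 ltW|exact: ltW].
Qed.

Lemma integrable_kernel_cont (D : R -> R) (u v t : R) : v <= t ->
  (forall s, u <= s <= v -> {for s, continuous D}) ->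
  leb.-integrable `]u, v[ (fun s => (a (t - s) * D s)%:E).
Proof.
move=> vt cD.
have [uv|uv] := ltP u v; last by rewrite set_itv_ge ?integrable_set0// -leNgt bnd_simp.
have cD' : {within `[u, v], continuous D}.
  by apply: continuous_in_subspaceT => s; rewrite inE/= in_itv/= => /cD.
have [x xuv xmax] := EVT_max (ltW uv) cD'.
have [y yuv ymin] := EVT_min (ltW uv) cD'.
pose M := Num.max `|D x| `|D y|.
have Dle s : s \in `]u, v[ -> `|D s| <= M.
  move=> /subset_itv_oo_cc suv; rewrite ler_norml; apply/andP; split.
    by apply: le_trans (ymin _ suv); rewrite lerNl (le_trans (ler_norm _))// normrN le_max lexx orbT.
  by apply: le_trans (xmax _ suv) _; rewrite (le_trans (ler_norm _))// le_max lexx.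
have mD : measurable_fun (`]u, v[ : set R) D.
  apply: (@measurable_funS _ _ _ _ `[u, v]%classic) => //; first exact: subset_itv_oo_cc.
  exact: subspace_continuous_measurable_fun.
have sub : `]u, v[ `<=` `]u, t[.
  by move=> s /=; rewrite !in_itv/= => /andP[-> h]; exact: lt_le_trans h vt.
have i0 : leb.-integrable `]u, v[ (fun s : R => ((t - s) `^ (mu - 1))%:E).
  by apply: integrableS (integrable_powR_reflect u t mu0) => //; exact: measurable_itv.
have i1 := @integrableZl _ _ _ leb `]u, v[ (measurable_itv _) (c * M) _ i0.
apply: (le_integrable _ _ _ i1) => //.
  apply/measurable_EFinP; apply: measurable_funM => //; apply: measurable_funTS.
  apply: measurable_funM => //.
  by apply: (@measurable_subl R (@powR R ^~ (mu - 1)) t); exact: measurable_powR.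
move=> s suv; rewrite /= lee_fin /a !normrM (gtr0_norm c0) -!mulrA ler_pM2l// mulrC.
by rewrite ler_wpM2r// (le_trans (Dle _ suv))// ler_norm.
Qed.

Variables (D p : R -> R).
Hypothesis cD : forall t, 0 <= t <= T1 -> {for t, continuous D}.
Hypothesis eqD : forall t, 0 <= t <= T1 ->
  D t + \int[leb]_(s in `]0, t[) (a (t - s) * D s) = p t.
Hypothesis p_gt0 : forall t, 0 <= t <= T1 -> 0 < p t.
(** Equivalently, since [p > 0], the kernel [a (t - s)] divided by [p t] is nonincreasing in
    [t > s]. *)
Hypothesis p_ratio : forall s t t', 0 <= s -> s < t -> t < t' -> t' <= T1 ->
  p t * a (t' - s) <= p t' * a (t - s).

(* Otherwise let t1 be the first zero of D; just before t1, at a maximum point t of D on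
   [t1 - d, t1], the ratio condition bounds D t by D t / 2. *)
Lemma volterra_pos t : 0 <= t <= T1 -> 0 < D t.
Proof.
move=> tT; rewrite ltNge; apply/negP => Dt0.
pose Z := [set x | 0 <= x <= T1 /\ D x <= 0].
have Zt : Z t by [].
have hi : has_inf Z by split; [exists t|exists 0 => x [/andP[]]].
pose t1 := inf Z.
have lbZ x : Z x -> t1 <= x by move=> Zx; apply: ge_inf => //; exact: hi.2.
have t1_ge0 : 0 <= t1 by apply: lb_le_inf; [exists t|move=> x [/andP[]]].
have t1T : t1 <= T1 by apply: le_trans (lbZ _ Zt) _; case/andP: tT.
have t1I : 0 <= t1 <= T1 by rewrite t1_ge0.
have before x : 0 <= x -> x < t1 -> 0 < D x.
  move=> x0 xt1; rewrite ltNge; apply/negP => Dx.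
  have : Z x by split => //; rewrite x0 (le_trans (ltW xt1)).
  by move=> /lbZ; rewrite leNgt xt1.
have Dt1 : D t1 <= 0.
  rewrite leNgt; apply/negP => Dt1.
  have /cvgrPdist_lt /(_ _ Dt1) [e /= e0 he] := cD t1I.
  have [y [yT Dy] yt1] := inf_adherent e0 hi.
  have t1y := lbZ _ (conj yT Dy).
  have ye : `|t1 - y| < e by rewrite distrC ger0_norm ?subr_ge0// ltrBlDl.
  by have := he y ye; rewrite /= ltr_norml => /andP[_ h]; lra.
have D0 : 0 < D 0.
  have T10 : 0 <= (0 : R) <= T1 by rewrite lexx (le_trans t1_ge0).
  have := eqD T10; rewrite set_itv_ge ?bnd_simp ?ltxx// Rintegral_set0 addr0 => ->.
  exact: p_gt0.
have t1_gt0 : 0 < t1.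
  by rewrite lt_neqAle t1_ge0 andbT; apply: contraTneq Dt1 => <-; rewrite -ltNge.
(* [M] bounds [p x / p t1] for [x] in [[t1 / 2, t1[], by the ratio condition at [s = 0]. The length
   [d] makes the mass of the kernel over the last stretch, times [M], at most 1/2. *)
pose M := a (t1 / 2) / a t1.
have M0 : 0 < M by rewrite divr_gt0 ?a_gt0 ?divr_gt0.
pose d := Num.min (t1 / 2) ((mu / (2 * c * M)) `^ mu^-1).
have q0 : 0 < mu / (2 * c * M) by rewrite divr_gt0// mulr_gt0// mulr_gt0.
have d0 : 0 < d by rewrite lt_min divr_gt0// powR_gt0.
have dt1 : d <= t1 / 2 by rewrite ge_min lexx.
have dM : M * (c * (d `^ mu / mu)) <= 1 / 2.
  have : d `^ mu <= mu / (2 * c * M).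
    have E : ((mu / (2 * c * M)) `^ mu^-1) `^ mu = mu / (2 * c * M).
      by rewrite -powRrM mulVf ?(lt0r_neq0 mu0)// powRr1// ltW.
    rewrite -[leRHS]E.
    by apply: ler_powRl; rewrite ?(ltW mu0) ?(ltW d0)// ge_min lexx orbT.
  move=> h; have -> : 1 / 2 = M * (c * (mu / (2 * c * M) / mu)).
    by field; rewrite !lt0r_neq0.
  by rewrite ler_pM2l// ler_pM2l// ler_pM2r ?invr_gt0.
have cDd : {within `[t1 - d, t1], continuous D}.
  apply: continuous_in_subspaceT => s; rewrite inE/= in_itv/= => /andP[h1 h2].
  by apply: cD; apply/andP; split; lra.
have [x] := EVT_max (ltac:(lra) : t1 - d <= t1) cDd.
rewrite in_itv/= => /andP[x1 x2] xmax.
have Dx : 0 < D x.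
  apply: lt_le_trans (xmax (t1 - d) _); last by rewrite in_itv/= lexx; lra.
  by apply: before; lra.
have xt1 : x < t1.
  by rewrite lt_neqAle x2 andbT; apply: contraTneq Dx => ->; rewrite -leNgt.
have x0 : 0 < x by lra.
have xI : 0 <= x <= T1 by apply/andP; split; lra.
have px := p_gt0 xI; have pt1 := p_gt0 t1I.
have pM : p x <= M * p t1.
  have := p_ratio (lexx 0) x0 xt1 t1T; rewrite !subr0 => h.
  rewrite /M mulrAC ler_pdivlMr ?a_gt0//; apply: le_trans h _.
  by rewrite mulrC ler_pM2r// a_le//; lra.
have iDt1 u v : 0 <= u -> v <= t1 -> leb.-integrable `]u, v[ (EFin \o (fun s => a (t1 - s) * D s)).
  move=> u0 vt1; apply: integrable_kernel_cont => // s /andP[h1 h2].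
  by apply: cD; apply/andP; split; lra.
have iDx u v : 0 <= u -> v <= x -> leb.-integrable `]u, v[ (EFin \o (fun s => a (x - s) * D s)).
  move=> u0 vt1; apply: integrable_kernel_cont => // s /andP[h1 h2].
  by apply: cD; apply/andP; split; lra.
pose A := \int[leb]_(s in `]0, x[) (a (t1 - s) * D s).
pose J := \int[leb]_(s in `]0, x[) (a (x - s) * D s).
have split1 : \int[leb]_(s in `]0, t1[) (a (t1 - s) * D s) =
    A + \int[leb]_(s in `]x, t1[) (a (t1 - s) * D s).
  have := @Rintegral_itvB R (fun s => a (t1 - s) * D s) (BRight 0) (BLeft t1) x (iDt1 0 t1 (lexx _) (lexx _)).
  rewrite !bnd_simp => /(_ (ltW x0) xt1) <-.
  rewrite -Rintegral_itv_bndo_bndc; first by rewrite /A addrC subrK.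
  exact: (iDt1 0 x).
have tail : \int[leb]_(s in `]x, t1[) (a (t1 - s) * D s) <= D x * (c * (d `^ mu / mu)).
  apply: (@le_trans _ _ (\int[leb]_(s in `]x, t1[) ((D x * c) * (t1 - s) `^ (mu - 1)))).
    apply: le_Rintegral => //.
    - by apply: iDt1 => //; exact: ltW.
    - by have := @integrableZl _ _ _ leb _ (measurable_itv _) (D x * c) _ (integrable_powR_reflect x t1 mu0).
    - move=> s; rewrite /= in_itv/= => /andP[h1 h2]; rewrite /a mulrAC (mulrC _ (D s)) -!mulrA.
      rewrite ler_wpM2r//; last by apply: xmax; rewrite in_itv/=; apply/andP; split; lra.
      by rewrite mulr_ge0 ?powR_ge0// ltW.
  rewrite RintegralZl//; last exact: integrable_powR_reflect.
  rewrite /Rintegral integral_powR_reflect//= -mulrA ler_pM2l// ler_pM2l// ler_pM2r ?invr_gt0//.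
  by apply: ler_powRl; rewrite ?(ltW mu0)//; lra.
(* Before [x] the values of [D] are positive, so the ratio condition can be integrated against
   them. *)
have JA : p x * A <= p t1 * J.
  rewrite /A /J.
  rewrite -(@RintegralZl _ _ _ leb _ _ (p x) (measurable_itv _) (iDt1 0 x (lexx _) x2)).
  rewrite -(@RintegralZl _ _ _ leb _ _ (p t1) (measurable_itv _) (iDx 0 x (lexx _) (lexx _))).
  apply: le_Rintegral => //.
  - by have := @integrableZl _ _ _ leb _ (measurable_itv _) (p x) _ (iDt1 0 x (lexx _) x2).
  - by have := @integrableZl _ _ _ leb _ (measurable_itv _) (p t1) _ (iDx 0 x (lexx _) (lexx _)).
  - move=> s; rewrite /= in_itv/= => /andP[h1 h2]; rewrite mulrA [leRHS]mulrA ler_wpM2r//.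
      by apply/ltW/before; [exact: ltW|exact: lt_trans xt1].
    by apply: p_ratio => //; exact: ltW.
have e1 := eqD t1I; have e2 := eqD xI.
rewrite split1 in e1; rewrite -/J in e2.
set tl := \int[leb]_(s in `]x, t1[) _ in e1 tail.
set k := c * (d `^ mu / mu) in dM tail.
(* Here [D t1 <= 0] enters; comparing with the equation at [x] then gives [D x <= D x / 2]. *)
have h1 : p t1 <= A + D x * k by lra.
have h2 : p x * p t1 <= p t1 * J + p x * (D x * k).
  have : p x * p t1 <= p x * (A + D x * k) by rewrite ler_pM2l.
  by rewrite mulrDr; lra.
have h3 : p x * (D x * k) <= p t1 * (D x / 2).
  have k0 : 0 <= k by rewrite mulr_ge0 ?divr_ge0 ?powR_ge0// ltW.
  apply: (@le_trans _ _ (M * p t1 * (D x * k))).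
    by rewrite ler_wpM2r// mulr_ge0// ltW.
  have -> : M * p t1 * (D x * k) = p t1 * (D x * (M * k)) by ring.
  by rewrite ler_pM2l// ler_pM2l//; lra.
have h4 : p t1 * p x <= p t1 * (J + D x / 2) by rewrite mulrDr; lra.
by rewrite ler_pM2l// in h4; lra.
Qed.

End VolterraPos.

(** * Pointwise associativity *)

Section BoundedAssoc.
Variables (R : realType) (T : R).
Notation leb := (@lebesgue_measure R).
Implicit Types u v w : R -> R.
Local Notation inT := (inT T).
Local Notation tcv := (tcv T).
Local Notation emb := (@emb R T).

Lemma econv_bounded (u : R -> R) (C : R) (G : R -> \bar R) t :
  measurable_fun setT u -> measurable_fun setT G -> (forall x, 0 <= G x)%E ->
  (forall x, `|u x| <= C) -> (econv (eabs u) G t <= C%:E * \int[leb]_x G x)%E.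
Proof.
move=> mu mG G0 uC.
have C0 : 0 <= C by apply: le_trans (uC 0).
rewrite -ge0_integralZl//; apply: ge0_le_integral => //.
- by move=> x _; apply: mule_ge0 => //; exact: eabs_ge0.
- apply: emeasurable_funM => //; apply/measurable_EFinP.
  by apply: measurableT_comp => //; exact: measurable_subl.
- exact: measurable_funeM.
- by move=> x _; apply: lee_wpmul2r => //; rewrite lee_fin.
Qed.

Lemma econv_bounded_fin u v C t : measurable_fun setT u -> inT v -> (forall x, `|u x| <= C) ->
  (econv (eabs u) (eabs v) t < +oo)%E.
Proof.
move=> mu iv uC; have mv := inT_measurable iv.
apply: le_lt_trans (econv_bounded t mu (measurable_eabs mv) (@eabs_ge0 R v) uC) _.
rewrite lte_mul_pinfty// ?lee_fin ?(le_trans _ (uC 0))//.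
by case: iv => iv _; exact: integral_eabs_fin.
Qed.

Lemma tcvE u v t : 0 < t < T -> tcv u v t = cv u v t.
Proof. by move=> tT; exact: trunc_in. Qed.

Lemma tcv_out u v t : ~~ (0 < t < T) -> tcv u v t = 0.
Proof. exact: trunc_out. Qed.

(** A bounded factor makes the triple integral finite at every [t], so associativity holds
    pointwise; the Volterra equation for [S] below is needed at every point. *)
Lemma tcvA_bounded_l u v w (C : R) : inT u -> inT v -> inT w -> (forall x, `|u x| <= C) ->
  tcv u (tcv v w) = tcv (tcv u v) w.
Proof.
move=> iu iv iw uC; apply/funext => t.
have [tT|tT] := boolP (0 < t < T); last by rewrite (tcv_out _ _ tT) (tcv_out _ _ tT).
rewrite !(tcvE _ _ tT) cv_tcvr// cv_tcvl// cvA//; [exact: inT_measurable iu|exact: inT_measurable iv|exact: inT_measurable iw|].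
have me x : inT x -> measurable_fun setT (eabs x) by move=> /inT_measurable; exact: measurable_eabs.
have m := measurable_econv (me _ iv) (me _ iw) (@eabs_ge0 R v) (@eabs_ge0 R w).
have p x := econv_ge0 x (@eabs_ge0 R v) (@eabs_ge0 R w).
apply: le_lt_trans (econv_bounded t (inT_measurable iu) m p uC) _.
rewrite lte_mul_pinfty// ?lee_fin ?(le_trans _ (uC 0))//.
exact: integral_econv_fin iv.1 iw.1.
Qed.

Lemma tcvA_bounded_m u v w (C : R) : inT u -> inT v -> inT w -> (forall x, `|v x| <= C) ->
  tcv u (tcv v w) = tcv (tcv u v) w.
Proof.
move=> iu iv iw vC; rewrite (tcvC iu (inT_tcv iv iw)) -(tcvA_bounded_l iv iw iu vC).
by rewrite (tcvC iu iv) -(tcvA_bounded_l iv iu iw vC) (tcvC iw iu).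
Qed.

Lemma tcv_bounded u v (C : R) t : inT u -> inT v -> (forall x, `|u x| <= C) ->
  `|tcv u v t| <= C * fine (L1norm v).
Proof.
move=> iu iv uC.
have C0 : 0 <= C by apply: le_trans (uC 0).
have [tT|tT] := boolP (0 < t < T); last first.
  by rewrite (tcv_out _ _ tT) normr0 mulr_ge0// fine_ge0// L1norm_ge0.
rewrite (tcvE _ _ tT) -lee_fin.
have mu := inT_measurable iu; have mv := inT_measurable iv.
apply: le_trans (eabs_cv_le t mu mv) _.
apply: le_trans (econv_bounded t mu (measurable_eabs mv) (@eabs_ge0 R v) uC) _.
have fn : L1norm v \is a fin_num by rewrite ge0_fin_numE ?L1norm_ge0//; apply: (@L1norm_fin _ T).
by rewrite EFinM fineK.
Qed.

Lemma one_bound x : `|one T x| <= (1 : R).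
Proof. by rewrite /one truncE; case: ifP; rewrite ?normr1 ?normr0. Qed.

Lemma tcv_ge0 u v t : (forall x, 0 <= u x) -> (forall x, 0 <= v x) -> 0 <= tcv u v t.
Proof.
move=> u0 v0; rewrite /tcv truncE; case: ifP => // _.
by apply: Rintegral_ge0 => s _; rewrite mulr_ge0.
Qed.

Lemma emb_tM u v : inT u -> inT v ->
  emb (tM (tcv u v)) = emb (tM u) * emb v + emb u * emb (tM v).
Proof.
move=> iu iv; have iu' := inT_tM iu; have iv' := inT_tM iv.
rewrite -!embM// -embD; [|exact: inT_tcv|exact: inT_tcv].
apply/emb_eq; [by apply: inT_tM; exact: inT_tcv|by apply: inTD; exact: inT_tcv|].
exact: tM_tcv.
Qed.

Lemma tMD u v : tM (u \+ v) = tM u \+ tM v.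
Proof. by apply/funext => t; rewrite /tM /= mulrDr. Qed.

Lemma emb_eq_tM u v : inT u -> inT v -> emb u = emb v -> emb (tM u) = emb (tM v).
Proof.
move=> iu iv /(emb_eq iu iv) h; apply/emb_eq; [exact: inT_tM|exact: inT_tM|].
by move: h; apply: ae_imply => t h; rewrite /tM h.
Qed.

End BoundedAssoc.

(** * The Mittag-Leffler resolvent *)

Lemma Rintegral_shift_itv (R : realType) (f : R -> R) (t h : R) :
  measurable_fun (`]h, (t + h)[ : set R) f ->
  \int[@lebesgue_measure R]_(s in `]0, t[) f (s + h) =
  \int[@lebesgue_measure R]_(s in `]h, (t + h)[) f s.
Proof.
move=> mf; rewrite [LHS]Rintegral_mkcond [RHS]Rintegral_mkcond /Rintegral; congr fine.
set F := f \_ _.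
have mF : measurable_fun setT (EFin \o F).
  apply/measurable_EFinP; rewrite /F.
  by move: mf => /(measurable_restrictT _ (measurable_itv _)).
rewrite -(@integral_shift _ _ (- h) mF); apply: eq_integral => s _.
rewrite /F /= !patchE !mem_setE !in_itv/= opprK -ltrBlDr subrr ltrD2r.
by [].
Qed.

Lemma leb_RintegralZr (R : realType) (f : R -> R) (k : R) (i : interval R) :
  (@lebesgue_measure R).-integrable [set` i] (EFin \o f) ->
  \int[@lebesgue_measure R]_(s in [set` i]) (f s * k) =
  \int[@lebesgue_measure R]_(s in [set` i]) f s * k.
Proof. by move=> h; rewrite RintegralZr. Qed.

Section MittagLeffler.
Variables (R : realType) (T al lam : R).
Notation leb := (@lebesgue_measure R).
Local Notation inT := (inT T).
Local Notation tcv := (tcv T).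
Local Notation emb := (@emb R T).
Hypotheses (T0 : 0 < T) (al0 : 0 < al) (al1 : al < 1) (lam0 : 0 < lam).

Let K : R -> R := fun t => lam * Bk T al t.
Let iK : inT K. Proof. by apply: inTZ; exact: inT_Bk. Qed.
Let c := lam / Gamma al.
Let c0 : 0 < c.
Proof. by rewrite divr_gt0// Gamma_gt0// al0 ltW. Qed.
Let a (x : R) : R := c * x `^ (al - 1).

Let KE (t : R) : 0 < t < T -> K t = a t.
Proof. by move=> tT; rewrite /K BkE// /a /c; ring. Qed.

Let a_gt0 (x : R) : 0 < x -> 0 < a x.
Proof. by move=> x0; rewrite mulr_gt0// powR_gt0. Qed.

Let a_le (x y : R) : 0 < x -> x <= y -> a y <= a x.
Proof.
move=> x0 xy; rewrite ler_pM2l//; have y0 := lt_le_trans x0 xy.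
rewrite -[al - 1]opprB !powRN lef_pV2 ?posrE ?powR_gt0//.
by apply: ler_powRl => //; [rewrite subr_ge0 ltW|exact: ltW].
Qed.

Section FirstResolvent.
Variable r : R -> R.
Hypotheses (ir : inT r) (res : (1 - emb r) * (1 + emb K) = 1).

(** On [[0, T[] this is the Mittag-Leffler function [E_al (- lam t^al)]. The integral starts at -1,
    left of the support of [r], so that 0 is an interior point and continuity there is two-sided. *)
Let S (t : R) : R := 1 - \int[leb]_(s in `[-1, t]) r s.

Let SE (t : R) : 0 < t < T -> S t = 1 - tcv (one T) r t.
Proof.
move=> tT; rewrite /S tcv_one//; congr (1 - _).
rewrite [LHS]Rintegral_mkcond [RHS]Rintegral_mkcond; congr (Rintegral _ _ _).
apply/funext => s; rewrite !patchE !mem_setE !in_itv/=.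
have [s0|s0] := leP 0 s; first by rewrite (le_trans _ s0)// oppr_le0.
by rewrite andFb ir.2 ?if_same// negb_and -leNgt ltW.
Qed.

Let S0 : S 0 = 1.
Proof.
rewrite /S (_ : \int[leb]_(s in _) _ = 0) ?subr0//.
rewrite /Rintegral integral0_eq// => s; rewrite /= in_itv/= => /andP[_ s0].
by rewrite ir.2// negb_and -leNgt s0.
Qed.

Let cS (t : R) : 0 <= t -> {for t, continuous S}.
Proof.
move=> t0.
have h : -1 <= t + 1 by lra.
have := continuous_primitive h (inT_integrable (measurable_itv _) ir).
have h' : -1 < t + 1 by lra.
move=> /(continuous_within_itvP _ h')[cc _ _].
apply: cvgB; first exact: cvg_cst.
by apply: cc; rewrite in_itv/=; apply/andP; split; lra.
Qed.

Let rK : {ae leb, forall t, r t = K t - tcv K r t}.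
Proof.
have /resolventE := res; rewrite -embM// -embD//; last exact: inT_tcv.
move=> /emb_eq h.
have /h : inT (r \+ tcv K r) by apply: inTD => //; exact: inT_tcv.
move=> /(_ iK); apply: ae_imply => t /= <-; by rewrite addrK.
Qed.

(** Convolving [r = K - K * r] with 1 turns [1 * r] into [1 * K - K * (1 * r)]; a bounded factor is
    involved each time, so every regrouping is pointwise. *)
Let eqS (t : R) : 0 <= t < T -> S t + \int[leb]_(s in `]0, t[) (a (t - s) * S s) = 1.
Proof.
move=> /andP[]; rewrite le_eqVlt => /predU1P[<- _|t0 tT].
  by rewrite S0 set_itv_ge ?bnd_simp ?ltxx// Rintegral_set0 addr0.
have tI : 0 < t < T by rewrite t0.
set q := tcv (one T) r.
have iq : inT q by apply: inT_tcv => //; exact: inT_one.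
have io := inT_one T.
have -> : \int[leb]_(s in `]0, t[) (a (t - s) * S s) = cv K (one T \- q) t.
  rewrite /cv [LHS]Rintegral_mkcond; apply: eq_Rintegral => s _.
  rewrite patchE mem_setE in_itv/=; case: ifPn => [/andP[s0 st]|].
    have sT : 0 < s < T by rewrite s0 (lt_trans st).
    rewrite KE ?SE//; last by apply/andP; split; lra.
    by rewrite /one trunc_in.
  rewrite negb_and -!leNgt => /orP[s0|ts].
    by rewrite /= (io.2 s) ?(iq.2 s) ?subrr ?mulr0// negb_and -leNgt s0.
  by rewrite iK.2 ?mul0r// negb_and -leNgt subr_le0 ts.
have qb x : `|q x| <= 1 * fine (L1norm r) by exact: tcv_bounded (@one_bound R T).
have mK := inT_measurable iK.
have -> : cv K (one T \- q) t = tcv K (one T) t - tcv K q t.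
  rewrite /tcv !trunc_in//.
  have mo := inT_measurable io; have mq := inT_measurable iq.
  rewrite cvC//; last exact: measurable_funB.
  rewrite (_ : one T \- q = one T \+ (fun x => -1 * q x)); last first.
    by apply/funext => x /=; rewrite mulN1r.
  rewrite cvDl//; last 3 first.
  - exact: measurable_funM.
  - exact: (@econv_bounded_fin _ T _ K 1 t mo iK (@one_bound R T)).
  - apply: (@econv_bounded_fin _ T _ K (1 * fine (L1norm r))) => //; first exact: measurable_funM.
    by move=> x; rewrite mulN1r normrN.
  rewrite cvZl//; last exact: (@econv_bounded_fin _ T _ K _ t mq iK qb).
  by rewrite mulN1r [in RHS]cvC// [X in _ = _ - X]cvC.
rewrite SE// -/q (tcvA_bounded_m iK io ir (@one_bound R T)) (tcvC iK io).
rewrite -(tcvA_bounded_l io iK ir (@one_bound R T)).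
have iKr : inT (tcv K r) by exact: inT_tcv.
rewrite /q !tcv_one//.
have -> : \int[leb]_(s in `[0, t]) r s = \int[leb]_(s in `[0, t]) (K s - tcv K r s).
  rewrite /Rintegral; congr fine; apply: ae_eq_integral => //.
  - by apply/measurable_EFinP; apply: measurable_funTS; exact: inT_measurable ir.
  - apply/measurable_EFinP; apply: measurable_funTS.
    by apply: measurable_funB; [exact: mK|exact: inT_measurable iKr].
  - by move: rK; apply: ae_imply => s h _; rewrite -h.
rewrite RintegralB//; [ring|exact: (inT_integrable (measurable_itv _) iK)|exact: (inT_integrable (measurable_itv _) iKr)].
Qed.

Let S_gt0 (t : R) : 0 <= t < T -> 0 < S t.
Proof.
move=> /andP[t0 tT].
apply: (@volterra_pos R al c t al0 al1 c0 S (cst 1)).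
- by move=> x /andP[x0 _]; exact: cS.
- by move=> x /andP[x0 xt]; rewrite /cst; apply: eqS; rewrite x0 (le_lt_trans xt).
- by move=> x _; exact: ltr01.
- by move=> s x y s0 sx xy _; rewrite !mul1r; apply: a_le; lra.
- by rewrite t0 lexx.
Qed.

(** The drop [D t = S t - S (t + h)] solves the same Volterra equation, with right-hand side [p] the
    part of the integral at [t + h] that comes from [[0, h]]; the positivity principle applies to it
    because [S > 0]. *)
Let S_decr (x y : R) : 0 <= x -> x < y -> y < T -> S y < S x.
Proof.
move=> x0 xy yT.
pose h := y - x; have h0 : 0 < h by rewrite subr_gt0.
pose D (t : R) : R := S t - S (t + h).
pose p (t : R) : R := \int[leb]_(s in `]0, h[) (a (t + h - s) * S s).
suff : 0 < D x by rewrite /D /h [x + _]addrC subrK subr_gt0.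
have iaS u v t : 0 <= u -> v <= t -> leb.-integrable `]u, v[ (EFin \o (fun s => a (t - s) * S s)).
  move=> u0 vt; apply: integrable_kernel_cont => // s /andP[us sv].
  by apply: cS; exact: le_trans us.
have cSh t : 0 <= t -> {for t, continuous (fun s => S (s + h))}.
  move=> t0; apply: (@continuous_comp _ _ _ (fun s => s + h) S t).
    by apply: cvgD; [exact: cvg_id|exact: cvg_cst].
  by apply: cS; rewrite addr_ge0// ltW.
have iaSh t : leb.-integrable `]0, t[ (EFin \o (fun s => a (t - s) * S (s + h))).
  by apply: integrable_kernel_cont => // s /andP[s0 _]; exact: cSh.
have shift t : \int[leb]_(s in `]0, t[) (a (t - s) * S (s + h)) =
      \int[leb]_(s in `]h, (t + h)[) (a (t + h - s) * S s).
  rewrite -Rintegral_shift_itv; last first.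
    by have /integrableP[/measurable_EFinP + _] := iaS h (t + h) (t + h) (ltW h0) (lexx _).
  apply: eq_Rintegral => s _; congr (a _ * _).
  by rewrite opprD addrACA subrr addr0.
apply: (@volterra_pos R al c x al0 al1 c0 D p).
- move=> t /andP[t0 _]; apply: cvgB; first exact: cS.
  exact: cSh.
- move=> t /andP[t0 tx].
  have e1 := @eqS t; have e2 := @eqS (t + h).
  rewrite t0 (le_lt_trans tx (lt_trans xy yT)) in e1.
  have thT : t + h < T.
    by apply: le_lt_trans yT; rewrite -(subrK x y) addrC lerD2l.
  rewrite (addr_ge0 t0 (ltW h0)) thT in e2.
  have {}e1 := e1 isT; have {}e2 := e2 isT.
  move: t0 e1 e2; rewrite le_eqVlt => /predU1P[<-|t0 e1 e2].
    rewrite /D /p set_itv_ge ?bnd_simp ?ltxx// !Rintegral_set0 !addr0 !add0r => e1 e2.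
    by rewrite e1 -e2 addrAC subrr add0r.
  have -> : \int[leb]_(s in `]0, t[) (a (t - s) * D s) =
      \int[leb]_(s in `]0, t[) (a (t - s) * S s) - \int[leb]_(s in `]0, t[) (a (t - s) * S (s + h)).
    rewrite -RintegralB//; last exact: (iaS 0 t t (lexx _) (lexx _)).
    by apply: eq_Rintegral => s _; rewrite /D mulrBr.
  have -> : \int[leb]_(s in `]0, t[) (a (t - s) * S (s + h)) =
      \int[leb]_(s in `]h, (t + h)[) (a (t + h - s) * S s).
    exact: shift.
  have := @Rintegral_itvB R (fun s => a (t + h - s) * S s) (BRight 0) (BLeft (t + h)) h (iaS 0 (t + h) (t + h) (lexx _) (lexx _)).
  rewrite !bnd_simp ltrDr => /(_ (ltW h0) t0).
  rewrite -Rintegral_itv_bndo_bndc; last by apply: (iaS 0 h (t + h)) => //; rewrite lerDr ltW.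
  rewrite -/(p t) /D.
  move: e1 e2; set i1 := \int[leb]_(_ in _) _; set i2 := \int[leb]_(_ in _) _.
  by set i3 := \int[leb]_(_ in _) _ => e1 e2 e3; rewrite -e3; lra.
- move=> t /andP[t0 tx].
  have cS' : {within `[0, h], continuous S}.
    by apply: continuous_in_subspaceT => s; rewrite inE/= in_itv/= => /andP[s0 _]; exact: cS.
  have [z] := EVT_min (ltW h0) cS'.
  rewrite in_itv/= => /andP[z0 zh] zmin.
  have Sz : 0 < S z by apply: S_gt0; rewrite z0 /=; rewrite /h in zh; lra.
  have ath : 0 < a (t + h) by apply: a_gt0; lra.
  apply: (@lt_le_trans _ _ (\int[leb]_(s in `]0, h[) (a (t + h) * S z))).
    have -> : \int[leb]_(s in `]0, h[) (a (t + h) * S z) = a (t + h) * S z * h.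
      by rewrite Rintegral_cst//= lebesgue_measure_itv/= lte_fin h0 oppr0 addr0.
    by rewrite mulr_gt0// mulr_gt0.
  apply: le_Rintegral => //.
  - apply/integrableP; split; first exact/measurable_EFinP/measurable_cst.
    by rewrite integral_cst// lte_mul_pinfty ?abse_ge0//; exact: lebesgue_oo_lty.
  - by apply: iaS => //; lra.
  - move=> s; rewrite /= in_itv/= => /andP[s0 sh]; apply: ler_pM.
    + exact: ltW.
    + exact: ltW.
    + by apply: a_le; rewrite ?subr_gt0 ?gerBl ?(ltW s0)//; apply: lt_le_trans sh _; rewrite lerDr.
    + by apply: zmin; rewrite in_itv/= !ltW.
- move=> s t t' s0 st tt' t'x; rewrite /p.
  have i1 := iaS 0 h (t + h) (lexx _); have i2 := iaS 0 h (t' + h) (lexx _).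
  have {}i1 : leb.-integrable `]0, h[ (EFin \o (fun s => a (t + h - s) * S s)).
    by apply: i1; rewrite lerDr (le_trans s0 (ltW st)).
  have {}i2 : leb.-integrable `]0, h[ (EFin \o (fun s => a (t' + h - s) * S s)).
    by apply: i2; rewrite lerDr (le_trans s0 (ltW (lt_trans st tt'))).
  rewrite /p -(leb_RintegralZr (a (t' - s)) i1) -(leb_RintegralZr (a (t - s)) i2).
  apply: le_Rintegral => //.
  - by have := @integrableZr _ _ _ leb _ (measurable_itv _) (a (t' - s)) _ i1.
  - by have := @integrableZr _ _ _ leb _ (measurable_itv _) (a (t - s)) _ i2.
  - move=> z; rewrite /= in_itv/= => /andP[z0 zh].
    have Sz : 0 <= S z by apply/ltW/S_gt0; rewrite (ltW z0) /=; rewrite /h in zh; lra.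
    rewrite mulrAC [leRHS]mulrAC; apply: ler_wpM2r => //.
    rewrite /a mulrACA [leRHS]mulrACA ler_pM2l ?(mulr_gt0 c0 c0)//.
    have X0 : 0 < t + h - z by lra.
    have X'0 : 0 < t' + h - z by lra.
    have Y0 : 0 < t - s by lra.
    have Y'0 : 0 < t' - s by lra.
    (* The ratio condition for a negative power reduces to comparing products of arguments, whose
       difference has the sign of [(t' - t) (h - z + s)]. *)
    rewrite -!powRM ?(ltW X0) ?(ltW X'0) ?(ltW Y0) ?(ltW Y'0)//.
    rewrite -[al - 1]opprB !powRN lef_pV2 ?posrE ?powR_gt0 ?mulr_gt0//.
    apply: ler_powRl; [by rewrite subr_ge0 ltW|by rewrite mulr_ge0 ?ltW|].
    rewrite -subr_ge0.
    have -> : (t + h - z) * (t' - s) - (t' + h - z) * (t - s) = (t' - t) * (h - z + s) by ring.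
    by rewrite mulr_ge0//; lra.
- by rewrite x0 lexx.
Qed.

(** Lebesgue differentiation: almost everywhere [r] is a limit of difference quotients of a
    primitive that increases by [S_decr]. *)
Lemma resolvent_ge0 : {ae leb, forall t, 0 <= r t}.
Proof.
have := @FTC1 R r (BLeft (-1)) (fun y => inT_integrable (measurable_itv _) ir).
have li : locally_integrable setT r.
  have := @integrable_locally R r setT measurableT ir.1.
  by rewrite patch_setT.
move=> /(_ li); apply: ae_imply => t ht.
have [tT|] := boolP (0 < t < T); last by move=> /ir.2 ->.
have /andP[t0 tT'] := tT.
have [|dF <-] := ht.
  by rewrite /= lte_fin (lt_trans _ t0)// oppr_lt0.
have tI : t \in `]0, T[ by rewrite in_itv.
have mono x y : 0 < x -> x < y -> y < T -> \int[leb]_(s in `[-1, x]) r s <= \int[leb]_(s in `[-1, y]) r s.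
  by move=> x0 xy yT; have := S_decr (ltW x0) xy yT; rewrite /S; lra.
rewrite derive1E; apply: limr_ge => //.
have [e /= e0 he] := near_in_itvoo tI.
near=> d.
have d0 : d != 0 by near: d; exact: nbhs_dnbhs_neq.
have : (d + t) \in `]0, T[.
  apply: he; rewrite /= opprD addrCA subrr addr0 normrN.
  by near: d; apply: dnbhs0_lt.
rewrite in_itv/= => /andP[dt0 dtT].
rewrite /GRing.scale/= mulr1.
have [dn|dp|/eqP] := ltgtP d 0; last by rewrite (negbTE d0).
  rewrite nmulr_rge0 ?invr_lt0// subr_le0; apply: mono => //; lra.
rewrite pmulr_rge0 ?invr_gt0// subr_ge0; apply: mono => //; lra.
Unshelve. all: by end_near. Qed.

(** As [r >= 0], its norm is [1 - S T], and [S T >= 0] by continuity from the positivity of [S] on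
    [[0, T[]. *)
Lemma L1norm_resolvent : (L1norm r <= 1)%E.
Proof.
have ST : 0 <= S T.
  rewrite leNgt; apply/negP => ST.
  have ST' : 0 < - S T by rewrite oppr_gt0.
  have /cvgrPdist_lt /(_ _ ST') [e /= e0 he] := cS (ltW T0).
  pose x := Num.max 0 (T - e / 2).
  have x0 : 0 <= x by rewrite le_max lexx.
  have xT : x < T by rewrite gt_max T0 ltrBlDr ltrDl divr_gt0.
  have xe : `|T - x| < e.
    rewrite ger0_norm ?subr_ge0 ?(ltW xT)// ltrBlDl -ltrBlDr.
    by rewrite lt_max; apply/orP; right; lra.
  have := he x xe; have := @S_gt0 x; rewrite x0 xT => /(_ isT) Sx.
  by rewrite /= ltr_norml => /andP[h _]; lra.
have -> : L1norm r = (\int[leb]_(s in `[-1, T]) r s)%:E.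
  rewrite /Rintegral fineK; last exact: integrable_fin_num (inT_integrable (measurable_itv _) ir).
  rewrite [RHS]integral_mkcond; apply: ae_eq_integral => //.
  - exact: measurable_eabs (inT_measurable ir).
  - have : measurable_fun (`[-1, T] : set R) (EFin \o r).
      by apply/measurable_EFinP; apply: measurable_funTS; exact: inT_measurable ir.
    by move=> /(measurable_restrictT _ (measurable_itv _)).
  - have := resolvent_ge0; apply: ae_imply => s rs _; rewrite patchE mem_setE in_itv/= /eabs ger0_norm//.
    case: ifPn => // hs; rewrite ir.2//; apply: contra hs => /andP[h1 h2].
    by apply/andP; split; lra.
by rewrite lee_fin; move: ST; rewrite /S subr_ge0.
Qed.

End FirstResolvent.

(** Since [K * r >= 0], the equation [r = K - K * r] gives [r <= K]. The Leibniz rule applied to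
    that equation turns [t r] into [al (q - r * q)], with [0 <= q <= 1] the primitive of [r]. *)
Lemma mittag_leffler_resolvent : exists r, [/\ inT r,
  (1 - emb r) * (1 + emb (fun t => lam * Bk T al t)) = 1,
  (forall t, 0 <= r t), (L1norm r <= 1)%E &
  {ae leb, forall t, r t <= lam * Bk T al t /\ t * r t <= al}].
Proof.
have [r0 [ir0 res0]] := resolvent_ex iK.
have r0_ge0 := resolvent_ge0 ir0 res0.
have nu0 := L1norm_resolvent ir0 res0.
(* Gives nonnegativity at every point, not merely almost everywhere, without leaving the class of
   [r0]. *)
pose r t := `|r0 t|.
have ae_r : {ae leb, forall t, r t = r0 t}.
  by move: r0_ge0; apply: ae_imply => t h; rewrite /r ger0_norm.
have ir : inT r.
  split; last by move=> t h; rewrite /r ir0.2// normr0.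
  by have := integrable_abse ir0.1.
have er : emb r = emb r0 by apply/emb_eq.
have nur : (L1norm r <= 1)%E.
  by rewrite (L1norm_ae (inT_measurable ir) (inT_measurable ir0) ae_r).
have r_ge0 t : 0 <= r t by rewrite /r.
have res : (1 - emb r) * (1 + emb K) = 1 by rewrite er.
exists r; split => //.
have K0 t : 0 <= K t by rewrite mulr_ge0 ?(ltW lam0)// Bk_ge0// al0 ltW.
have iKr : inT (tcv K r) by exact: inT_tcv.
have irKr : inT (r \+ tcv K r) by exact: inTD.
have /resolventE res' := res.
have ae1 : {ae leb, forall t, (r \+ tcv K r) t = K t}.
  by apply/(emb_eq irKr iK); rewrite embD// embM.
set q := tcv (one T) r.
have iq : inT q by apply: inT_tcv => //; exact: inT_one.
have irq : inT (tcv r q) by exact: inT_tcv.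
have ae2 : {ae leb, forall t, tM r t = (fun t => al * (q \- tcv r q) t) t}.
  have iqrq : inT (q \- tcv r q) by exact: inTB.
  apply/(emb_eq (inT_tM ir) (inTZ al iqrq)).
  rewrite embZ// embB// embM// embM//; last exact: inT_one.
  set x := emb r in res res' *; set k := emb K in res res' *.
  have tMK : emb (tM K) = scal T al * (emb (one T) * k).
    rewrite -embM//; last exact: inT_one.
    rewrite -embZ; last by apply: inT_tcv => //; exact: inT_one.
    congr emb; apply/funext => t; rewrite /tM.
    have := congr1 (fun f => lam * f t) (tM_Bk T al0); rewrite /tM /= => h.
    rewrite /K mulrCA h mulrCA; congr (_ * _).
    have [tT|tT] := boolP (0 < t < T); last by rewrite !(tcv_out _ _ tT) mulr0.
    rewrite !tcv_one//; [|exact: inT_Bk].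
    by rewrite -RintegralZl//; apply: inT_integrable; [|exact: inT_Bk].
  have h : emb (tM r) + (emb (tM K) * x + k * emb (tM r)) = emb (tM K).
    rewrite -(emb_tM iK ir) -embD; [|exact: inT_tM|exact: inT_tM].
    rewrite -tMD; apply: emb_eq_tM => //.
    by rewrite embD// embM.
  (* Multiplying by the inverse [1 - x] of [1 + k] isolates [t r]; then [k (1 - x) = x] removes
     [k]. *)
  have h2 : emb (tM r) * (1 + k) = emb (tM K) * (1 - x).
    transitivity (emb (tM r) + (emb (tM K) * x + k * emb (tM r)) - emb (tM K) * x); first by ring.
    by rewrite h; ring.
  have -> : emb (tM r) = (1 - x) * (emb (tM r) * (1 + k)) by rewrite mulrCA res mulr1.
  rewrite h2 tMK.
  have kx : k * (1 - x) = x by rewrite mulrBr mulr1 -{1}res' addrK.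
  transitivity (scal T al * emb (one T) * (1 - x) * (k * (1 - x))); first by ring.
  by rewrite kx; ring.
have := ae_and ae1 ae2; apply: ae_imply => t [/= h1 h2]; split.
  by rewrite -/(K t) -h1 lerDl; exact: tcv_ge0.
rewrite -/(tM r t) h2 ler_piMr ?(ltW al0)//.
apply: (@le_trans _ _ (q t)).
  rewrite gerBl; apply: tcv_ge0 => // s; apply: tcv_ge0 => // z.
  by rewrite /one truncE; case: ifP.
have [tT|tT] := boolP (0 < t < T); last by rewrite iq.2.
apply: le_trans (ler_norm _) _.
apply: le_trans (tcv_bounded t (inT_one T) ir (@one_bound R T)) _.
rewrite mul1r -lee_fin fineK// ge0_fin_numE ?L1norm_ge0//; exact: (L1norm_fin ir).
Qed.

End MittagLeffler.

(** * Differentiability of the Gamma function *)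

Section LogGamma.
Variable R : realType.
Notation leb := (@lebesgue_measure R).

Lemma ln_le_powR (d x : R) : 0 < d -> 0 < x -> ln x <= x `^ d / d.
Proof.
move=> d0 x0; rewrite ler_pdivlMr// mulrC -ln_powR.
by apply/ltW/ln_sublinear; rewrite powR_gt0.
Qed.

Lemma norm_ln_le1 (d x : R) : 0 < d -> 0 < x -> x <= 1 -> `|ln x| <= x `^ (- d) / d.
Proof.
move=> d0 x0 x1; rewrite ler0_norm; last by apply: ln_le0.
have xV : 0 < x^-1 by rewrite invr_gt0.
rewrite -lnV ?posrE// (le_trans (ln_le_powR d0 xV))//.
by rewrite -powR_inv1 ?(ltW x0)// -powRrM mulN1r.
Qed.

Lemma norm_ln_ge1 (d x : R) : 0 < d -> 1 <= x -> `|ln x| <= x `^ d / d.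
Proof.
by move=> d0 x1; rewrite ger0_norm ?ln_ge0// ln_le_powR// (lt_le_trans ltr01).
Qed.

Lemma is_derive_powR_exponent (y x : R) : 0 < y ->
  is_derive x (1 : R) (fun x => y `^ (x - 1)) (y `^ (x - 1) * ln y).
Proof.
move=> y0.
rewrite (_ : (fun _ => _) = (fun x => expR ((x - 1) * ln y))); last first.
  by apply/funext => z; rewrite /powR gt_eqF.
apply: is_derive_eq; rewrite /powR gt_eqF//.
by rewrite /GRing.scale/= subr0 mulr1 mulr0 add0r.
Qed.

Lemma is_derive_Gamma_integrand (y x : R) :
  is_derive x (1 : R) (fun x => Gamma_integrand x y) (Gamma_integrand x y * ln y).
Proof.
have [y0|y0] := ltP 0 y; last first.
  rewrite (_ : (fun _ => _) = cst 0); last first.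
    by apply/funext => z; rewrite /Gamma_integrand pos_powRE ltNge y0 mulr0.
  by rewrite /Gamma_integrand pos_powRE ltNge y0 mulr0 mul0r; exact: is_derive_cst.
rewrite (_ : (fun _ => _) = (fun x => expR (- y) * y `^ (x - 1))); last first.
  by apply/funext => z; rewrite /Gamma_integrand pos_powRE y0.
have h := is_derive_powR_exponent x y0.
apply: is_derive_eq; rewrite /Gamma_integrand pos_powRE y0 /GRing.scale/= -mulrA; congr (_ * _).
Qed.

(** A logarithm costs an arbitrarily small power: [y^(-u/2)] near 0, which leaves the integrable
    exponent [u/2 - 1], and [y^(1-v)] at infinity, which leaves the exponent 0. The bound depends on
    [u] and [v] but not on [a]. *)
Lemma Gamma_integrand_ln_bound (u v a y : R) : 0 < u -> u <= a -> a <= v -> v < 1 ->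
  `|Gamma_integrand a y * ln y| <= (u / 2)^-1 * Gamma_integrand (u / 2) y + (1 - v)^-1 * Gamma_integrand 1 y.
Proof.
move=> u0 ua av v1.
have v1' : 0 < 1 - v by rewrite subr_gt0.
have u2 : 0 < u / 2 by rewrite divr_gt0.
rewrite /Gamma_integrand !pos_powRE; case: ifPn => [y0|_]; last by rewrite !mulr0 mul0r normr0 addr0.
rewrite mulrCA [X in _ <= _ + X]mulrCA -mulrDr -mulrA normrM ger0_norm ?expR_ge0//.
rewrite ler_wpM2l ?expR_ge0// normrM ger0_norm ?powR_ge0//.
have [y1|y1] := leP y 1.
  apply: (@le_trans _ _ ((u / 2)^-1 * y `^ (u / 2 - 1))); last first.
    by rewrite lerDl mulr_ge0 ?powR_ge0// invr_ge0 ltW.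
  apply: (@le_trans _ _ (y `^ (u - 1) * (y `^ (- (u / 2)) / (u / 2)))).
    apply: ler_pM => //; [exact: powR_ge0| |exact: norm_ln_le1].
    by apply: ger_powR; rewrite ?y0//; lra.
  rewrite mulrA -powRD; last by rewrite (gt_eqF y0)/= ?implybT.
  by rewrite mulrC (_ : u - 1 - u / 2 = u / 2 - 1)//; lra.
apply: (@le_trans _ _ ((1 - v)^-1 * y `^ (1 - 1))); last first.
  by rewrite lerDr mulr_ge0 ?powR_ge0// invr_ge0 ltW.
apply: (@le_trans _ _ (y `^ (v - 1) * (y `^ (1 - v) / (1 - v)))).
  apply: ler_pM => //; [exact: powR_ge0| |by apply: norm_ln_ge1 => //; exact: ltW].
  by apply: ler_powR; [exact: ltW|lra].
rewrite mulrA -powRD; last by rewrite (gt_eqF y0)/= ?implybT.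
by rewrite mulrC (_ : v - 1 + (1 - v) = 1 - 1)//; lra.
Qed.

Lemma derive_Rintegral (B : set R) (f f' : R -> R -> R) (G : R -> R) (a u v : R) :
  measurable B -> u < a < v ->
  (forall x, u < x < v -> leb.-integrable B (EFin \o f x)) ->
  (forall x y, u < x < v -> B y -> is_derive x (1 : R) (f ^~ y) (f' x y)) ->
  (forall y, 0 <= G y) -> leb.-integrable B (EFin \o G) ->
  (forall x y, u < x < v -> B y -> `|f' x y| <= G y) ->
  derivable (fun x => \int[leb]_(y in B) f x y) a (1 : R) /\
  derive1 (fun x => \int[leb]_(y in B) f x y) a = \int[leb]_(y in B) f' a y.
Proof.
move=> mB uav intf df G0 iG ub.
have I x : `]u, v[%classic x -> u < x < v by rewrite /= in_itv.
have Ia : `]u, v[%classic a by rewrite /= in_itv.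
have d1 x y : u < x < v -> B y -> partial1of2 f x y = f' x y.
  by move=> hx By; rewrite partial1of2E; have h := df x y hx By; rewrite derive_val.
have intf' x (hx : `]u, v[%classic x) := intf x (I x hx).
have df' x y (hx : `]u, v[%classic x) (By : B y) : derivable (f ^~ y) x (1 : R).
  by have h := df x y (I x hx) By; exact: ex_derive.
have ub' x y (hx : `]u, v[%classic x) (By : B y) : `|partial1of2 f x y| <= G y.
  by rewrite (d1 _ _ (I x hx) By); apply: ub => //; exact: I.
split; first exact: (@derivable_under_integral R _ _ leb f B mB a u v Ia intf' df' G G0 iG ub').
rewrite (@differentiation_under_integral R _ _ leb f B mB a u v Ia intf' df' G G0 iG ub').
by apply: eq_Rintegral => y; rewrite inE => By; exact: d1.
Qed.

(** The dominating function is common to the whole interval []u, v[], so its integral serves as [M];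
    uniformity is needed when [Gamma] is composed with [alpha]. *)
Lemma Gamma_derivable (u v : R) : 0 < u -> v < 1 -> exists M : R, 0 <= M /\
  forall a, u < a -> a < v -> derivable (@Gamma R) a 1 /\ `|derive1 (@Gamma R) a| <= M.
Proof.
move=> u0 v1.
pose D (y : R) := (u / 2)^-1 * Gamma_integrand (u / 2) y + (1 - v)^-1 * Gamma_integrand 1 y.
have [vu|uv] := leP v u.
  by exists 0; split => // a ua av; have := lt_trans ua av; rewrite ltNge vu.
have D0 y : 0 <= D y.
  by rewrite addr_ge0// mulr_ge0 ?Gamma_integrand_ge0// invr_ge0; lra.
have iD : leb.-integrable setT (EFin \o D).
  have i1 := @integrable_Gamma_integrand R (u / 2) (ltac:(apply/andP; split; lra)).
  have i2 := @integrable_Gamma_integrand R 1 (ltac:(apply/andP; split; lra)).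
  have j1 := @integrableZl _ _ _ leb setT measurableT (u / 2)^-1 _ i1.
  have j2 := @integrableZl _ _ _ leb setT measurableT (1 - v)^-1 _ i2.
  have := @integrableD _ _ _ leb setT measurableT _ _ j1 j2.
  by apply: eq_integrable => // y _; rewrite /D /= EFinD !EFinM.
have intf x : u < x < v -> leb.-integrable setT (EFin \o (Gamma_integrand x)).
  by move=> /andP[ux xv]; apply: integrable_Gamma_integrand; apply/andP; split; lra.
exists (\int[leb]_y D y); split; first by apply: Rintegral_ge0.
move=> a ua av.
have uav : u < a < v by rewrite ua.
have [h1 h2] := @derive_Rintegral setT (@Gamma_integrand R) (fun x y => Gamma_integrand x y * ln y) D a u v measurableT
  uav intf (fun x y _ _ => is_derive_Gamma_integrand y x) D0 iD
  (fun x y hx _ => Gamma_integrand_ln_bound y u0 (ltW (andP hx).1) (ltW (andP hx).2) v1).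
have GE : \forall x \near a, \int[leb]_y Gamma_integrand x y = Gamma x.
  have aI : a \in `]u, v[ by rewrite in_itv/= ua.
  near=> x; have : x \in `]u, v[ by near: x; exact: near_in_itvoo.
  rewrite in_itv/= => /andP[ux xv].
  by rewrite /Rintegral GammaEFin//; apply/andP; split; lra.
split.
  by apply: near_eq_derivable h1.
rewrite derive1E -(near_eq_derive _ GE)// -derive1E h2.
have mf : measurable_fun setT (fun y => Gamma_integrand a y * ln y).
  by apply: measurable_funM; [exact: measurable_Gamma_integrand|exact: measurable_ln].
have ub y : `|Gamma_integrand a y * ln y| <= D y by apply: Gamma_integrand_ln_bound => //; exact: ltW.
have id1 : leb.-integrable setT (EFin \o (fun y => Gamma_integrand a y * ln y)).
  apply: le_integrable iD => //; first exact/measurable_EFinP.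
  by move=> y _ /=; rewrite lee_fin (ger0_norm (D0 y)).
apply: (le_trans (le_normr_Rintegral _ _)) => //.
apply: le_Rintegral => //; first exact: (integrable_norm id1).
Unshelve. all: by end_near. Qed.

End LogGamma.

(** * The fundamental theorem of calculus for bounded derivatives *)

Section BoundedDerivative.
Variable R : realType.
Notation leb := (@lebesgue_measure R).
Implicit Types F : R -> R.

Lemma cvg_diff_quotient F (t : R) (h : nat -> R) : derivable F t 1 ->
  (forall n, h n != 0) -> h n @[n --> \oo] --> (0 : R) ->
  (F (t + h n) - F t) / h n @[n --> \oo] --> derive1 F t.
Proof.
move=> dF h0 hc; rewrite derive1E.
have d : (fun h => h^-1 *: (F (h *: (1 : R) + t) - F t)) x @[x --> 0^'] --> 'D_1 F t by exact: dF.
have := (@cvgr_dnbhsP R _ _ _).1 d h (conj h0 hc).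
apply: cvg_trans; apply: near_eq_cvg; near=> n.
by rewrite /GRing.scale/= mulr1 mulrC addrC [t + _]addrC addrC.
Unshelve. all: by end_near. Qed.

Lemma derivable_in_continuous F (a b : R) : (forall t, a < t < b -> derivable F t 1) ->
  forall t, a < t < b -> {for t, continuous F}.
Proof. by move=> dF t /dF h; apply/differentiable_continuous/derivable1_diffP. Qed.

Lemma measurable_derivable F (a b : R) : (forall t, a < t < b -> derivable F t 1) ->
  measurable_fun (`]a, b[ : set R) F.
Proof.
move=> dF; apply: open_continuous_measurable_fun; first exact: interval_open.
move=> t; rewrite inE/= in_itv/= => tab; exact: (derivable_in_continuous dF).
Qed.

(** A pointwise limit of difference quotients with steps [1 / (n + 1)]; cutting [F] to the interval
    makes each quotient measurable, and the cut is invisible once the step is short. *)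
Lemma measurable_derive1 F (a b : R) : (forall t, a < t < b -> derivable F t 1) ->
  measurable_fun (`]a, b[ : set R) (derive1 F).
Proof.
move=> dF.
pose F0 := F \_ (`]a, b[ : set R).
have mF0 : measurable_fun setT F0.
  by have := measurable_derivable dF; move=> /(measurable_restrictT _ (measurable_itv _)).
pose H (n : nat) (t : R) : R := (F0 (t + 1 / n.+1%:R) - F0 t) / (1 / n.+1%:R).
have mH n : measurable_fun (`]a, b[ : set R) (H n).
  apply: measurable_funTS; apply: measurable_funM; last exact: measurable_cst.
  apply: measurable_funB => //; apply: measurableT_comp => //.
  by apply: measurable_funD => //; exact: measurable_cst.
suff cH t : (`]a, b[%classic : set R) t -> H ^~ t @ \oo --> derive1 F t by exact: (measurable_fun_cvg mH cH).
rewrite /= in_itv/= => tab.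
have := @cvg_diff_quotient F t (fun n => 1 / n.+1%:R) (dF _ tab).
have hn n : 1 / n.+1%:R != 0 :> R by rewrite div1r invr_neq0// pnatr_eq0.
move=> /(_ hn (@cvg_div_natS R 1)); apply: cvg_trans; apply: near_eq_cvg.
have /andP[ta tb] := tab.
have : \forall n \near \oo, 1 / n.+1%:R < b - t.
  have tb' : 0 < b - t by rewrite subr_gt0.
  have /cvgrPdist_lt /(_ _ tb') := @cvg_div_natS R 1.
  by apply: filterS => n; rewrite sub0r normrN => /ltr_normlW.
apply: filterS => n hn1.
rewrite /H /F0 !patchE !mem_setE !in_itv/= tab.
have n0 : 0 < 1 / n.+1%:R :> R by rewrite divr_gt0.
have -> : a < t + 1 / n.+1%:R by rewrite (lt_trans ta)// ltrDl.
by have -> : t + 1 / n.+1%:R < b by rewrite addrC -ltrBrDr.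
Qed.

Lemma derivable_lipschitz F (a b M : R) :
  (forall t, a < t < b -> derivable F t 1 /\ `|derive1 F t| <= M) ->
  forall x y, a < x -> x <= y -> y < b -> `|F y - F x| <= M * (y - x).
Proof.
move=> dF x y ax xy yb.
have dF' t : a < t < b -> derivable F t 1 by move=> /dF[].
have [c] : exists2 c, c \in `[x, y]%R & F y - F x = derive1 F c * (y - x).
  apply: MVT_segment => // [t|].
    rewrite in_itv/= => /andP[xt ty].
    have tab : a < t < b by rewrite (lt_trans ax) ?(lt_trans ty).
    by rewrite derive1E; apply: derivableP; exact: dF'.
  apply: continuous_in_subspaceT => t; rewrite inE/= in_itv/= => /andP[xt ty].
  by apply: (derivable_in_continuous dF'); rewrite (lt_le_trans ax) ?(le_lt_trans ty).
rewrite in_itv/= => /andP[xc cy] ->; rewrite normrM (@ger0_norm _ (y - x)) ?subr_ge0//.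
rewrite ler_wpM2r ?subr_ge0//; apply: (dF c _).2.
by rewrite (lt_le_trans ax) ?(le_lt_trans cy).
Qed.

Lemma Rintegral_shift_oc (f : R -> R) (a b h : R) :
  measurable_fun (`](a + h), (b + h)] : set R) f ->
  \int[leb]_(s in `]a, b]) f (s + h) = \int[leb]_(s in `](a + h), (b + h)]) f s.
Proof.
move=> mf; rewrite [LHS]Rintegral_mkcond [RHS]Rintegral_mkcond /Rintegral; congr fine.
set G := f \_ _.
have mG : measurable_fun setT (EFin \o G).
  apply/measurable_EFinP; rewrite /G.
  by move: mf => /(measurable_restrictT _ (measurable_itv _)).
rewrite -(@integral_shift _ _ (- h) mG); apply: eq_integral => s _.
by rewrite /G /= !patchE !mem_setE !in_itv/= opprK lerD2r ltrD2r.
Qed.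

Lemma integrable_bounded_itv (f : R -> R) (M : R) (a b : R) :
  measurable_fun (`]a, b] : set R) f -> (forall t, a < t <= b -> `|f t| <= M) ->
  leb.-integrable `]a, b] (EFin \o f).
Proof.
move=> mf fM.
have ic : leb.-integrable `]a, b] (EFin \o cst M).
  apply/integrableP; split; first exact/measurable_EFinP/measurable_cst.
  under eq_integral do rewrite /=.
  rewrite integral_cst// lte_mul_pinfty ?lee_fin//.
  have L : (leb (`]a, b]%classic : set R) < +oo)%E.
    by rewrite lebesgue_measure_itv/=; case: ifP => _; rewrite ?ltry.
  exact: L.
apply: le_integrable ic => //; first exact/measurable_EFinP.
move=> t; rewrite /= in_itv/= => tab; rewrite lee_fin.
by apply: le_trans (fM t tab) _; exact: ler_norm.
Qed.

End BoundedDerivative.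

Section FTCBounded.
Variable R : realType.
Notation leb := (@lebesgue_measure R).
Implicit Types F : R -> R.

(* The derivative need not be continuous: both sides are limits of the integrated
   difference quotients, the left one by dominated convergence. *)
Lemma FTC_bounded F (a0 a b b0 M : R) : a0 < a -> a < b -> b < b0 ->
  (forall t, a0 < t < b0 -> derivable F t 1 /\ `|derive1 F t| <= M) ->
  \int[leb]_(t in `]a, b]) derive1 F t = F b - F a.
Proof.
move=> a0a ab bb0 dF.
have dF' t : a0 < t < b0 -> derivable F t 1 by move=> /dF[].
have cF := derivable_in_continuous dF'.
have M0 : 0 <= M.
  by apply: le_trans (dF b _).2; rewrite ?normr_ge0// bb0 (lt_trans a0a).
(* Room on both sides of [[a, b]], so that the shifted points [t + h n] stay where [F] is
   differentiable. *)
pose a1 := (a0 + a) / 2; pose b1 := (b + b0) / 2.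
have a01 : a0 < a1 by rewrite /a1; lra.
have a1a : a1 < a by rewrite /a1; lra.
have bb1 : b < b1 by rewrite /b1; lra.
have b10 : b1 < b0 by rewrite /b1; lra.
pose h (n : nat) : R := (b1 - b) / n.+1%:R.
have h_gt0 n : 0 < h n by rewrite divr_gt0// subr_gt0.
have h_le n : b + h n <= b1.
  by rewrite -lerBrDl ler_pdivrMr// ler_peMr ?subr_ge0 ?(ltW bb1)// ler1n.
have h_neq n : h n != 0 by rewrite gt_eqF.
have h_cvg : h n @[n --> \oo] --> (0 : R) by exact: cvg_div_natS.
have cF1 : {within `[a1, b1], continuous F}.
  apply: continuous_in_subspaceT => t; rewrite inE/= in_itv/= => /andP[xt ty].
  by apply: cF; rewrite (lt_le_trans a01) ?(le_lt_trans ty).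
have iF : leb.-integrable `[a1, b1] (EFin \o F).
  by apply: continuous_compact_integrable => //; exact: segment_compact.
(* After a shift of variable, the integrated quotient of [F] is the difference of the quotients of
   [Phi] at [b] and at [a], which tend to [F b] and [F a]. *)
pose Phi x := \int[leb]_(t in `[a1, x]) F t.
have dPhi x : a1 < x < b1 -> derivable Phi x 1 /\ derive1 Phi x = F x.
  move=> /andP[ax xb]; apply: (@continuous_FTC1 R F (BLeft a1) x b1 xb iF).
    by rewrite /= lte_fin.
  by apply: cF; rewrite (lt_trans a01) ?(lt_trans xb).
pose Q n t := (F (t + h n) - F t) / h n.
have mF : measurable_fun (`]a0, b0[ : set R) F by exact: measurable_derivable.
have subF x y : a0 <= x -> y < b0 -> measurable_fun (`]x, y] : set R) F.
  move=> ax yb; apply: measurable_funS mF => // t; rewrite /= !in_itv/= => /andP[xt ty].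
  by rewrite (le_lt_trans ax) ?(le_lt_trans ty).
have mdF : measurable_fun (`]a, b] : set R) (derive1 F).
  apply: measurable_funS (measurable_derive1 dF') => // t; rewrite /= !in_itv/= => /andP[xt ty].
  by rewrite (lt_trans a0a) ?(le_lt_trans ty).
have mQ n : measurable_fun (`]a, b] : set R) (Q n).
  apply: measurable_funM; last exact: measurable_cst.
  apply: measurable_funB; last by apply: subF => //; exact: ltW.
  have : measurable_fun (`]a + h n, b + h n] : set R) F.
    apply: subF; last exact: le_lt_trans b10.
    by rewrite ltW// (lt_trans a0a)// ltrDl.
  move=> /(measurable_restrictT _ (measurable_itv _)) m.
  have mm : measurable_fun (`]a, b] : set R) (fun t : R => (F \_ (`]a + h n, b + h n] : set R)) (t + h n)).
    apply: measurable_funTS; apply: measurableT_comp => //.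
    by apply: measurable_funD => //; exact: measurable_cst.
  apply: eq_measurable_fun mm => t.
  by rewrite inE/= in_itv/= => tab; rewrite patchE mem_setE in_itv/= ltrD2r lerD2r tab.
have QM n t : a < t <= b -> `|Q n t| <= M.
  move=> /andP[at_ tb]; rewrite /Q normrM normfV (gtr0_norm (h_gt0 n)) ler_pdivrMr//.
  have e : h n = t + h n - t by rewrite addrC addKr.
  rewrite [X in M * X]e.
  apply: (derivable_lipschitz dF); first exact: lt_trans at_.
    by rewrite lerDl ltW.
  by apply: le_lt_trans b10; apply: le_trans (h_le n); rewrite lerD2r.
have lim1 : \int[leb]_(t in `]a, b]) Q n t @[n --> \oo] --> \int[leb]_(t in `]a, b]) derive1 F t.
  have ic : leb.-integrable `]a, b] (EFin \o cst M).
    by apply: (@integrable_bounded_itv _ _ M); [exact: measurable_cst|move=> t _; rewrite ger0_norm].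
  have e2 t : (`]a, b]%classic : set R) t -> (Q n t)%:E @[n --> \oo] --> (derive1 F t)%:E.
    rewrite /= in_itv/= => /andP[at_ tb]; apply: cvg_EFin; first by near=> n.
    apply: (@cvg_diff_quotient _ F t h) => //; apply: dF'.
    by rewrite (lt_trans a0a) ?(le_lt_trans tb).
  have e1 n : measurable_fun (`]a, b] : set R) (fun t => (Q n t)%:E) by exact/measurable_EFinP.
  have e3 : measurable_fun (`]a, b] : set R) (EFin \o derive1 F) by exact/measurable_EFinP.
  have e4 n t : (`]a, b]%classic : set R) t -> (`|(Q n t)%:E| <= (EFin \o cst M) t)%E.
    by rewrite /= in_itv/= => tab; rewrite lee_fin; exact: QM.
  have E2 : {ae leb, forall t, (`]a, b]%classic : set R) t -> (Q n t)%:E @[n --> \oo] --> (EFin \o derive1 F) t}.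
    by apply: aeW => t; exact: e2.
  have E4 : {ae leb, forall t n, (`]a, b]%classic : set R) t -> (`|(Q n t)%:E| <= (EFin \o cst M) t)%E}.
    by apply: aeW => t n; exact: e4.
  have [i1 _ +] := @dominated_convergence _ _ _ leb _ (measurable_itv `]a, b])
    (fun n t => (Q n t)%:E) (EFin \o derive1 F) (EFin \o cst M) e1 e3 E2 ic E4.
  have fi : (\int[leb]_(x in `]a, b]) (EFin \o derive1 F) x)%E \is a fin_num by apply: integrable_fin_num.
  rewrite -(fineK fi) => /fine_cvgP[_]; apply: cvg_trans.
  by apply: near_eq_cvg; near=> n.
have lim2 : \int[leb]_(t in `]a, b]) Q n t @[n --> \oo] --> F b - F a.
  have q x := @cvg_diff_quotient _ Phi x h.
  have [db eb] : derivable Phi b 1 /\ derive1 Phi b = F b.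
    by apply: dPhi; rewrite bb1 (lt_trans a1a).
  have [da ea] : derivable Phi a 1 /\ derive1 Phi a = F a.
    by apply: dPhi; rewrite a1a (lt_trans ab).
  rewrite -eb -ea.
  have cB (s1 s2 : nat -> R) (l1 l2 : R) : s1 n @[n --> \oo] --> l1 -> s2 n @[n --> \oo] --> l2 ->
      s1 n - s2 n @[n --> \oo] --> l1 - l2 by move=> hu hv; exact: cvgB.
  have cc : (Phi (b + h n) - Phi b) / h n - (Phi (a + h n) - Phi a) / h n @[n --> \oo] -->
      derive1 Phi b - derive1 Phi a.
    exact: (cB _ _ _ _ (q b db h_neq h_cvg) (q a da h_neq h_cvg)).
  apply: cvg_trans cc; apply: near_eq_cvg; near=> n => /=.
  have PB x y : a1 < x -> x < y -> y <= b1 -> Phi y - Phi x = \int[leb]_(t in `]x, y]) F t.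
    move=> ax xy yb; rewrite /Phi.
    have iFy : leb.-integrable `[a1, y] (EFin \o F).
      apply: integrableS iF => // t; rewrite /= !in_itv/= => /andP[-> ty].
      exact: le_trans yb.
    have := @Rintegral_itvB R F (BLeft a1) (BRight y) x iFy.
    by rewrite !bnd_simp => ->//; exact: ltW.
  have ahb : a + h n <= b1 by apply: le_trans (h_le n); rewrite lerD2r ltW.
  have iab f : leb.-integrable `[a1, b1] (EFin \o f) -> leb.-integrable `]a, b] (EFin \o f).
    move=> i; apply: integrableS i => // t; rewrite /= !in_itv/= => /andP[at_ tb].
    by rewrite (ltW (lt_trans a1a at_)) (le_trans tb (ltW bb1)).
  have mFh : measurable_fun (`]a, b] : set R) (fun t => F (t + h n)).
    have mm : measurable_fun (`]a, b] : set R) (fun t => Q n t * h n + F t).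
      apply: measurable_funD; last by apply: subF => //; exact: ltW.
      by apply: measurable_funM => //; exact: measurable_cst.
    by apply: eq_measurable_fun mm => t _; rewrite /Q divfK// subrK.
  have iFh : leb.-integrable `]a, b] (EFin \o (fun t => F (t + h n))).
    have iQ := integrable_bounded_itv (mQ n) (QM n).
    have i1 := @integrableZr _ _ _ leb _ (measurable_itv `]a, b]) (h n) _ iQ.
    have := @integrableD _ _ _ leb _ (measurable_itv `]a, b]) _ _ i1 (iab _ iF).
    apply: eq_integrable => // t _ /=.
    by rewrite -EFinM -EFinD /Q divfK// subrK.
  rewrite -mulrBl /Q leb_RintegralZr; last first.
    have := @integrableB _ _ _ leb _ (measurable_itv `]a, b]) _ _ iFh (iab _ iF).
    by apply: eq_integrable => // t _ /=; rewrite EFinB.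
  congr (_ / _).
  have -> : Phi (b + h n) - Phi b - (Phi (a + h n) - Phi a) =
            (Phi (b + h n) - Phi (a + h n)) - (Phi b - Phi a) by ring.
  rewrite (PB a b a1a ab (ltW bb1)) (PB (a + h n) (b + h n))//; last 2 first.
  - by rewrite (lt_trans a1a)// ltrDl.
  - by rewrite ltrD2r.
  rewrite -Rintegral_shift_oc; last by apply: subF; [rewrite ltW// (lt_trans a0a)// ltrDl|exact: le_lt_trans b10].
  by rewrite RintegralB//; exact: iab.
have := cvg_unique (@Rhausdorff R) lim1 lim2.
exact.
Unshelve. all: by end_near. Qed.

End FTCBounded.

Section FTCNear0.
Variable R : realType.
Notation leb := (@lebesgue_measure R).
Implicit Types F : R -> R.

(** The bounded case applies on [[s, t]], away from the singularity of the derivative at 0; since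
    [e > 0] the derivative is integrable and [s] may tend to 0. *)
Lemma FTC_near0 F (T C L e : R) : 0 < T -> 0 < e ->
  (forall t : R, 0 < t < T -> derivable F t 1 /\ `|derive1 F t| <= C * t `^ (e - 1)) ->
  F x @[x --> 0^'+] --> L ->
  inT T (trunc T (derive1 F)) /\
  forall t, 0 < t < T -> F t = L + \int[leb]_(s in `[0, t]) trunc T (derive1 F) s.
Proof.
move=> T0 e0 dF FL.
have dF' (t : R) : 0 < t < T -> derivable F t 1 by move=> /dF[].
have mdF := measurable_derive1 dF'.
have iu : inT T (trunc T (derive1 F)).
  apply: inT_trunc.
  have iP := integrable_powR T e0.
  have i1 := @integrableZl _ _ _ leb _ (measurable_itv `]0, T[) C _ iP.
  apply: le_integrable i1 => //; first exact/measurable_EFinP.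
  move=> t; rewrite /= in_itv/= => /dF[_ h]; rewrite lee_fin.
  by apply: le_trans h _; exact: ler_norm.
split=> // t tT; have /andP[t0 tT'] := tT.
set u := trunc T (derive1 F) in iu *.
pose Psi x := \int[leb]_(s in `[0, x]) u s.
have iT : leb.-integrable `[0, T] (EFin \o u) by apply: inT_integrable iu.
have [cPsi Psi0 _] := (continuous_within_itvP Psi T0).1 (continuous_primitive (ltW T0) iT).
have P0 : Psi 0 = 0 by rewrite /Psi set_itv1 Rintegral_set1.
have key (s : R) : 0 < s -> s < t -> F s = F t - Psi t + Psi s.
  move=> s0 st.
  have iFy : leb.-integrable `[0, t] (EFin \o u) by apply: inT_integrable iu.
  have := @Rintegral_itvB R u (BLeft 0) (BRight t) s iFy.
  rewrite !bnd_simp => /(_ (ltW s0) (ltW st)) e1.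
  have C0 : 0 <= C.
    have := (dF t tT).2 => h; have := le_trans (normr_ge0 _) h.
    by rewrite pmulr_lge0// powR_gt0.
  have e2 : \int[leb]_(x in `]s, t]) u x = F t - F s.
    (* The sign of [e - 1] is not known, so the bound adds the powers at [s / 2] and at [T], one for
       each case. *)
    rewrite -(@FTC_bounded _ F (s / 2) s t ((t + T) / 2) (C * ((s / 2) `^ (e - 1) + T `^ (e - 1)))) //; try lra.
      apply: eq_Rintegral => x; rewrite inE/= in_itv/= => /andP[sx xt].
      by rewrite /u trunc_in// (lt_trans s0) ?(le_lt_trans xt).
    move=> x /andP[sx xT].
    have xT' : 0 < x < T by apply/andP; split; lra.
    have [d b] := dF x xT'; split=> //; apply: le_trans b _; apply: ler_wpM2l => //.
    have [e1'|e1'] := leP 1 e.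
      apply: (@le_trans _ _ (T `^ (e - 1))); last by rewrite lerDr powR_ge0.
      by apply: ler_powRl; lra.
    apply: (@le_trans _ _ ((s / 2) `^ (e - 1))); last by rewrite lerDl powR_ge0.
    rewrite -[e - 1]opprB !powRN lef_pV2 ?posrE ?powR_gt0 ?divr_gt0//; last by lra.
    by apply: ler_powRl; lra.
  move: e1; rewrite e2 /Psi; lra.
have lim1 : F x @[x --> 0^'+] --> F t - Psi t + Psi 0.
  have : F t - Psi t + Psi x @[x --> 0^'+] --> F t - Psi t + Psi 0.
    by apply: cvgD => //; exact: cvg_cst.
  apply: cvg_trans; apply: near_eq_cvg; near=> x.
  by rewrite -key//; near: x; exact: nbhs_right_lt.
have := cvg_unique (@Rhausdorff R) FL lim1; rewrite P0 addr0 => ->.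
by rewrite subrK.
Unshelve. all: by end_near. Qed.

End FTCNear0.

(** * Regularity of g *)

Lemma measurable_Bk (R : realType) (T a : R) : measurable_fun setT (Bk T a).
Proof. by apply: measurable_trunc; exact: measurable_beta. Qed.

Section BetaAverage.
Variables (R : realType) (a : R).
Notation leb := (@lebesgue_measure R).
Hypothesis a01 : 0 < a < 1.

Let ca01 : 0 < 1 - a <= 1.
Proof. by move: a01 => /andP[? ?]; apply/andP; split; lra. Qed.

Let a01' : 0 < a <= 1.
Proof. by move: a01 => /andP[? ?]; apply/andP; split; lra. Qed.

(* Density of the Beta(a, 1 - a) law on (0,1), written with kernels on the longer
   horizon (0,2) so that the support conditions [0 < x] and [x < 1] are automatic. *)
Definition betaw (x : R) : R := Bk 2 (1 - a) (1 - x) * Bk 2 a x.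

Lemma betaw_ge0 x : 0 <= betaw x.
Proof. by rewrite mulr_ge0// Bk_ge0. Qed.

Lemma betaw_out x : ~~ (0 < x < 1) -> betaw x = 0.
Proof.
rewrite /betaw negb_and -!leNgt => /orP[x0|x1].
  by rewrite /Bk (trunc_out (beta_ a)) ?mulr0// ltNge x0.
by rewrite /Bk (trunc_out (beta_ (1 - a))) ?mul0r// ltNge subr_le0 x1.
Qed.

Lemma measurable_betaw : measurable_fun setT betaw.
Proof.
by apply: measurable_cv_integrand; exact: measurable_Bk.
Qed.

Lemma Rintegral_betaw : \int[leb]_x betaw x = 1.
Proof.
have := congr1 (fun f => f 1) (@tcv_Bk R 2 a a01).
have h : ((0 : R) < (1 : R)) && ((1 : R) < (2 : R)) by rewrite ltr01 ltr1n.
by rewrite (tcvE _ _ h) /one trunc_in.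
Qed.

Lemma integrable_betaw : leb.-integrable setT (EFin \o betaw).
Proof.
apply/integrableP; split; first by apply/measurable_EFinP; exact: measurable_betaw.
rewrite ltNge leye_eq; apply/negP => /eqP h.
have := Rintegral_betaw; rewrite /Rintegral.
have -> : (\int[leb]_x (betaw x)%:E = +oo)%E.
  by rewrite -h; apply: eq_integral => x _; rewrite /= ger0_norm ?betaw_ge0.
by move=> /= /esym/eqP; rewrite oner_eq0.
Qed.

Section Derivative.
Variables (T C M e : R) (p : R -> R).
Hypotheses (T0 : 0 < T) (e0 : 0 < e) (e1 : e <= 1) (C0 : 0 <= C).
Hypothesis dp : forall s : R, 0 < s < T -> derivable p s 1 /\ `|derive1 p s| <= C * s `^ (e - 1).
Hypothesis pM : forall s : R, 0 < s < T -> `|p s| <= M.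

Let G t := \int[leb]_x (betaw x * p (t * x)).

Let dp' (s : R) : 0 < s < T -> derivable p s 1. Proof. by move=> /dp[]. Qed.

Let in01 (t x : R) : 0 < t < T -> 0 < x < 1 -> 0 < t * x < T.
Proof.
move=> /andP[t0 tT] /andP[x0 x1]; rewrite mulr_gt0//=.
by apply: lt_trans tT; rewrite gtr_pMr.
Qed.

Let M0 : 0 <= M.
Proof.
have h : 0 < T / 2 < T by rewrite divr_gt0//= ltr_pdivrMr// ltr_pMr// ltr1n.
exact: le_trans (pM h).
Qed.

Let mcomp (q : R -> R) (t : R) : 0 < t < T -> measurable_fun (`]0, T[ : set R) q ->
  measurable_fun setT (fun x => betaw x * q (t * x)).
Proof.
move=> tT mq.
rewrite (_ : (fun x => _) = (fun x => betaw x * trunc T q (t * x))); last first.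
  apply/funext => x; have [x01|/betaw_out ->] := boolP (0 < x < 1); last by rewrite !mul0r.
  by rewrite trunc_in//; exact: in01.
apply: measurable_funM; first exact: measurable_betaw.
apply: measurableT_comp; first exact: measurable_trunc.
exact: measurable_funM.
Qed.

Let mp : measurable_fun (`]0, T[ : set R) p. Proof. exact: measurable_derivable. Qed.

Let intp (t : R) : 0 < t < T -> leb.-integrable setT (EFin \o (fun x => betaw x * p (t * x))).
Proof.
move=> tT.
have i1 := @integrableZl _ _ _ leb setT measurableT M _ integrable_betaw.
apply: le_integrable i1 => //; first by apply/measurable_EFinP; exact: mcomp.
move=> x _; rewrite /= lee_fin [leLHS]normrM [leRHS]normrM mulrC.
have [x01|/betaw_out ->] := boolP (0 < x < 1); last by rewrite normr0 !mulr0.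
rewrite ler_wpM2r// (ger0_norm M0); apply: pM; exact: in01.
Qed.

(** Substitute [s = t x]: the powers [t^(-a)], [t^(a-1)] and the Jacobian [t] cancel. *)
Lemma conv_betaE (k : R -> R) (t : R) : 0 < t < T ->
  (forall s : R, 0 < s < T -> k s = beta_ a s * p s) -> conv (beta_ (1 - a)) k t = G t.
Proof.
move=> tT kE; have /andP[t0 tT'] := tT; have /andP[a0 a1] := a01.
have mk : measurable_fun (`]0, T[ : set R) k.
  have mm : measurable_fun (`]0, T[ : set R) (fun s => beta_ a s * p s).
    by apply: measurable_funM => //; exact: measurable_beta.
  by apply: eq_measurable_fun mm => s; rewrite inE/= in_itv/= => /kE ->.
rewrite (@conv_tcv R T)//; last exact: measurable_beta.
rewrite (tcvE _ _ tT) /cv /G /Rintegral; congr fine.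
set f : R -> \bar R := fun s => (_ * _)%:E.
have mf : measurable_fun setT f.
  apply/measurable_EFinP; apply: measurable_cv_integrand; last exact: measurable_trunc.
  exact: measurable_Bk.
rewrite (@integral_affine R f t 0 t0 mf).
have fE (x : R) : f (t * x + 0) = ((t^-1)%:E * (betaw x * p (t * x))%:E)%E.
  rewrite /f addr0 -EFinM; congr EFin.
  have [x01|x01] := boolP (0 < x < 1); last first.
    rewrite (betaw_out x01) mul0r mulr0.
    move: x01; rewrite negb_and -!leNgt => /orP[x0|x1].
      by rewrite (trunc_out k) ?mulr0// ltNge mulr_ge0_le0// ltW.
    rewrite trunc_out ?mul0r// ltNge subr_le0 ler_peMr//.
    exact: ltW.
  have /andP[x0 x1] := x01.
  have h1 : 0 < t * x < T by exact: in01.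
  have h2 : 0 < t - t * x < T.
    have -> : t - t * x = t * (1 - x) by ring.
    by apply: in01 => //; apply/andP; split; lra.
  rewrite !trunc_in// kE// /betaw !BkE; [|by apply/andP; split; lra|by apply/andP; split; lra].
  rewrite /beta_.
  have -> : t - t * x = t * (1 - x) by ring.
  rewrite !powRM ?ltW//; last by lra.
  have -> : 1 - a - 1 = - a by ring.
  have -> : t^-1 = t `^ (- a) * t `^ (a - 1).
    rewrite -powRD; last by rewrite (gt_eqF t0) implybT.
    by rewrite (_ : - a + (a - 1) = -1) ?powR_inv1 ?ltW//; ring.
  by ring.
have -> : (\int[leb]_x f (t * x + 0)%R)%E = (\int[leb]_x ((t^-1)%:E * (betaw x * p (t * x))%:E))%E.
  by apply: eq_integral => x _; exact: fE.
rewrite integralZl//; last exact: intp.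
by rewrite muleA -EFinM divff ?gt_eqF// mul1e.
Qed.

(** Differentiation under the integral gives [G' t] as the average of [x p' (t x)], and
    [x (t x)^(e-1) <= t^(e-1)] because [x^e <= 1]: averaging does not worsen the singularity of
    [p']. *)
Lemma derive_betaw_average (t : R) : 0 < t < T ->
  derivable G t 1 /\ `|derive1 G t| <= C * t `^ (e - 1).
Proof.
move=> tT; have /andP[t0 tT'] := tT.
pose f' x y := betaw y * (y * derive1 p (x * y)).
have df (x y : R) : t / 2 < x < T -> setT y -> is_derive x (1 : R) (fun x => betaw y * p (x * y)) (f' x y).
  move=> /andP[tx xT] _.
  have [y01|y01] := boolP (0 < y < 1); last first.
    rewrite /f' (betaw_out y01) mul0r.
    rewrite (_ : (fun _ => _) = cst 0); first exact: is_derive_cst.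
    by apply/funext => z; rewrite mul0r.
  have xT' : 0 < x < T by apply/andP; split; lra.
  have d1 : is_derive (x * y) (1 : R) p (derive1 p (x * y)).
    by rewrite derive1E; apply: derivableP; apply: dp'; exact: in01.
  have d2 : is_derive x (1 : R) (fun x : R => x * y) y.
    by apply: is_derive_eq; rewrite /GRing.scale/= ?mulr0 ?addr0 ?mulr1 ?mul1r ?add0r.
  have d3 := @is_derive1_comp _ p (fun x : R => x * y) x (derive1 p (x * y)) y d1 d2.
  apply: is_derive_eq; rewrite /f' /GRing.scale/=; ring.
have fb (x y : R) : 0 < x < T -> `|f' x y| <= C * x `^ (e - 1) * betaw y.
  move=> xT; rewrite /f' normrM (ger0_norm (betaw_ge0 _)) mulrC.
  have [y01|y01] := boolP (0 < y < 1); last by rewrite (betaw_out y01) !mulr0.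
  rewrite ler_wpM2r ?betaw_ge0// normrM.
  have /andP[y0 y1] := y01; have /andP[x0 _] := xT.
  have h := (dp (in01 xT y01)).2.
  rewrite gtr0_norm//; apply: (le_trans (ler_wpM2l (ltW y0) h)).
  rewrite (powRM _ (ltW x0) (ltW y0)).
  have -> : y * (C * (x `^ (e - 1) * y `^ (e - 1))) = C * (x `^ (e - 1) * (y * y `^ (e - 1))) by ring.
  rewrite ler_wpM2l// ler_piMr ?powR_ge0//.
  rewrite (mulr_powRB1 (ltW y0) e0).
  by rewrite -[X in _ <= X](powRr0 y); apply: ger_powR; rewrite ?y0 ?ltW.
(* Domination is needed near [t] only; [x > t / 2] keeps the singular power bounded. *)
pose D y := C * (t / 2) `^ (e - 1) * betaw y.
have D0 y : 0 <= D y by rewrite mulr_ge0 ?betaw_ge0// mulr_ge0// powR_ge0.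
have iD : leb.-integrable setT (EFin \o D).
  have := @integrableZl _ _ _ leb setT measurableT (C * (t / 2) `^ (e - 1)) _ integrable_betaw.
  by apply: eq_integrable => // y _; rewrite /D /= EFinM.
have ub (x y : R) : t / 2 < x < T -> setT y -> `|f' x y| <= D y.
  move=> /andP[tx xT] _; have x0 : 0 < x by lra.
  apply: le_trans (fb x y _) _; first by rewrite x0.
  rewrite ler_wpM2r ?betaw_ge0// ler_wpM2l//.
  rewrite -[e - 1]opprB !powRN lef_pV2 ?posrE ?powR_gt0//; last by lra.
  by apply: ler_powRl; [rewrite subr_ge0|rewrite ltW// divr_gt0|exact: ltW].
have intf (x : R) : t / 2 < x < T -> leb.-integrable setT (EFin \o (fun y => betaw y * p (x * y))).
  by move=> /andP[tx xT]; apply: intp; apply/andP; split; lra.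
have uv : t / 2 < t < T by apply/andP; split; lra.
have [dG eG] := derive_Rintegral measurableT uv intf df D0 iD ub.
split=> //; rewrite eG.
have mf' : measurable_fun setT (f' t).
  rewrite (_ : f' t = fun y => y * (betaw y * derive1 p (t * y))); last first.
    by apply/funext => y; rewrite /f' mulrCA.
  by apply: measurable_funM => //; apply: mcomp => //; exact: measurable_derive1.
have iE : leb.-integrable setT (EFin \o (fun y => C * t `^ (e - 1) * betaw y)).
  have := @integrableZl _ _ _ leb setT measurableT (C * t `^ (e - 1)) _ integrable_betaw.
  by apply: eq_integrable => // y _; rewrite /= EFinM.
have E0 y : 0 <= C * t `^ (e - 1) * betaw y by rewrite mulr_ge0 ?betaw_ge0// mulr_ge0// powR_ge0.
have if' : leb.-integrable setT (EFin \o f' t).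
  apply: le_integrable iE => //; first exact/measurable_EFinP.
  by move=> y _; rewrite /= lee_fin (ger0_norm (E0 y)); exact: fb.
apply: (le_trans (le_normr_Rintegral measurableT if')).
apply: (@le_trans _ _ (\int[leb]_y (C * t `^ (e - 1) * betaw y))).
  apply: le_Rintegral => //; first exact: (integrable_norm if').
  by move=> y _; exact: fb.
by rewrite RintegralZl// ?Rintegral_betaw ?mulr1//; exact: integrable_betaw.
Qed.

(** [betaw] is a probability density on []0, 1[], where [t x < t]; smallness of [p - L] near 0 thus
    passes to the average. *)
Lemma cvg_betaw_average (L : R) : p x @[x --> 0^'+] --> L -> G x @[x --> 0^'+] --> L.
Proof.
move=> /cvgrPdist_le pL; apply/cvgrPdist_le => eps eps0.
have [d /= d0 hd] := pL eps eps0.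
near=> t.
have t0 : 0 < t by near: t; exact: nbhs_right_gt.
have td : t < d by near: t; exact: nbhs_right_lt.
have tT : 0 < t < T by rewrite t0; near: t; exact: nbhs_right_lt.
have iL : leb.-integrable setT (EFin \o (fun x => betaw x * L)).
  have := @integrableZr _ _ _ leb setT measurableT L _ integrable_betaw.
  by apply: eq_integrable => // y _; rewrite /= EFinM.
have iE : leb.-integrable setT (EFin \o (fun x => betaw x * eps)).
  have := @integrableZr _ _ _ leb setT measurableT eps _ integrable_betaw.
  by apply: eq_integrable => // y _; rewrite /= EFinM.
have -> : L = \int[leb]_x (betaw x * L).
  by rewrite RintegralZr ?Rintegral_betaw ?mul1r//; exact: integrable_betaw.
have -> : eps = \int[leb]_x (betaw x * eps).
  by rewrite RintegralZr ?Rintegral_betaw ?mul1r//; exact: integrable_betaw.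
have ip := intp tT.
rewrite /G -RintegralB//.
have iB : leb.-integrable setT (EFin \o (fun x => betaw x * L - betaw x * p (t * x))).
  have := @integrableB _ _ _ leb setT measurableT _ _ iL ip.
  by apply: eq_integrable => // y _; rewrite /= EFinB.
apply: (le_trans (le_normr_Rintegral measurableT iB)).
apply: le_Rintegral => //; first exact: (integrable_norm iB).
move=> x _; rewrite -mulrBr normrM (ger0_norm (betaw_ge0 _)).
have [x01|/betaw_out ->] := boolP (0 < x < 1); last by rewrite !mul0r.
rewrite ler_wpM2l ?betaw_ge0//.
have /andP[x0 x1] := x01.
apply: hd => /=; last by rewrite mulr_gt0.
rewrite sub0r normrN gtr0_norm ?mulr_gt0//.
by apply: lt_trans td; rewrite gtr_pMr.
Unshelve. all: by end_near. Qed.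

End Derivative.
End BetaAverage.

(** * The quotient of the variable-order kernel by [beta_a] *)

Section KernelRatio.
Variables (R : realType) (T : R) (alpha : R -> R) (Qs : R).
Hypothesis T0 : 0 < T.
Hypothesis alpha01 : forall t : R, 0 <= t <= T -> 0 < alpha t < 1.
Hypothesis alphaC : {within `[0, T], continuous alpha}.
Hypothesis dalpha : forall t : R, 0 < t < T -> derivable alpha t 1 /\ `|derive1 alpha t| <= Qs.

Let a := alpha 0.

(** The quotient [p] of the overview, with its power as an exponential: the exponent is
    [O(s |ln s|)] and tends to 0 with [s]. *)
Definition kratio (s : R) : R :=
  expR ((alpha s - a) * ln s) * (Gamma a / Gamma (alpha s)).

Let aP : 0 < a < 1. Proof. by apply: alpha01; rewrite lexx ltW. Qed.

Let Qs0 : 0 <= Qs.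
Proof.
have h : 0 < T / 2 < T by rewrite divr_gt0//= ltr_pdivrMr// ltr_pMr// ltr1n.
exact: le_trans (dalpha h).2.
Qed.

Let in_cc (s : R) : 0 < s < T -> 0 <= s <= T.
Proof. by move=> /andP[s0 sT]; rewrite !ltW. Qed.

Let Gge (x : R) : 0 < x < 1 -> expR (- 2) / 2 <= Gamma x.
Proof. by move=> /andP[x0 x1]; apply: Gamma_lower; rewrite x0 ltW. Qed.

Let Ggt0 (x : R) : 0 < x < 1 -> 0 < Gamma x.
Proof. by move=> /andP[x0 x1]; apply: Gamma_gt0; rewrite x0 ltW. Qed.

Lemma kker_ratio (s : R) : 0 < s < T -> kker alpha s = beta_ a s * kratio s.
Proof.
move=> sT; have /andP[s0 _] := sT.
have G1 : Gamma a != 0 by rewrite gt_eqF// Ggt0.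
rewrite /kker /beta_ /kratio /powR gt_eqF//.
have -> : (alpha s - 1) * ln s = (a - 1) * ln s + (alpha s - a) * ln s by ring.
rewrite expRD; field.
by rewrite G1 gt_eqF// Ggt0// alpha01// in_cc.
Qed.

Lemma alpha_lipschitz0 (s : R) : 0 < s < T -> `|alpha s - a| <= Qs * s.
Proof.
move=> /andP[s0 sT].
have [c] : exists2 c, c \in `]0, s[%R & alpha s - alpha 0 = derive1 alpha c * (s - 0).
  apply: MVT => // [t|].
    rewrite in_itv/= => /andP[t0 ts].
    rewrite derive1E; apply: derivableP; apply: (dalpha _).1.
    by rewrite t0 (lt_trans ts).
  by apply: continuous_subspaceW alphaC; apply: subset_itvl; rewrite bnd_simp ltW.
rewrite in_itv/= subr0 => /andP[c0 cs] ->.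
rewrite normrM (gtr0_norm s0) ler_wpM2r ?(ltW s0)//; apply: (dalpha _).2.
by rewrite c0 (lt_trans cs).
Qed.

(** For [s <= 1], [|ln s| <= 4 s^(-1/4)]; for [s > 1], [ln s <= s = s^(5/4) s^(-1/4)] with [s < T].
    The sum covers both cases. *)
Let N := 4 + T `^ (5 / 4).

Let N0 : 0 <= N. Proof. by rewrite addr_ge0// powR_ge0. Qed.

Lemma norm_ln_le (s : R) : 0 < s < T -> `|ln s| <= N * s `^ (3 / 4 - 1).
Proof.
move=> /andP[s0 sT].
have e4 : 3 / 4 - 1 = - 4^-1 :> R by lra.
rewrite e4 /N mulrDl.
have [s1|s1] := leP s 1.
  have h4 : 0 < 4^-1 :> R by rewrite invr_gt0.
  apply: le_trans (norm_ln_le1 h4 s0 s1) _.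
  rewrite invrK mulrC lerDl mulr_ge0 ?powR_ge0//.
apply: le_trans (norm_ln_ge1 ltr01 (ltW s1)) _.
rewrite divr1 powRr1 ?(ltW s0)//.
apply: (@le_trans _ _ (T `^ (5 / 4) * s `^ (- 4^-1))); last first.
  by rewrite lerDr mulr_ge0 ?powR_ge0.
rewrite [leLHS](_ : s = s `^ (5 / 4) * s `^ (- 4^-1)); last first.
  rewrite -powRD; last by rewrite (gt_eqF s0) implybT.
  by rewrite (_ : 5 / 4 + - 4^-1 = 1) ?powRr1 ?(ltW s0)//; lra.
rewrite ler_wpM2r ?powR_ge0//; apply: ler_powRl; [|exact: ltW|exact: ltW].
by rewrite divr_ge0.
Qed.

(** Lets bounded terms be absorbed into the singular weight [s^(-1/4)]. *)
Let one_le (s : R) : 0 < s < T -> 1 <= T `^ (1 / 4) * s `^ (3 / 4 - 1).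
Proof.
move=> /andP[s0 sT].
rewrite [leLHS](_ : 1 = s `^ (1 / 4) * s `^ (3 / 4 - 1)); last first.
  rewrite -powRD; last by rewrite (gt_eqF s0) implybT.
  by rewrite (_ : 1 / 4 + (3 / 4 - 1) = 0) ?powRr0//; lra.
rewrite ler_wpM2r ?powR_ge0//; apply: ler_powRl; [|exact: ltW|exact: ltW].
by rewrite divr_ge0.
Qed.

Lemma exponent_bound (s : R) : 0 < s < T -> `|(alpha s - a) * ln s| <= Qs * N * s `^ (3 / 4).
Proof.
move=> sT; have /andP[s0 _] := sT; rewrite normrM.
apply: le_trans (ler_pM (normr_ge0 _) (normr_ge0 _) (alpha_lipschitz0 sT) (norm_ln_le sT)) _.
have h : 0 < 3 / 4 :> R by rewrite divr_gt0.
by rewrite mulrACA (mulr_powRB1 (ltW s0) h).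
Qed.

Let ME := expR (Qs * N * T `^ (3 / 4)).
Let g0 : R := expR (- 2) / 2.

Let g0_gt0 : 0 < g0. Proof. by rewrite divr_gt0// expR_gt0. Qed.

Let E_le (s : R) : 0 < s < T -> expR ((alpha s - a) * ln s) <= ME.
Proof.
move=> sT; have /andP[s0 s1] := sT; rewrite ler_expR; apply: le_trans (ler_norm _) _.
apply: le_trans (exponent_bound sT) _; rewrite ler_wpM2l ?mulr_ge0//.
by apply: ler_powRl; [rewrite divr_ge0|exact: ltW|exact: ltW].
Qed.

(** By compactness [alpha] keeps away from 0 and 1, where the bounds on the derivative of [Gamma]
    would degenerate. *)
Let alpha_cpt : exists u v : R, [/\ 0 < u, v < 1 & forall t : R, 0 <= t <= T -> u < alpha t /\ alpha t < v].
Proof.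
have [x + xmin] := EVT_min (ltW T0) alphaC.
have [y + ymax] := EVT_max (ltW T0) alphaC.
rewrite !in_itv/= => /alpha01/andP[y0 y1] /alpha01/andP[x0 x1].
exists (alpha x / 2), ((1 + alpha y) / 2); split; [lra|lra|].
move=> t tT; have tI : t \in `[0, T] by rewrite in_itv.
by have := xmin t tI; have := ymax t tI; split; lra.
Qed.

Lemma kratio_bounds : exists C M : R, [/\ 0 <= C,
  (forall s : R, 0 < s < T -> derivable kratio s 1 /\ `|derive1 kratio s| <= C * s `^ (3 / 4 - 1)) &
  (forall s : R, 0 < s < T -> `|kratio s| <= M)].
Proof.
have [u [v [u0 v1 auv]]] := alpha_cpt.
have [Mg [Mg0 dG]] := Gamma_derivable u0 v1.
have Ga0 := Ggt0 aP.
have ME0 : 0 <= ME by exact: expR_ge0.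
(* [C1] bounds the derivative of the exponent, [alpha' ln s + (alpha s - a) / s], and [C2] that of
   [1 / Gamma (alpha s)], both relative to [s^(-1/4)]. *)
pose C1 := Qs * N + Qs * T `^ (1 / 4).
pose C2 := g0 ^- 2 * (Mg * Qs) * T `^ (1 / 4).
have T4 : 0 <= T `^ (1 / 4) by exact: powR_ge0.
have C10 : 0 <= C1 by rewrite addr_ge0// mulr_ge0.
have C20 : 0 <= C2.
  by rewrite mulr_ge0// mulr_ge0 ?invr_ge0 ?exprn_ge0 ?(ltW g0_gt0)// mulr_ge0.
have Gr (s : R) : 0 < s < T -> `|Gamma a / Gamma (alpha s)| <= Gamma a / g0.
  move=> sT; have h := alpha01 (in_cc sT).
  rewrite ger0_norm ?(divr_ge0 (ltW Ga0) (ltW (Ggt0 h)))// ler_pM2l//.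
  by rewrite lef_pV2 ?posrE ?Ggt0//; exact: Gge.
exists (ME * C1 * (Gamma a / g0) + ME * (Gamma a * C2)), (ME * (Gamma a / g0)).
split.
- have q : 0 <= Gamma a / g0 by rewrite divr_ge0 ?(ltW Ga0) ?(ltW g0_gt0).
  by rewrite addr_ge0 ?(mulr_ge0 (mulr_ge0 ME0 C10) q) ?(mulr_ge0 ME0 (mulr_ge0 (ltW Ga0) C20)).
- move=> s sT; have /andP[s0 s1] := sT.
  have as01 := alpha01 (in_cc sT).
  have [ua av] := auv s (in_cc sT).
  have [dA bA] := dalpha sT; have [dGs bG] := dG _ ua av.
  set A' := derive1 alpha s in bA; set G' := derive1 (@Gamma R) (alpha s) in bG.
  have iA : is_derive s (1 : R) alpha A' by rewrite /A' derive1E; exact: derivableP.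
  have iG : is_derive (alpha s) (1 : R) (@Gamma R) G' by rewrite /G' derive1E; exact: derivableP.
  have iGA := is_derive1_comp iG iA.
  have Gs0 : (@Gamma R \o alpha) s != 0 by rewrite /= gt_eqF// Ggt0.
  have iV := is_deriveV Gs0 iGA.
  have iL := is_derive1_ln s0.
  pose E := expR ((alpha s - a) * ln s).
  have iE : is_derive s (1 : R) (fun s => expR ((alpha s - a) * ln s))
      (E * (A' * ln s + (alpha s - a) / s)).
    apply: is_derive_eq; rewrite /GRing.scale/= -/E; ring.
  pose D := E * (A' * ln s + (alpha s - a) / s) * (Gamma a / Gamma (alpha s))
     + E * (Gamma a * (- Gamma (alpha s) ^- 2 * (G' * A'))).
  have iD : is_derive s (1 : R) kratio D.
    rewrite (_ : kratio = (fun s => expR ((alpha s - a) * ln s)) \* (fun s => Gamma a * (Gamma (alpha s))^-1))//.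
    apply: is_derive_eq; rewrite /D /GRing.scale/= -/E; ring.
  split; first exact: ex_derive.
  rewrite derive1E (@derive_val _ _ _ _ _ _ _ iD) /D.
  have E0 : 0 <= E by exact: expR_ge0.
  have EM : E <= ME by exact: E_le.
  have w0 : 0 <= s `^ (3 / 4 - 1) by exact: powR_ge0.
  have h1 : `|A' * ln s + (alpha s - a) / s| <= C1 * s `^ (3 / 4 - 1).
    apply: le_trans (ler_normD _ _) _; rewrite /C1 [leRHS]mulrDl; apply: lerD.
      rewrite normrM -mulrA; apply: ler_pM => //; exact: norm_ln_le.
    rewrite normrM normfV (gtr0_norm s0) -mulrA.
    apply: (@le_trans _ _ Qs); last by rewrite ler_peMr// one_le.
    by rewrite ler_pdivrMr// alpha_lipschitz0.
  have h2 : `|- Gamma (alpha s) ^- 2 * (G' * A')| <= C2 * s `^ (3 / 4 - 1).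
    have q : `|- Gamma (alpha s) ^- 2 * (G' * A')| <= g0 ^- 2 * (Mg * Qs).
      rewrite normrM normrN; apply: ler_pM => //.
        rewrite ger0_norm ?invr_ge0 ?exprn_ge0 ?(ltW (Ggt0 as01))//.
        rewrite lef_pV2 ?posrE ?exprn_gt0 ?Ggt0//.
        by rewrite lerXn2r ?nnegrE ?(ltW g0_gt0) ?(ltW (Ggt0 as01))//; exact: Gge.
      by rewrite normrM; exact: ler_pM.
    apply: le_trans q _; rewrite /C2 -mulrA ler_peMr ?one_le//.
    by rewrite mulr_ge0 ?invr_ge0 ?exprn_ge0 ?(ltW g0_gt0)// mulr_ge0.
  apply: le_trans (ler_normD _ _) _; rewrite [leRHS]mulrDl; apply: lerD.
    rewrite !normrM (ger0_norm E0) -normrM.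
    rewrite [leRHS](_ : _ = ME * (C1 * s `^ (3 / 4 - 1)) * (Gamma a / g0)); last by ring.
    apply: ler_pM => //; [by rewrite mulr_ge0|by apply: ler_pM|exact: Gr].
  rewrite normrM (ger0_norm E0) -mulrA; apply: ler_pM => //.
  by rewrite normrM (gtr0_norm Ga0) -mulrA ler_pM2l.
- move=> s sT; rewrite /kratio normrM; apply: ler_pM => //; last exact: Gr.
  by rewrite ger0_norm ?expR_ge0//; exact: E_le.
Qed.

Lemma cvg_kratio : kratio x @[x --> 0^'+] --> (1 : R).
Proof.
have [u [v [u0 v1 auv]]] := alpha_cpt.
have [Mg [Mg0 dG]] := Gamma_derivable u0 v1.
have [_ al0 _] := (continuous_within_itvP alpha T0).1 alphaC.
have [ua av] : u < a /\ a < v by apply: auv; rewrite lexx ltW.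
have cG : {for a, continuous (@Gamma R)}.
  by apply: differentiable_continuous; apply/derivable1_diffP; exact: (dG _ ua av).1.
have lG : Gamma (alpha x) @[x --> 0^'+] --> Gamma a.
  by apply: (continuous_cvg _ cG); exact: al0.
have Ga0 : Gamma a != 0 by rewrite gt_eqF// Ggt0.
have -> : 1 = expR 0 * (Gamma a / Gamma a) by rewrite expR0 mul1r divff.
apply: cvgM; last by apply: cvgM; [exact: cvg_cst|exact: cvgV].
apply: (continuous_cvg _ (@continuous_expR R 0)).
apply: norm_cvg0.
have lim0 : Qs * N * x `^ (3 / 4) @[x --> 0^'+] --> (0 : R).
  suff lp : x `^ (3 / 4) @[x --> 0^'+] --> (0 : R).
    have : Qs * N * x `^ (3 / 4) @[x --> 0^'+] --> Qs * N * 0.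
      by apply: cvgM => //; exact: cvg_cst.
    by rewrite mulr0.
  apply/cvgrPdist_le => eps eps0; near=> x.
  have x0 : 0 < x by near: x; exact: nbhs_right_gt.
  have xe : x < eps `^ (4 / 3) by near: x; apply: nbhs_right_lt; rewrite powR_gt0.
  rewrite sub0r normrN ger0_norm ?powR_ge0//.
  rewrite [leRHS](_ : eps = (eps `^ (4 / 3)) `^ (3 / 4)); last first.
    by rewrite -powRrM (_ : 4 / 3 * (3 / 4) = 1) ?powRr1 ?(ltW eps0)//; lra.
  by apply: ler_powRl; [rewrite divr_ge0|exact: ltW|exact: ltW].
apply: squeeze_cvgr lim0; last exact: (cvg_cst (0 : R)).
near=> x; rewrite normr_ge0/=; apply: exponent_bound; apply/andP; split.
  by near: x; exact: nbhs_right_gt.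
by near: x; exact: nbhs_right_lt.
Unshelve. all: by end_near. Qed.

End KernelRatio.

(** * Factorization of the variable-order kernel *)

Lemma mulr_1Dr (A : comNzRingType) (b h : A) : b + b * h = b * (1 + h).
Proof. by rewrite mulrDr mulr1. Qed.

(** Read [c] as [beta_(1-a)], [b] as [beta_a], [o] as the constant 1 and [h] as [g'], and multiply
    [c k = g] by [b]. An abstract ring lets [ring] see plain variables. *)
Lemma comring_cancel_inverse (A : comNzRingType) (o b c k h : A) :
  c * b = o -> c * k = o * (1 + h) -> o * k = o * (b * (1 + h)).
Proof. by move=> <- e; rewrite mulrAC e; ring. Qed.

Section KernelFactorization.
Variables (R : realType) (T : R) (alpha : R -> R) (Qs : R).
Notation leb := (@lebesgue_measure R).
Local Notation inT := (inT T).
Local Notation tcv := (tcv T).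
Local Notation trunc := (trunc T).
Local Notation emb := (@emb R T).
Hypothesis T0 : 0 < T.
Hypothesis alpha01 : forall t : R, 0 <= t <= T -> 0 < alpha t < 1.
Hypothesis alphaC : {within `[0, T], continuous alpha}.
Hypothesis dalpha : forall t : R, 0 < t < T -> derivable alpha t 1 /\ `|derive1 alpha t| <= Qs.

Let a := alpha 0.

Let aP : 0 < a < 1. Proof. by apply: alpha01; rewrite lexx ltW. Qed.

Lemma gker_regular : exists C : R,
  [/\ 0 <= C, measurable_fun (`]0, T[ : set R) (derive1 (gker alpha)),
   forall t : R, 0 < t < T -> `|derive1 (gker alpha) t| <= C * t `^ (3 / 4 - 1),
   inT (trunc (derive1 (gker alpha))) &
   forall t : R, 0 < t < T -> gker alpha t = 1 + \int[leb]_(s in `[0, t]) trunc (derive1 (gker alpha)) s].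
Proof.
have [C [M [C0 dk kM]]] := kratio_bounds T0 alpha01 alphaC dalpha.
have e0 : 0 < 3 / 4 :> R by rewrite divr_gt0.
have e1 : 3 / 4 <= 1 :> R by lra.
have kE := kker_ratio T0 alpha01.
pose G t := \int[leb]_x (betaw a x * kratio alpha (t * x)).
have gE (t : R) : 0 < t < T -> gker alpha t = G t.
  by move=> tT; exact: (conv_betaE aP T0 dk kM tT kE).
have gnear (t : R) : 0 < t < T -> \forall x \near t, G x = gker alpha x.
  move=> tT; have tI : t \in `]0, T[ by rewrite in_itv.
  near=> x; apply/esym/gE; have : x \in `]0, T[ by near: x; exact: near_in_itvoo.
  by rewrite in_itv.
have dg (t : R) : 0 < t < T -> derivable (gker alpha) t 1 /\
    `|derive1 (gker alpha) t| <= C * t `^ (3 / 4 - 1).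
  move=> tT; have [d b] := derive_betaw_average aP T0 e0 e1 C0 dk kM tT.
  split; first exact: near_eq_derivable (gnear t tT) d.
  by rewrite derive1E -(near_eq_derive _ (gnear t tT)) -derive1E.
have g1 : gker alpha x @[x --> 0^'+] --> (1 : R).
  have := cvg_betaw_average aP T0 dk kM (cvg_kratio T0 alpha01 alphaC dalpha).
  apply: cvg_trans; apply: near_eq_cvg; near=> x; apply/esym/gE.
  apply/andP; split; first by near: x; exact: nbhs_right_gt.
  by near: x; exact: nbhs_right_lt.
have [ih gF] := FTC_near0 T0 e0 dg g1.
exists C; split=> //; last by move=> t /dg[].
by apply: measurable_derive1 => t /dg[].
Unshelve. all: by end_near. Qed.

Lemma kker_inT : inT (trunc (kker alpha)) /\ measurable_fun (`]0, T[ : set R) (kker alpha).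
Proof.
have [C [M [C0 dk kM]]] := kratio_bounds T0 alpha01 alphaC dalpha.
have kE := kker_ratio T0 alpha01.
have mk : measurable_fun (`]0, T[ : set R) (kker alpha).
  have mm : measurable_fun (`]0, T[ : set R) (fun s => beta_ a s * kratio alpha s).
    apply: measurable_funM; first exact: measurable_beta.
    by apply: measurable_derivable => t /dk[].
  by apply: eq_measurable_fun mm => s; rewrite inE/= in_itv/= => /kE ->.
split=> //; apply: inT_trunc.
have a0 : 0 < a by case/andP: aP.
have iB := inT_integrable (measurable_itv `]0, T[) (@inT_Bk R T a a0).
have i1 := @integrableZl _ _ _ leb _ (measurable_itv `]0, T[) M _ iB.
apply: le_integrable i1 => //; first exact/measurable_EFinP.
move=> t; rewrite /= in_itv/= => tT; rewrite lee_fin kE// normrM [leRHS]normrM mulrC.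
rewrite /Bk trunc_in// ler_wpM2r//; apply: le_trans (kM t tT) _; exact: ler_norm.
Qed.

Lemma emb_kker : emb (trunc (kker alpha)) =
  emb (Bk T a) * (1 + emb (trunc (derive1 (gker alpha)))).
Proof.
have [C [C0 mg gb ih gF]] := gker_regular.
have [ik mk] := kker_inT.
have /andP[a0 a1] := aP.
have iB : inT (Bk T a) by exact: inT_Bk.
have iC : inT (Bk T (1 - a)) by apply: inT_Bk; lra.
have io := inT_one T.
set h := trunc _ in ih gF *; set k := trunc _ in ik *.
have ck : tcv (Bk T (1 - a)) k = one T \+ tcv (one T) h.
  apply/funext => t.
  have [tT|tT] := boolP (0 < t < T); last first.
    by rewrite /= !(tcv_out _ _ tT) /one trunc_out// addr0.
  rewrite /= (tcv_one ih tT) /one (trunc_in _ tT) -(gF t tT).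
  by rewrite /gker (conv_tcv (@measurable_beta R (1 - a) _) mk tT).
have eck : emb (Bk T (1 - a)) * emb k = emb (one T) * (1 + emb h).
  by rewrite -(embM iC ik) ck (embD io (inT_tcv io ih)) (embM io ih) mulr_1Dr.
have ebc : emb (Bk T (1 - a)) * emb (Bk T a) = emb (one T) by rewrite -(embM iC iB) tcv_Bk.
have iBh : inT (tcv (Bk T a) h) by exact: inT_tcv.
have hb : emb (Bk T a \+ tcv (Bk T a) h) = emb (Bk T a) * (1 + emb h).
  by rewrite (embD iB iBh) (embM iB ih) mulr_1Dr.
rewrite -hb; apply: (emb_one_inj ik (inTD iB iBh)); rewrite hb.
exact: comring_cancel_inverse ebc eck.
Qed.

End KernelFactorization.

(** * Bounds on the resolvent of the variable-order kernel *)

Section SquareIntegral.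
Variables (R : realType) (T : R).
Notation leb := (@lebesgue_measure R).
Implicit Types u v : R -> R.
Local Notation inT := (inT T).
Local Notation tcv := (tcv T).

Definition L2sq u : \bar R := (\int[leb]_t ((u t) ^+ 2)%:E)%E.

Lemma measurable_L2sq u : measurable_fun setT u -> measurable_fun setT (fun t => ((u t) ^+ 2)%:E).
Proof. by move=> mu; apply/measurable_EFinP; exact: measurable_funX. Qed.

Lemma L2sq_ge0 u : (0 <= L2sq u)%E.
Proof. by apply: integral_ge0 => x _; rewrite lee_fin sqr_ge0. Qed.

Lemma L2sq_le u v : measurable_fun setT u -> measurable_fun setT v ->
  {ae leb, forall t, `|u t| <= `|v t|} -> (L2sq u <= L2sq v)%E.
Proof.
move=> mu mv uv; apply: ae_ge0_le_integral => //.
- by move=> x _; rewrite lee_fin sqr_ge0.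
- exact: measurable_L2sq.
- by move=> x _; rewrite lee_fin sqr_ge0.
- exact: measurable_L2sq.
move: uv; apply: ae_imply => t h _; rewrite lee_fin.
by rewrite -[leLHS]real_normK ?num_real// -[leRHS]real_normK ?num_real// lerXn2r ?nnegrE.
Qed.

Lemma L2sqZ c u : measurable_fun setT u -> L2sq (fun t => c * u t) = ((c ^+ 2)%:E * L2sq u)%E.
Proof.
move=> mu; rewrite /L2sq -ge0_integralZl//.
- by apply: eq_integral => t _; rewrite exprMn EFinM.
- exact: measurable_L2sq.
- by move=> x _; rewrite lee_fin sqr_ge0.
- by rewrite lee_fin sqr_ge0.
Qed.

Lemma L2sqD u v : measurable_fun setT u -> measurable_fun setT v ->
  (L2sq (u \+ v)%R <= 2%:E * (L2sq u + L2sq v))%E.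
Proof.
move=> mu mv; rewrite /L2sq -ge0_integralD//; first last.
- exact: measurable_L2sq.
- by move=> x _; rewrite lee_fin sqr_ge0.
- exact: measurable_L2sq.
- by move=> x _; rewrite lee_fin sqr_ge0.
rewrite -ge0_integralZl//; first last.
- by move=> x _; rewrite adde_ge0// lee_fin sqr_ge0.
- by apply: emeasurable_funD; exact: measurable_L2sq.
apply: ge0_le_integral => //.
- by move=> x _; rewrite lee_fin sqr_ge0.
- by apply: measurable_L2sq; exact: measurable_funD.
- by apply: measurable_funeM; apply: emeasurable_funD; exact: measurable_L2sq.
move=> x _; rewrite -EFinD -EFinM lee_fin /= -subr_ge0.
have -> : 2 * (u x ^+ 2 + v x ^+ 2) - (u x + v x) ^+ 2 = (u x - v x) ^+ 2 by ring.
exact: sqr_ge0.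
Qed.

Lemma L2sq_tcv u v : inT u -> inT v -> (L2sq (tcv u v) <= L1norm u * L1norm u * L2sq v)%E.
Proof.
move=> iu iv; have mu := inT_measurable iu; have mv := inT_measurable iv.
apply: le_trans (integral_sqr_tcv iu mv).
apply: L2sq_le; [exact: inT_measurable (inT_tcv iu iv)|exact: measurable_cv|].
by apply: ae_all => t; rewrite /tcv truncE; case: ifP; rewrite ?normr0.
Qed.

Lemma measurable_powR_mul (e : R) u : measurable_fun setT u ->
  measurable_fun setT (fun t => t `^ e * u t).
Proof. by move=> mu; apply: measurable_funM => //; exact: measurable_powR. Qed.

Lemma L2sq_weight (e : R) u : 0 <= e -> inT u ->
  (L2sq (fun t => (t `^ e * u t)%R) <= ((T `^ e) ^+ 2)%:E * L2sq u)%E.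
Proof.
move=> e0 iu; have mu := inT_measurable iu.
rewrite -L2sqZ//; apply: L2sq_le; [exact: measurable_powR_mul|exact: measurable_funM|].
apply: ae_all => t; rewrite !normrM !(ger0_norm (powR_ge0 _ _)).
have [/andP[t0 tT]|/iu.2 ->] := boolP (0 < t < T); last by rewrite normr0 !mulr0.
by rewrite ler_wpM2r//; apply: ler_powRl => //; exact: ltW.
Qed.

End SquareIntegral.

(* Amounts to the factorization [1 - r = (1 - x) (1 + r h)]. *)
Lemma resolvent_factor (A : comNzRingType) (x r l b h K : A) :
  (1 - r) * (1 + l * b) = 1 -> K = l * (b * (1 + h)) -> (1 - x) * (1 + K) = 1 ->
  x = r + (r * h - x * (r * h)).
Proof.
move=> e1 -> e2.
have e3 : (1 - r) * (l * b) = r.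
  by transitivity ((1 - r) * (1 + l * b) - (1 - r)); [ring|rewrite e1; ring].
have e4 : 1 - r = (1 - x) * (1 + r * h).
  transitivity ((1 - x) * (1 + l * (b * (1 + h))) * (1 - r)); first by rewrite e2 mul1r.
  transitivity ((1 - x) * ((1 - r) * (1 + l * b) + (1 - r) * (l * b) * h)); first by ring.
  by rewrite e1 e3.
transitivity (r + (r * h - x * (r * h)) + ((1 - r) - (1 - x) * (1 + r * h))); first by ring.
by rewrite e4 subrr addr0.
Qed.

(** The hypotheses give [x <= 1 + 1/2 + x/2]; the last term can be absorbed because [x] is
    finite. *)
Lemma bootstrap_le3 (R : realType) (x r g h : \bar R) :
  (0 <= x -> x < +oo -> r < +oo -> 0 <= g -> g < +oo -> h < +oo ->
  x <= r + (g + h) -> h <= x * g -> r <= 1 -> g <= 2^-1%:E -> x <= 3%:E)%E.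
Proof.
case: x r g h => [x||] [r||] [g||] [h||] //=.
rewrite -!EFinD -!EFinM !lee_fin => x0 _ _ g0 _ _ e1 e2 e3 e4.
have := ler_wpM2l x0 e4; lra.
Qed.

Section ResolventBounds.
Variables (R : realType) (T al gam th : R) (h k : R -> R).
Notation leb := (@lebesgue_measure R).
Local Notation inT := (inT T).
Local Notation tcv := (tcv T).
Local Notation emb := (@emb R T).
Hypotheses (T0 : 0 < T) (al01 : 0 < al < 1) (gam01 : 0 < gam < 1) (th0 : 0 <= th).
Hypothesis th_gt : 1 / 2 - al * (1 - gam) < th.
Hypotheses (ih : inT h) (h2 : (L2sq h < +oo)%E) (ik : inT k).
Hypothesis kE : emb k = emb (Bk T al) * (1 + emb h).

Let mu := al * (1 - gam).

Let mu0 : 0 < mu.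
Proof. by case/andP: al01 => ? _; case/andP: gam01 => _ ?; rewrite mulr_gt0// subr_gt0. Qed.

Let w (t : R) : R := trunc T (fun t => t `^ (mu - 1)) t.

Let iw : inT w. Proof. by apply: inT_trunc; exact: integrable_powR. Qed.

Let L2sq_w : (L2sq (fun t => (t `^ th * w t)%R) < +oo)%E.
Proof.
(* The square of [t^(th + mu - 1)] is [t^(e - 1)], integrable since the lower bound on [th] says
   [e > 0]. *)
pose e := 2 * (th + mu) - 1.
have e0 : 0 < e by move: th_gt; rewrite /e -/mu; lra.
have := integrable_powR T e0; move=> /integrableP[_].
apply: le_lt_trans; rewrite [leRHS]integral_mkcond /L2sq.
rewrite le_eqVlt; apply/orP; left; apply/eqP; apply: eq_integral => t _.
rewrite /w truncE patchE mem_setE in_itv/=; case: ifP => [/andP[t0 tT]|_]; last by rewrite mulr0 expr0n.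
rewrite ger0_norm ?powR_ge0//; congr EFin.
rewrite -powRD; last by rewrite (gt_eqF t0) implybT.
by rewrite -powR_mulrn ?powR_ge0// -powRrM; congr (_ `^ _); rewrite /e; lra.
Qed.

Let cst0 := (Gamma al)^-1 `^ (1 - gam) * al `^ gam.

Let cst0_ge0 : 0 <= cst0. Proof. by rewrite mulr_ge0 ?powR_ge0. Qed.

(* Writes [rt = rt^(1-gam) rt^gam] and uses one bound on each factor. *)
Let interpolation (lam rt t : R) : 0 < lam -> 0 < t < T -> 0 <= rt ->
  rt <= lam * Bk T al t -> t * rt <= al -> rt <= cst0 * lam `^ (1 - gam) * w t.
Proof.
move=> lam0 tT; have /andP[t0 tT'] := tT; have /andP[al0 al1] := al01.
have /andP[g0 g1] := gam01.
have g1' : 0 <= 1 - gam by rewrite subr_ge0 ltW.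
rewrite le_eqVlt => /predU1P[<- _ _|r0 h1 h3].
  by rewrite mulr_ge0// ?mulr_ge0 ?powR_ge0// /w truncE tT powR_ge0.
have -> : rt = rt `^ (1 - gam) * rt `^ gam.
  by rewrite -powRD ?(gt_eqF r0) ?implybT// subrK powRr1 ?ltW.
have G0 : 0 < Gamma al by rewrite Gamma_gt0// al0 ltW.
have h4 : rt <= al / t by rewrite ler_pdivlMr// mulrC.
apply: le_trans (ler_pM (powR_ge0 _ _) (powR_ge0 _ _) (ler_powRl g1' (ltW r0) h1)
  (ler_powRl (ltW g0) (ltW r0) h4)) _.
rewrite BkE// /w (trunc_in _ tT) le_eqVlt; apply/orP; left; apply/eqP.
have p0 : 0 <= t `^ (al - 1) by exact: powR_ge0.
have iG : 0 <= (Gamma al)^-1 by rewrite invr_ge0 ltW.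
rewrite (powRM _ (ltW lam0)) ?mulr_ge0// powRM//.
rewrite (powRM _ (ltW al0)) ?invr_ge0 ?(ltW t0)//.
rewrite -powRrM -(powR_inv1 (ltW t0)) -powRrM /cst0.
have -> : t `^ (mu - 1) = t `^ ((al - 1) * (1 - gam)) * t `^ (-1 * gam).
  rewrite -powRD; last by rewrite (gt_eqF t0) implybT.
  by congr (_ `^ _); rewrite /mu; ring.
by ring.
Qed.

(** All constants, and the weight [sg], are fixed before [lam]; the resolvent [r] enters only
    through bounds whose dependence on [lam] is explicit. *)
Lemma resolvent_bounds : exists Q1 Q2 : R, [/\ 0 <= Q1, 0 <= Q2 &
  forall lam : R, 0 < lam -> exists rho : R -> R, [/\ inT rho,
    (1 - emb rho) * (1 + emb (fun t => lam * k t)) = 1, (L1norm rho <= Q1%:E)%E &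
    (L2sq (fun t => (t `^ th * rho t)%R) <= (Q2 * (lam `^ (1 - gam)) ^+ 2)%:E)%E]].
Proof.
have /andP[al0 al1] := al01.
have [sg [sg0 nuh]] := L1norm_ew_small ih (ltac:(lra) : 0 < 2^-1 :> R).
(* The weighted norm of [rho] will be at most 3, and removing the weight on []0, T[] costs
   [e^(sg T)]. *)
pose Q1 := expR (sg * T) * 3.
pose sh := fine (L2sq h).
pose nw := fine (L1norm w).
pose sw := fine (L2sq (fun t => t `^ th * w t)).
have shE : L2sq h = sh%:E by rewrite fineK// ge0_fin_numE// L2sq_ge0.
have nwE : L1norm w = nw%:E by rewrite fineK// ge0_fin_numE ?L1norm_ge0//; exact: (L1norm_fin iw).
have swE : L2sq (fun t => (t `^ th * w t)%R) = sw%:E by rewrite fineK// ge0_fin_numE ?L2sq_ge0//; exact: L2sq_w.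
have sh0 : 0 <= sh by rewrite fine_ge0// L2sq_ge0.
have nw0 : 0 <= nw by rewrite fine_ge0// L1norm_ge0.
have sw0 : 0 <= sw by rewrite fine_ge0// L2sq_ge0.
have Q10 : 0 <= Q1 by rewrite mulr_ge0 ?expR_ge0.
pose g2 := cst0 ^+ 2 * nw ^+ 2 * sh.
have g20 : 0 <= g2 by apply: mulr_ge0 => //; rewrite mulr_ge0 ?sqr_ge0.
pose Tth := (T `^ th) ^+ 2.
have Tth0 : 0 <= Tth by exact: sqr_ge0.
(* Collects the weighted square norms of [r], [r * h] and [rho * (r * h)], with the factor 2 of
   [L2sqD] at each sum. *)
pose Q2 := 2 * (cst0 ^+ 2 * sw + 2 * (Tth * g2 + Tth * (Q1 ^+ 2 * g2))).
exists Q1, Q2; split=> //.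
  have q1 : 0 <= cst0 ^+ 2 * sw by rewrite mulr_ge0 ?sqr_ge0.
  have q2 : 0 <= Tth * g2 by rewrite mulr_ge0.
  have q3 : 0 <= Tth * (Q1 ^+ 2 * g2) by rewrite mulr_ge0// mulr_ge0 ?sqr_ge0.
  by rewrite /Q2 mulr_ge0// addr_ge0// mulr_ge0// addr_ge0.
move=> lam lam0.
have [r [ir resr r0 nur aer]] := mittag_leffler_resolvent T0 al0 al1 lam0.
pose K t := lam * k t.
have iK : inT K by exact: inTZ.
have [rho [irho resrho]] := resolvent_ex iK.
exists rho.
pose G := tcv r h.
have iG : inT G by exact: inT_tcv.
pose H := tcv rho G.
have iH : inT H by exact: inT_tcv.
have iGH : inT (G \- H) by exact: inTB.
have rhoE : {ae leb, forall t, rho t = (r \+ (G \- H)) t}.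
  apply/(emb_eq irho (inTD ir iGH)).
  rewrite (embD ir iGH) (embB iG iH) (embM irho iG) (embM ir ih).
  have iB : inT (Bk T al) by exact: inT_Bk.
  have eK : emb K = scal T lam * (emb (Bk T al) * (1 + emb h)) by rewrite (embZ lam ik) kE.
  by move: resr; rewrite (embZ lam iB) => resr'; exact: resolvent_factor resr' eK resrho.
have m1 u : inT u -> measurable_fun setT u by exact: inT_measurable.
have mN u : inT u -> measurable_fun setT (fun t => -1 * u t) by move=> /m1 mu'; exact: measurable_funM.
have nuew u : inT u -> (L1norm (ew sg u) < +oo)%E by move=> iu; exact: (L1norm_fin (inT_ew sg iu)).
have nur1 : (L1norm (ew sg r) <= 1)%E.
  apply: le_trans nur; apply: L1norm_le; [exact: m1 (inT_ew sg ir)|exact: m1|].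
  apply: ae_all => t; rewrite /ew normrM (ger0_norm (expR_ge0 _)).
  have [/andP[t0 tT]|/ir.2 ->] := boolP (0 < t < T); last by rewrite normr0 mulr0.
  by rewrite ler_piMl// -expR0 ler_expR mulNr oppr_le0 mulr_ge0// ltW.
have L1norm_ew_tcv u v : inT u -> inT v -> (L1norm (ew sg (tcv u v)) <= L1norm (ew sg u) * L1norm (ew sg v))%E.
  move=> iu iv; have iu' := inT_ew sg iu; have iv' := inT_ew sg iv.
  apply: le_trans (L1norm_tcv iu' iv'); apply: L1norm_le; [exact: m1 (inT_ew sg (inT_tcv iu iv))|exact: m1 (inT_tcv iu' iv')|].
  by have := ew_tcv sg iu iv; apply: ae_imply => t ->.
have nuG : (L1norm (ew sg G) <= 2^-1%:E)%E.
  apply: le_trans (L1norm_ew_tcv _ _ ir ih) _.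
  by rewrite -[leRHS]mul1e; apply: lee_pmul => //; exact: L1norm_ge0.
have nu3 : (L1norm (ew sg rho) <= 3%:E)%E.
  have b1 : (L1norm (ew sg rho) <= L1norm (ew sg r) + (L1norm (ew sg G) + L1norm (ew sg H)))%E.
    have -> : L1norm (ew sg rho) = L1norm (ew sg r \+ (ew sg G \+ (fun t => -1 * ew sg H t))).
      apply: L1norm_ae.
      - exact: m1 (inT_ew sg irho).
      - apply: measurable_funD; first exact: m1 (inT_ew sg ir).
        by apply: measurable_funD; [exact: m1 (inT_ew sg iG)|exact: mN (inT_ew sg iH)].
      - by move: rhoE; apply: ae_imply => t ht; rewrite {1}/ew ht /ew /=; ring.
    apply: le_trans (L1normD (m1 _ (inT_ew sg ir)) _) _.
      by apply: measurable_funD; [exact: m1 (inT_ew sg iG)|exact: mN (inT_ew sg iH)].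
    apply: leeD => //.
    apply: le_trans (L1normD (m1 _ (inT_ew sg iG)) (mN _ (inT_ew sg iH))) _.
    apply: leeD => //; rewrite L1normZ ?normrN1 ?mul1e//.
    exact: m1 (inT_ew sg iH).
  have b2 := L1norm_ew_tcv _ _ irho iG.
  exact: bootstrap_le3 (L1norm_ge0 _) (nuew _ irho) (nuew _ ir) (L1norm_ge0 _) (nuew _ iG) (nuew _ iH) b1 b2 nur1 nuG.
have nurho : (L1norm rho <= Q1%:E)%E.
  have ie := inT_ew sg irho.
  apply: (@le_trans _ _ (L1norm (fun t => expR (sg * T) * ew sg rho t))).
    apply: L1norm_le; [exact: m1|by apply: measurable_funM => //; exact: m1 ie|].
    apply: ae_all => t; have [tT|/irho.2 ->] := boolP (0 < t < T); last by rewrite normr0.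
    have /andP[t0 tT'] := tT.
    rewrite /ew mulrA -expRD normrM ler_peMl// ger0_norm ?expR_ge0// -[leLHS]expR0 ler_expR.
    by rewrite mulNr -mulrBr mulr_ge0// subr_ge0 ltW.
  rewrite L1normZ; last exact: m1 ie.
  by rewrite (ger0_norm (expR_ge0 _)) EFinM; apply: lee_wpmul2l => //; rewrite lee_fin expR_ge0.
pose c := cst0 * lam `^ (1 - gam).
have c0 : 0 <= c by rewrite mulr_ge0 ?powR_ge0.
have rw : {ae leb, forall t, `|r t| <= `|c * w t|}.
  move: aer; apply: ae_imply => t [h1 h3].
  have [tT|/ir.2 ->] := boolP (0 < t < T); last by rewrite normr0.
  rewrite ger0_norm//; apply: le_trans (ler_norm _); exact: interpolation.
(* Beside the bound 1, a bound of order [lam^(1-gam)]: this is the factor that the square norms of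
   [G] and [H] must carry. *)
have nurw : (L1norm r <= (c * nw)%:E)%E.
  apply: le_trans (L1norm_le (m1 _ ir) (m1 _ (inTZ c iw)) rw) _.
  by rewrite (L1normZ c (m1 _ iw)) nwE (ger0_norm c0) -EFinM.
have sqG : (L2sq G <= (g2 * (lam `^ (1 - gam)) ^+ 2)%:E)%E.
  apply: le_trans (L2sq_tcv ir ih) _; rewrite shE.
  apply: (@le_trans _ _ ((c * nw)%:E * (c * nw)%:E * sh%:E)%E).
    by apply: lee_wpmul2r; [rewrite lee_fin|apply: lee_pmul => //; exact: L1norm_ge0].
  by rewrite -!EFinM lee_fin le_eqVlt; apply/orP; left; apply/eqP; rewrite /c /g2; ring.
have sqH : (L2sq H <= (Q1 ^+ 2 * g2 * (lam `^ (1 - gam)) ^+ 2)%:E)%E.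
  apply: le_trans (L2sq_tcv irho iG) _.
  apply: (@le_trans _ _ (Q1%:E * Q1%:E * (g2 * (lam `^ (1 - gam)) ^+ 2)%:E)%E).
    apply: lee_pmul => //; [by apply: mule_ge0; exact: L1norm_ge0|exact: L2sq_ge0|].
    by apply: lee_pmul => //; exact: L1norm_ge0.
  by rewrite -!EFinM lee_fin le_eqVlt; apply/orP; left; apply/eqP; ring.
split=> //.
have mw u : inT u -> measurable_fun setT (fun t => t `^ th * u t) by move=> /m1 mu'; exact: measurable_powR_mul.
pose A t := t `^ th * r t; pose B t := t `^ th * G t; pose D t := -1 * (t `^ th * H t).
have mA : measurable_fun setT A by exact: mw.
have mB : measurable_fun setT B by exact: mw.
have mD : measurable_fun setT D by apply: measurable_funM => //; exact: mw.
have mBD : measurable_fun setT (B \+ D) by exact: measurable_funD.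
have s0 : (L2sq (fun t => (t `^ th * rho t)%R) <= L2sq (A \+ (B \+ D))%R)%E.
  apply: L2sq_le; [exact: mw|exact: measurable_funD|].
  move: rhoE; apply: ae_imply => t ->; rewrite /A /B /D /=.
  by rewrite mulN1r -mulrN -!mulrDr.
have s1 : (L2sq A <= (c ^+ 2 * sw)%:E)%E.
  rewrite EFinM -swE -L2sqZ; last exact: mw.
  apply: L2sq_le => //; first by apply: measurable_funM => //; exact: mw.
  move: rw; apply: ae_imply => t ht.
  have -> : c * (t `^ th * w t) = t `^ th * (c * w t) by rewrite mulrCA.
  rewrite /A [leLHS]normrM [leRHS]normrM; exact: ler_wpM2l.
have s2 : (L2sq B <= (Tth * (g2 * (lam `^ (1 - gam)) ^+ 2))%:E)%E.
  apply: le_trans (L2sq_weight th0 iG) _; rewrite [leRHS]EFinM.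
  by apply: lee_wpmul2l => //; rewrite lee_fin.
have s3 : (L2sq D <= (Tth * (Q1 ^+ 2 * g2 * (lam `^ (1 - gam)) ^+ 2))%:E)%E.
  rewrite L2sqZ; last exact: mw.
  rewrite sqrrN expr1n mul1e; apply: le_trans (L2sq_weight th0 iH) _; rewrite [leRHS]EFinM.
  by apply: lee_wpmul2l => //; rewrite lee_fin.
apply: le_trans s0 _; apply: le_trans (L2sqD mA mBD) _.
have s4 : (L2sq (B \+ D)%R <= (2 * (Tth * (g2 * (lam `^ (1 - gam)) ^+ 2) + Tth * (Q1 ^+ 2 * g2 * (lam `^ (1 - gam)) ^+ 2)))%:E)%E.
  apply: le_trans (L2sqD mB mD) _; rewrite [leRHS]EFinM.
  by apply: lee_wpmul2l; [rewrite lee_fin|rewrite EFinD; exact: leeD].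
apply: (@le_trans _ _ (2%:E * ((c ^+ 2 * sw)%:E + (2 * (Tth * (g2 * (lam `^ (1 - gam)) ^+ 2) + Tth * (Q1 ^+ 2 * g2 * (lam `^ (1 - gam)) ^+ 2)))%:E)))%E.
  by apply: lee_wpmul2l; [rewrite lee_fin|exact: leeD].
rewrite -EFinD -EFinM lee_fin le_eqVlt; apply/orP; left; apply/eqP.
by rewrite /c /Q2; ring.
Qed.

End ResolventBounds.

(** * From the equation to the convolution algebra *)

Section L2Facts.
Variables (R : realType) (T : R).
Notation leb := (@lebesgue_measure R).
Implicit Types f u v w : R -> R.
Local Notation inT := (inT T).
Local Notation tcv := (tcv T).
Local Notation trunc := (trunc T).
Local Notation emb := (@emb R T).

Lemma L2sq_trunc f : L2sq (trunc f) = (\int[leb]_(t in `]0%R, T[) ((f t) ^+ 2)%:E)%E.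
Proof.
rewrite /L2sq [RHS]integral_mkcond; apply: eq_integral => t _.
rewrite truncE patchE mem_setE in_itv/=; case: ifP => // _.
by rewrite expr0n.
Qed.

(** The interval is bounded and [|f| <= 1 + f^2]. *)
Lemma L2_inT f : L2 T f -> inT (trunc f).
Proof.
move=> [mf if2]; apply: inT_trunc.
have i1 : leb.-integrable `]0, T[ (EFin \o cst 1).
  apply/integrableP; split; first exact/measurable_EFinP/measurable_cst.
  under eq_integral do rewrite /= normr1.
  by rewrite integral_cst// mul1e; exact: lebesgue_oo_lty.
have i2 := @integrableD _ _ _ leb _ (measurable_itv `]0, T[) _ _ i1 if2.
apply: le_integrable i2 => //; first exact/measurable_EFinP.
move=> t _; rewrite /= lee_fin [leRHS]ger0_norm; last by rewrite addr_ge0// sqr_ge0.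
rewrite -subr_ge0 -[f t ^+ 2]real_normK ?num_real//.
have -> : 1 + `|f t| ^+ 2 - `|f t| = (`|f t| - 2^-1) ^+ 2 + 3 / 4 by field.
by rewrite addr_ge0 ?sqr_ge0// divr_ge0.
Qed.

Lemma L2norm_ge0 f : 0 <= L2norm T f. Proof. exact: sqrtr_ge0. Qed.

Lemma L2_sq f : L2 T f -> L2sq (trunc f) = (L2norm T f ^+ 2)%:E.
Proof.
move=> [mf if2]; rewrite L2sq_trunc /L2norm sqr_sqrtr; last first.
  by apply: Rintegral_ge0 => t _; exact: sqr_ge0.
by rewrite /Rintegral fineK//; apply: integrable_fin_num.
Qed.

Lemma L2sq_L2 f (c : R) : measurable_fun (`]0, T[ : set R) f -> (L2sq (trunc f) <= c%:E)%E ->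
  L2 T f /\ L2norm T f ^+ 2 <= c.
Proof.
move=> mf h.
have l2 : L2 T f.
  split=> //; apply/integrableP; split; first by apply/measurable_EFinP; exact: measurable_funX.
  apply: (@le_lt_trans _ _ c%:E); last exact: ltry.
  apply: le_trans h; rewrite L2sq_trunc le_eqVlt; apply/orP; left; apply/eqP.
  by apply: eq_integral => t _; rewrite /= ger0_norm ?sqr_ge0.
by split=> //; move: h; rewrite L2_sq// lee_fin.
Qed.

Lemma measurable_trunc_itv f : inT (trunc f) -> measurable_fun (`]0, T[ : set R) f.
Proof.
move=> /inT_measurable m; have mm : measurable_fun (`]0, T[ : set R) (trunc f) by exact: measurable_funTS.
by apply: eq_measurable_fun mm => t; rewrite inE/= in_itv/= => tT; rewrite trunc_in.
Qed.

Lemma L1norm_one : 0 < T -> L1norm (one T) = T%:E.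
Proof.
move=> T0; rewrite /L1norm.
transitivity (\int[leb]_(t in `]0%R, T[) (cst 1%E t))%E.
  rewrite [RHS]integral_mkcond; apply: eq_integral => t _.
  by rewrite /eabs /one truncE patchE mem_setE in_itv/=; case: ifP => _; rewrite ?normr1 ?normr0.
have L : leb (`]0%R, T[%classic : set R) = T%:E.
  by rewrite lebesgue_measure_itv/= lte_fin T0 oppr0 adde0.
by rewrite integral_cst// mul1e; exact: L.
Qed.

Lemma Rintegral_cc_trunc f (t : R) : 0 <= t <= T -> measurable_fun (`]0, T[ : set R) f ->
  \int[leb]_(s in `[0, t]) f s = \int[leb]_(s in `[0, t]) trunc f s.
Proof.
move=> /andP[t0 tT] mf; rewrite /Rintegral; congr fine.
have m (g : R -> R) : measurable_fun (`]0, T[ : set R) g -> measurable_fun (`]0, t[ : set R) (EFin \o g).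
  move=> mg; apply/measurable_EFinP; apply: measurable_funS mg => // s.
  by rewrite /= !in_itv/= => /andP[-> st]; exact: lt_le_trans tT.
have mt : measurable_fun (`]0, T[ : set R) (trunc f).
  by apply: measurable_funTS; exact: measurable_trunc.
rewrite (integral_itv_bndoo _ _ (m _ mf)) (integral_itv_bndoo _ _ (m _ mt)).
apply: eq_integral => s; rewrite inE/= in_itv/= => /andP[s0 st].
by rewrite trunc_in// s0 (lt_le_trans st).
Qed.

(** The equation is posed on []0, T]] while the ring sees []0, T[]; the end point is discarded as a
    null set. *)
Lemma ae_neq (x : R) : {ae leb, forall t, t != x}.
Proof.
exists [set x]; split => //; first by rewrite lebesgue_measure_set1.
by move=> t /= /negP; rewrite negbK => /eqP.
Qed.

End L2Facts.

Section SolvesEmb.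
Variables (R : realType) (T : R) (alpha : R -> R) (Qs : R).
Notation leb := (@lebesgue_measure R).
Local Notation inT := (inT T).
Local Notation tcv := (tcv T).
Local Notation trunc := (trunc T).
Local Notation emb := (@emb R T).
Hypothesis T0 : 0 < T.
Hypothesis alpha01 : forall t : R, 0 <= t <= T -> 0 < alpha t < 1.
Hypothesis alphaC : {within `[0, T], continuous alpha}.
Hypothesis dalpha : forall t : R, 0 < t < T -> derivable alpha t 1 /\ `|derive1 alpha t| <= Qs.

Let a := alpha 0.

Let aP : 0 < a < 1. Proof. by apply: alpha01; rewrite lexx ltW. Qed.

Let h := trunc (derive1 (gker alpha)).
Let c := Bk T (1 - a).

(** With [v = 1 * w] all terms become ring products in the single unknown [w]. *)
Lemma solves_emb (lam : R) (f v w : R -> R) : inT (trunc f) -> inT (trunc w) ->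
  (forall t : R, 0 < t < T -> v t = \int[leb]_(s in `[0, t]) w s) ->
  solves T alpha lam f v w <->
  emb c * emb (trunc w) + scal T lam * (emb (one T) * emb (trunc w))
    + scal T lam * (emb h * (emb (one T) * emb (trunc w))) = emb c * emb (trunc f).
Proof.
move=> ifT iw vE.
have [C [C0 mg gb ih gF]] := gker_regular T0 alpha01 alphaC dalpha.
have /andP[a0 a1] := aP.
have ic : inT c by apply: inT_Bk; rewrite subr_gt0.
have io := inT_one T.
have iow : inT (tcv (one T) (trunc w)) by exact: inT_tcv.
have ih' : inT h by [].
have mw := measurable_trunc_itv iw.
have mf := measurable_trunc_itv ifT.
have vE' (t : R) : 0 < t < T -> v t = tcv (one T) (trunc w) t.
  move=> tT; rewrite vE// tcv_one// (@Rintegral_cc_trunc _ T)//.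
  by case/andP: tT => ? ?; rewrite !ltW.
have tv : trunc v = tcv (one T) (trunc w).
  apply/funext => t; have [tT|tT] := boolP (0 < t < T); last by rewrite trunc_out// tcv_out.
  by rewrite trunc_in// vE'.
have mv : measurable_fun (`]0, T[ : set R) v.
  by apply: measurable_trunc_itv; rewrite tv.
have i1 : inT (tcv c (trunc w)) by exact: inT_tcv.
have i2 : inT (fun t => lam * tcv (one T) (trunc w) t) by exact: inTZ.
have i3' : inT (tcv h (tcv (one T) (trunc w))) by exact: inT_tcv.
have i3 : inT (fun t => lam * tcv h (tcv (one T) (trunc w)) t) by exact: inTZ.
have i4 : inT (tcv c (trunc f)) by exact: inT_tcv.
rewrite -(embM io iw) -(embM ih' iow) -(embM ic iw) -(embM ic ifT).
rewrite -(embZ lam iow) -(embZ lam i3') -(embD i1 i2) -(embD (inTD i1 i2) i3).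
rewrite (emb_eq (inTD (inTD i1 i2) i3) i4) /solves.
have E (t : R) : 0 < t < T ->
    (conv (beta_ (1 - alpha 0)) w t + lam * v t + lam * conv (derive1 (gker alpha)) v t
     = RLint (1 - alpha 0) f t) =
    ((tcv c (trunc w) \+ (fun t => lam * tcv (one T) (trunc w) t)
      \+ (fun t => lam * tcv h (tcv (one T) (trunc w)) t)) t = tcv c (trunc f) t).
  move=> tT; rewrite /RLint (conv_tcv (@measurable_beta R _ _) mw tT).
  rewrite (conv_tcv (@measurable_beta R _ _) mf tT) (conv_tcv mg mv tT) tv.
  by rewrite vE'.
split=> hs.
  have := ae_and hs (ae_neq T); apply: ae_imply => t [hs' tT'].
  have [tT|tT] := boolP (0 < t < T); last by rewrite /= !(tcv_out _ _ tT) !mulr0 !addr0.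
  by rewrite -E//; apply: hs'; rewrite /= in_itv/=; case/andP: tT => -> /ltW.
have := ae_and hs (ae_neq T); apply: ae_imply => t [hs' tT'].
rewrite /= in_itv/= => /andP[t0 tT]; rewrite E//.
by rewrite t0 lt_neqAle tT'.
Qed.

End SolvesEmb.

(** In these identities [c] and [b] stand for [beta_(1-a)] and [beta_a], [o] for the constant 1, [h]
    for [g'], [l] for [lam], [x] for the resolvent of [l k]. For existence, the left side collects
    into [c (1 + l k) W]. *)
Lemma solution_of_resolvent (A : comNzRingType) (c b o h k l x W F : A) :
  c * b = o -> k = b * (1 + h) -> (1 - x) * (1 + l * k) = 1 -> W = (1 - x) * F ->
  c * W + l * (o * W) + l * (h * (o * W)) = c * F.
Proof.
move=> <- -> e ->.
transitivity (c * ((1 - x) * (1 + l * (b * (1 + h)))) * F); first by ring.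
by rewrite e mulr1.
Qed.

(** Multiplying by [b] replaces [c] by [o]; the factor [o] left in the conclusion is cancelled by
    [emb_one_inj]. *)
Lemma resolvent_of_solution (A : comNzRingType) (c b o h k l W F : A) :
  c * b = o -> k = b * (1 + h) ->
  c * W + l * (o * W) + l * (h * (o * W)) = c * F -> o * (W + l * (k * W)) = o * F.
Proof.
move=> <- -> e.
transitivity (b * (c * W + l * (c * b * W) + l * (h * (c * b * W)))); first by ring.
by rewrite e; ring.
Qed.

Lemma resolvent_apply (A : comNzRingType) (x k l W F : A) :
  (1 - x) * (1 + l * k) = 1 -> W + l * (k * W) = F -> W = (1 - x) * F.
Proof.
move=> e <-; transitivity ((1 - x) * (1 + l * k) * W); first by rewrite e mul1r.
by ring.
Qed.

Section SolvesResolvent.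
Variables (R : realType) (T : R) (alpha : R -> R) (Qs : R).
Notation leb := (@lebesgue_measure R).
Local Notation inT := (inT T).
Local Notation tcv := (tcv T).
Local Notation trunc := (trunc T).
Local Notation emb := (@emb R T).
Hypothesis T0 : 0 < T.
Hypothesis alpha01 : forall t : R, 0 <= t <= T -> 0 < alpha t < 1.
Hypothesis alphaC : {within `[0, T], continuous alpha}.
Hypothesis dalpha : forall t : R, 0 < t < T -> derivable alpha t 1 /\ `|derive1 alpha t| <= Qs.

Let k := trunc (kker alpha).

(** Existence and uniqueness in one equivalence: the class of [w] is prescribed by the right-hand
    side. *)
Lemma solves_resolvent (lam : R) (rho f v w : R -> R) : inT rho ->
  (1 - emb rho) * (1 + emb (fun t => lam * k t)) = 1 ->
  inT (trunc f) -> inT (trunc w) ->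
  (forall t : R, 0 < t < T -> v t = \int[leb]_(s in `[0, t]) w s) ->
  solves T alpha lam f v w <-> emb (trunc w) = (1 - emb rho) * emb (trunc f).
Proof.
move=> irho res ifT iw vE.
rewrite (solves_emb T0 alpha01 alphaC dalpha lam ifT iw vE).
have aP : 0 < alpha 0 < 1 by apply: alpha01; rewrite lexx ltW.
have /andP[a0 a1] := aP.
have ic : inT (Bk T (1 - alpha 0)) by apply: inT_Bk; rewrite subr_gt0.
have ib : inT (Bk T (alpha 0)) by exact: inT_Bk.
have [ik _] := kker_inT T0 alpha01 alphaC dalpha.
have ecb : emb (Bk T (1 - alpha 0)) * emb (Bk T (alpha 0)) = emb (one T).
  by rewrite -(embM ic ib) tcv_Bk.
have ek := emb_kker T0 alpha01 alphaC dalpha.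
move: res; rewrite (embZ lam ik) => res.
split=> [e|]; last exact: solution_of_resolvent ecb ek res.
apply: resolvent_apply res _.
have ikw : inT (tcv k (trunc w)) by exact: inT_tcv.
have ilkw : inT (fun t => lam * tcv k (trunc w) t) by exact: inTZ.
have e1 : emb (trunc w) + scal T lam * (emb k * emb (trunc w))
    = emb (trunc w \+ (fun t => lam * tcv k (trunc w) t)).
  by rewrite (embD iw ilkw) (embZ lam ikw) (embM ik iw).
rewrite e1; apply: (emb_one_inj (inTD iw ilkw) ifT); rewrite -e1.
exact: resolvent_of_solution ecb ek e.
Qed.

End SolvesResolvent.

(** * The derivative of [w] for data in H^1 *)

Section HorizonExtension.
Variables (R : realType) (T : R).
Notation leb := (@lebesgue_measure R).

(* The horizon is enlarged below so that the endpoint [t = T] becomes interior. *)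
Lemma inT_widen (T' : R) u : T <= T' -> inT T u -> inT T' u.
Proof.
move=> TT' [iu u0]; split=> // t ht; apply: u0; apply: contra ht => /andP[-> tT] /=.
exact: lt_le_trans TT'.
Qed.

(** Write [f = f 0 + 1 * f'] and move the bounded factor 1 outside by pointwise associativity, so
    that the formula holds at every [t], including [T]. *)
Lemma cv_H1_formula (rho f f' : R -> R) (t : R) : 0 < T -> inT T rho -> H1D T f f' -> 0 < t <= T ->
  cv rho (trunc T f) t = f 0 * \int[leb]_(s in `[0, t]) rho s +
    \int[leb]_(s in `[0, t]) tcv (T + 1) rho (trunc T f') s.
Proof.
move=> T0 irho [l2 fE] /andP[t0 tT].
have mf' := l2.1.
have iphi := L2_inT l2.
set phi := trunc T f' in iphi *.
pose T' := T + 1.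
have TT' : T <= T' by rewrite lerDl.
have TT'' : T < T' by rewrite ltrDl.
have irho' := inT_widen TT' irho; have iphi' := inT_widen TT' iphi.
have io := inT_one T'.
set q := tcv T' (one T') phi.
have iq : inT T' q by exact: inT_tcv.
have tT' : 0 < t < T' by rewrite t0 (le_lt_trans tT).
pose F := (fun s => f 0 * one T' s) \+ q.
have i1 : inT T' (fun s => f 0 * one T' s) by exact: inTZ.
have iF : inT T' F by exact: inTD.
have -> : cv rho (trunc T f) t = tcv T' F rho t.
  rewrite (tcvC iF irho') (tcvE _ _ tT') /cv; apply: eq_Rintegral => s _.
  have [s0|s0] := leP s 0.
    have sn : ~~ (0 < s < T) by rewrite negb_and -leNgt s0.
    have sn' : ~~ (0 < s < T') by rewrite negb_and -leNgt s0.
    by rewrite (trunc_out f sn) (iF.2 _ sn').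
  have [st|st] := leP t s.
    by rewrite irho.2 ?mul0r// negb_and -leNgt subr_le0 st.
  have sT : 0 < s < T by rewrite s0 (lt_le_trans st).
  have sT' : 0 < s < T' by rewrite s0 (lt_trans st)//; case/andP: tT'.
  have sT2 : 0 <= s <= T by case/andP: sT => ? ?; rewrite !ltW.
  congr (_ * _); rewrite (trunc_in _ sT) fE// /F /= /one (trunc_in _ sT') mulr1.
  by rewrite /q (tcv_one iphi' sT') (Rintegral_cc_trunc sT2 mf').
have qb (x : R) : `|q x| <= 1 * fine (L1norm phi) by exact: tcv_bounded (@one_bound R T').
have mrho := inT_measurable irho'; have mq := inT_measurable iq; have mo := inT_measurable io.
rewrite (tcvE _ _ tT') /F cvDl//; first last.
- exact: (@econv_bounded_fin _ T' _ rho (1 * fine (L1norm phi))).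
- apply: (@econv_bounded_fin _ T' _ rho `|f 0|) => //; first exact: inT_measurable i1.
  by move=> x; rewrite normrM ler_piMr//; exact: one_bound.
- exact: inT_measurable i1.
rewrite cvZl//; last exact: (@econv_bounded_fin _ T' _ rho 1 t mo irho' (@one_bound R T')).
rewrite -(tcvE _ _ tT') -[X in _ + X](tcvE _ _ tT') (tcv_one irho' tT').
rewrite -(tcvA_bounded_l io iphi' irho' (@one_bound R T')) (tcvC iphi' irho').
by rewrite (tcv_one (inT_tcv irho' iphi') tT').
Qed.

(** Both [f] and [rho * f] are written as primitives from 0 and subtracted; the integrand is the
    weak derivative of [w = f - rho * f]. *)
Lemma w_H1_formula (rho f f' : R -> R) (s t : R) : 0 < T -> inT T rho -> H1D T f f' ->
  0 < s -> s <= t -> t <= T ->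
  f t - cv rho (trunc T f) t = f s - cv rho (trunc T f) s +
   \int[leb]_(x in `[s, t]) (trunc T f' x - (f 0 * rho x + tcv (T + 1) rho (trunc T f') x)).
Proof.
move=> T0 irho h1 s0 st tT; have [l2 fE] := h1.
have mf' := l2.1; have iphi := L2_inT l2.
have TT' : T <= T + 1 by rewrite lerDl.
have irho' := inT_widen TT' irho; have iphi' := inT_widen TT' iphi.
have iH := inT_tcv irho' iphi'.
set H := tcv _ _ _ in iH *; set phi := trunc T f' in iphi iphi' H iH *.
have iZ : inT (T + 1) (phi \- ((fun x => f 0 * rho x) \+ H)).
  by apply: inTB => //; apply: inTD => //; exact: inTZ.
have key (y : R) : 0 < y <= T -> f y - cv rho (trunc T f) y =
    f 0 + \int[leb]_(x in `[0, y]) (phi x - (f 0 * rho x + H x)).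
  move=> y0; have y0' : 0 <= y <= T by case/andP: y0 => ? ->; rewrite ltW.
  have ir0 : leb.-integrable `[0, y] (EFin \o (fun x => f 0 * rho x)).
    by apply: (@inT_integrable _ (T + 1)) => //; exact: inTZ.
  have iHy : leb.-integrable `[0, y] (EFin \o H) by exact: (@inT_integrable _ (T + 1)).
  have irH : leb.-integrable `[0, y] (EFin \o ((fun x => f 0 * rho x) \+ H)).
    by apply: (@inT_integrable _ (T + 1)) => //; apply: inTD => //; exact: inTZ.
  have iry : leb.-integrable `[0, y] (EFin \o rho) by exact: (@inT_integrable _ T).
  have ipy : leb.-integrable `[0, y] (EFin \o phi) by exact: (@inT_integrable _ T).
  rewrite (cv_H1_formula T0 irho h1 y0) fE// (Rintegral_cc_trunc y0' mf') -/phi -/H.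
  by rewrite RintegralB// RintegralD// RintegralZl// addrA.
have tI : 0 < t <= T by rewrite (lt_le_trans s0).
have sI : 0 < s <= T by rewrite s0 (le_trans st).
rewrite (key t tI) (key s sI) -addrA; congr (_ + _).
have iZt : leb.-integrable `[0, t] (EFin \o (fun x => phi x - (f 0 * rho x + H x))).
  exact: (@inT_integrable _ (T + 1)) iZ.
have := @Rintegral_itvB R _ (BLeft 0) (BRight t) s iZt.
rewrite !bnd_simp => /(_ (ltW s0) st) e1.
rewrite -[X in _ = _ + X]Rintegral_itv_obnd_cbnd; last exact: (@inT_integrable _ (T + 1)) iZ.
by rewrite -e1 addrC subrK.
Qed.

End HorizonExtension.

(** * Square-integral estimates for the solution *)

Section Bounds.
Variables (R : realType) (T : R).
Notation leb := (@lebesgue_measure R).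
Implicit Types f u v w : R -> R.
Local Notation inT := (inT T).
Local Notation trunc := (trunc T).
Local Notation emb := (@emb R T).

Lemma L2sqB u v : measurable_fun setT u -> measurable_fun setT v ->
  (L2sq (u \- v)%R <= 2%:E * (L2sq u + L2sq v))%E.
Proof.
move=> mu mv.
have mv' : measurable_fun setT (fun t => -1 * v t) by exact: measurable_funM.
rewrite (_ : u \- v = u \+ (fun t => -1 * v t)); last by apply/funext => t /=; rewrite mulN1r.
by apply: le_trans (L2sqD mu mv') _; rewrite L2sqZ// sqrrN expr1n mul1e.
Qed.

Lemma L2sq_powR_bound (u : R -> R) (C e : R) : 1 / 2 < e ->
  (forall t : R, 0 < t < T -> `|u t| <= C * t `^ (e - 1)) -> measurable_fun (`]0, T[ : set R) u ->
  (L2sq (trunc u) < +oo)%E.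
Proof.
move=> e0 uC mu; pose e' := 2 * e - 1.
have e'0 : 0 < e' by rewrite /e'; lra.
have i1 := @integrableZl _ _ _ leb _ (measurable_itv `]0, T[) (C ^+ 2) _ (integrable_powR T e'0).
have /integrableP[mi fin] := i1.
rewrite L2sq_trunc; apply: le_lt_trans fin; apply: ge0_le_integral => //.
- by move=> t _; rewrite lee_fin sqr_ge0.
- by apply/measurable_EFinP; exact: measurable_funX.
- exact: measurableT_comp mi.
move=> t; rewrite /= in_itv/= => tT; have /andP[t0 _] := tT.
rewrite lee_fin; apply: le_trans (ler_norm _).
have -> : C ^+ 2 * t `^ (e' - 1) = (C * t `^ (e - 1)) ^+ 2.
  rewrite exprMn; congr (_ * _); rewrite -powR_mulrn ?powR_ge0// -powRrM.
  by congr (_ `^ _); rewrite /e'; lra.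
rewrite -[leLHS]real_normK ?num_real// lerXn2r ?nnegrE//; last exact: uC.
exact: le_trans (uC t tT).
Qed.

Lemma L2_resolvent_image (rho f w : R -> R) (Q1 : R) : 0 <= Q1 -> inT rho -> (L1norm rho <= Q1%:E)%E -> L2 T f ->
  (forall t, w t = f t - cv rho (trunc f) t) ->
  [/\ trunc w = trunc f \- tcv T rho (trunc f), L2 T w &
      L2norm T w ^+ 2 <= 2 * (1 + Q1 ^+ 2) * L2norm T f ^+ 2].
Proof.
move=> Q10 irho nurho l2f wE; have if0 := L2_inT l2f.
have it : inT (tcv T rho (trunc f)) by exact: inT_tcv.
have tw : trunc w = trunc f \- tcv T rho (trunc f).
  apply/funext => t; have [tT|tT] := boolP (0 < t < T); last first.
    by rewrite /= !(trunc_out _ tT) (tcv_out _ _ tT) subr0.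
  by rewrite /= !(trunc_in _ tT) (tcvE _ _ tT) wE.
have iw : inT (trunc w) by rewrite tw; exact: inTB.
have mw := measurable_trunc_itv iw.
have [|l2w nw] := @L2sq_L2 R T w (2 * (1 + Q1 ^+ 2) * L2norm T f ^+ 2) mw _; last by split.
rewrite tw; apply: le_trans (L2sqB (inT_measurable if0) (inT_measurable it)) _.
rewrite -mulrA [leRHS]EFinM; apply: lee_wpmul2l; first by rewrite lee_fin.
rewrite mulrDl mul1r EFinD (L2_sq l2f); apply: leeD => //.
apply: le_trans (L2sq_tcv irho if0) _; rewrite (L2_sq l2f) [leRHS]EFinM.
apply: lee_wpmul2r; first by rewrite lee_fin sqr_ge0.
by rewrite expr2 EFinM; apply: lee_pmul => //; exact: L1norm_ge0.
Qed.

Lemma L2norm_primitive (w v : R -> R) : 0 < T -> L2 T w ->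
  (forall t : R, 0 < t < T -> v t = \int[leb]_(s in `[0, t]) w s) ->
  L2norm T v ^+ 2 <= T ^+ 2 * L2norm T w ^+ 2.
Proof.
move=> T0 l2w vE; have iw := L2_inT l2w; have mw := l2w.1.
have io := inT_one T.
have tv : trunc v = tcv T (one T) (trunc w).
  apply/funext => t; have [tT|tT] := boolP (0 < t < T); last by rewrite trunc_out// tcv_out.
  rewrite trunc_in// vE// tcv_one// (@Rintegral_cc_trunc _ T)//.
  by case/andP: tT => ? ?; rewrite !ltW.
have iv : inT (trunc v) by rewrite tv; exact: inT_tcv.
apply: (@L2sq_L2 R T v (T ^+ 2 * L2norm T w ^+ 2) (measurable_trunc_itv iv) _).2.
rewrite tv; apply: le_trans (L2sq_tcv io iw) _.
by rewrite (L1norm_one T0) (L2_sq l2w) -!EFinM expr2.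
Qed.

Lemma weighted_bound (th Q1 Q2 la f0 : R) (rho phi z : R -> R) : 0 <= th -> 0 <= Q1 -> 0 <= Q2 ->
  inT rho -> (L1norm rho <= Q1%:E)%E ->
  (L2sq (fun t => (t `^ th * rho t)%R) <= (Q2 * la ^+ 2)%:E)%E -> L2 T phi ->
  (forall t : R, z t = trunc phi t - (f0 * rho t + tcv (T + 1) rho (trunc phi) t)) ->
  L2 T (fun t => t `^ th * z t) /\
  L2norm T (fun t => t `^ th * z t) ^+ 2 <=
    2 * ((T `^ th) ^+ 2 + 2 * (Q2 + (T `^ th) ^+ 2 * Q1 ^+ 2)) * (L2norm T phi ^+ 2 + (la * f0) ^+ 2).
Proof.
move=> th0 Q10 Q20 irho nurho sqr l2 zE; have ip := L2_inT l2.
have iH : inT (tcv T rho (trunc phi)) by exact: inT_tcv.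
pose A t := t `^ th * trunc phi t; pose B t := f0 * (t `^ th * rho t).
pose D t := t `^ th * tcv T rho (trunc phi) t.
have mA : measurable_fun setT A by apply: measurable_powR_mul; exact: inT_measurable ip.
have mr : measurable_fun setT (fun t => t `^ th * rho t) by apply: measurable_powR_mul; exact: inT_measurable irho.
have mB : measurable_fun setT B by exact: measurable_funM.
have mD : measurable_fun setT D by apply: measurable_powR_mul; exact: inT_measurable iH.
have mBD : measurable_fun setT (B \+ D) by exact: measurable_funD.
have tz : trunc (fun t => t `^ th * z t) = A \- (B \+ D).
  apply/funext => t; have [tT|tT] := boolP (0 < t < T); last first.
    by rewrite /= /A /B /D (trunc_out _ tT) (trunc_out phi tT) (irho.2 _ tT) (iH.2 _ tT) !mulr0 addr0 subr0.
  have tT' : 0 < t < T + 1 by case/andP: tT => -> tT /=; rewrite (lt_trans tT)// ltrDl.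
  rewrite (trunc_in _ tT) zE (tcvE _ _ tT') /= /A /B /D (tcvE _ _ tT).
  by ring.
have mz : measurable_fun (`]0, T[ : set R) (fun t => t `^ th * z t).
  have m1 : measurable_fun (`]0, T[ : set R) (trunc (fun t => t `^ th * z t)).
    by rewrite tz; apply: measurable_funTS; exact: measurable_funB.
  by apply: eq_measurable_fun m1 => t; rewrite inE/= in_itv/= => tT; rewrite trunc_in.
apply: L2sq_L2 => //; rewrite tz.
set Tth := (T `^ th) ^+ 2; set S := L2norm T phi ^+ 2.
have Tth0 : 0 <= Tth by exact: sqr_ge0.
have S0 : 0 <= S by exact: sqr_ge0.
have sA : (L2sq A <= (Tth * S)%:E)%E.
  by apply: le_trans (L2sq_weight th0 ip) _; rewrite (L2_sq l2) -EFinM.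
have sB : (L2sq B <= (Q2 * (la * f0) ^+ 2)%:E)%E.
  rewrite L2sqZ//; apply: (@le_trans _ _ ((f0 ^+ 2)%:E * (Q2 * la ^+ 2)%:E)%E).
    by apply: lee_wpmul2l => //; rewrite lee_fin sqr_ge0.
  by rewrite -EFinM lee_fin le_eqVlt; apply/orP; left; apply/eqP; ring.
have sD : (L2sq D <= (Tth * (Q1 ^+ 2 * S))%:E)%E.
  apply: le_trans (L2sq_weight th0 iH) _; rewrite [leRHS]EFinM.
  apply: lee_wpmul2l; first by rewrite lee_fin.
  apply: le_trans (L2sq_tcv irho ip) _; rewrite (L2_sq l2) [leRHS]EFinM.
  apply: lee_wpmul2r; first by rewrite lee_fin.
  by rewrite expr2 EFinM; apply: lee_pmul => //; exact: L1norm_ge0.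
have sBD : (L2sq (B \+ D)%R <= (2 * (Q2 * (la * f0) ^+ 2 + Tth * (Q1 ^+ 2 * S)))%:E)%E.
  apply: le_trans (L2sqD mB mD) _; rewrite [leRHS]EFinM.
  by apply: lee_wpmul2l; [rewrite lee_fin|rewrite EFinD; exact: leeD].
apply: le_trans (L2sqB mA mBD) _.
apply: (@le_trans _ _ (2 * (Tth * S + 2 * (Q2 * (la * f0) ^+ 2 + Tth * (Q1 ^+ 2 * S))))%:E).
  by rewrite [leRHS]EFinM; apply: lee_wpmul2l; [rewrite lee_fin|rewrite EFinD; exact: leeD].
(* The claimed constant is rounded up: the excess is a sum of nonnegative mixed terms. *)
rewrite lee_fin -subr_ge0.
have -> : 2 * (Tth + 2 * (Q2 + Tth * Q1 ^+ 2)) * (S + (la * f0) ^+ 2) -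
    2 * (Tth * S + 2 * (Q2 * (la * f0) ^+ 2 + Tth * (Q1 ^+ 2 * S))) =
    2 * (Tth * (la * f0) ^+ 2) + 4 * (Q2 * S) + 4 * (Tth * Q1 ^+ 2 * (la * f0) ^+ 2) by ring.
have p1 : 0 <= Tth * (la * f0) ^+ 2 by rewrite mulr_ge0 ?sqr_ge0.
have p2 : 0 <= Q2 * S by rewrite mulr_ge0.
have p3 : 0 <= Tth * Q1 ^+ 2 * (la * f0) ^+ 2 by rewrite mulr_ge0 ?sqr_ge0// mulr_ge0 ?sqr_ge0.
by rewrite addr_ge0 ?(mulr_ge0 (ler0n _ 4) p3)// addr_ge0 ?(mulr_ge0 (ler0n _ 2) p1) ?(mulr_ge0 (ler0n _ 4) p2).
Qed.

End Bounds.

Theorem theorem3p1 (R : realType) (T : R) (alpha : R -> R) (Qs : R)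
  (gamma theta : R) :
  0 < T ->
  (forall t, 0 <= t <= T -> 0 < alpha t < 1) ->
  {within `[0, T], continuous alpha} ->
  (forall t, 0 < t < T -> derivable alpha t 1 /\ `|derive1 alpha t| <= Qs) ->
  3 / 4 < gamma < 1 ->
  Num.max (1 / 2 - alpha 0 * (1 - gamma)) (alpha 0 - 1 / 2) < theta < 1 / 2 ->
  exists Q : R, 0 < Q /\
  forall (lam : R) (f : R -> R), 0 < lam -> L2 T f ->
    (exists v w : R -> R,
       [/\ H1D T v w, v 0 = 0, solves T alpha lam f v w,
           H1norm T v w <= Q * L2norm T f &
           forall f' : R -> R, H1D T f f' ->
             exists z : R -> R,
               [/\ forall s t, 0 < s -> s <= t -> t <= T ->
                     w t = w s + Rintegral lebesgue_measure `[s, t] z,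
                   L2 T (fun t => powR t theta * z t) &
                   L2norm T (fun t => powR t theta * z t)
                     <= Q * (H1norm T f f' + powR lam (1 - gamma) * `|f 0|)]])
    /\
    (forall v1 w1 v2 w2 : R -> R,
       H1D T v1 w1 -> v1 0 = 0 -> solves T alpha lam f v1 w1 ->
       H1D T v2 w2 -> v2 0 = 0 -> solves T alpha lam f v2 w2 ->
       forall t, 0 <= t <= T -> v1 t = v2 t).
Proof.
move=> T0 alpha01 alphaC dalpha /andP[g34 g1] /andP[].
rewrite gt_max => /andP[th_gt _] _.
have aP : 0 < alpha 0 < 1 by apply: alpha01; rewrite lexx ltW.
have /andP[a0 a1] := aP.
have g01 : 0 < gamma < 1 by rewrite g1 (lt_trans _ g34)// divr_gt0.
(* Since [gamma > 3/4], [alpha 0 (1 - gamma) < 1/4], so the lower bound on [theta] is positive. *)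
have th0 : 0 <= theta.
  have h1 : alpha 0 * (1 - gamma) <= 1 * (1 - gamma).
    by apply: ler_wpM2r; [rewrite subr_ge0 ltW|exact: ltW].
  by apply/ltW; apply: le_lt_trans th_gt; lra.
have [C [C0 mg gb ih gF]] := gker_regular T0 alpha01 alphaC dalpha.
have e34 : 1 / 2 < 3 / 4 :> R by lra.
have h2 := L2sq_powR_bound e34 gb mg.
have [ik mk] := kker_inT T0 alpha01 alphaC dalpha.
have ek := emb_kker T0 alpha01 alphaC dalpha.
have [Q1 [Q2 [Q10 Q20 HR]]] := resolvent_bounds T0 aP g01 th0 th_gt ih h2 ik ek.
pose Qa := (T ^+ 2 + 1) * (2 * (1 + Q1 ^+ 2)).
pose Qb := 2 * ((T `^ theta) ^+ 2 + 2 * (Q2 + (T `^ theta) ^+ 2 * Q1 ^+ 2)).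
have q1 : 0 <= 1 + Q1 ^+ 2 by rewrite addr_ge0 ?sqr_ge0.
have q2 : 0 <= (T `^ theta) ^+ 2 * Q1 ^+ 2 by rewrite mulr_ge0 ?sqr_ge0.
have Qa0 : 0 <= Qa.
  by rewrite (mulr_ge0 (addr_ge0 (sqr_ge0 _) ler01) (mulr_ge0 (ler0n _ 2) q1)).
have Qb0 : 0 <= Qb.
  exact: mulr_ge0 (ler0n _ 2) (addr_ge0 (sqr_ge0 _) (mulr_ge0 (ler0n _ 2) (addr_ge0 Q20 q2))).
(* [Qa] and [Qb] bound squared norms. As [Q >= 1], its square dominates both, and one constant
   serves for the two estimates. *)
pose Q := 1 + Qa + Qb.
have Q_ge1 : 1 <= Q by rewrite /Q -addrA lerDl addr_ge0.
have QaQ : Qa <= Q ^+ 2.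
  apply: (@le_trans _ _ Q); first by rewrite /Q; lra.
  by rewrite expr2 ler_peMl// (le_trans ler01).
have QbQ : Qb <= Q ^+ 2.
  apply: (@le_trans _ _ Q); first by rewrite /Q; lra.
  by rewrite expr2 ler_peMl// (le_trans ler01).
have Q0 : 0 <= Q by exact: le_trans ler01 Q_ge1.
exists Q; split; first exact: lt_le_trans ltr01 Q_ge1.
move=> lam f lam0 l2f.
have if0 := L2_inT l2f.
have [rho [irho res nurho sqrho]] := HR lam lam0.
have sol (v w : R -> R) : inT T (trunc T w) ->
    (forall t : R, 0 < t < T -> v t = Rintegral lebesgue_measure `[0, t] w) ->
    solves T alpha lam f v w <-> emb T (trunc T w) = (1 - emb T rho) * emb T (trunc T f).
  by move=> iw vE; exact: (solves_resolvent T0 alpha01 alphaC dalpha irho res if0 iw vE).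
split; last first.
  move=> v1 w1 v2 w2 [l1 e1] v10 s1 [l2 e2] v20 s2 t tT.
  have i1 := L2_inT l1; have i2 := L2_inT l2.
  have E1 (y : R) : 0 < y < T -> v1 y = Rintegral lebesgue_measure `[0, y] w1.
    by move=> /andP[y0 y1]; rewrite e1 ?v10 ?add0r// !ltW.
  have E2 (y : R) : 0 < y < T -> v2 y = Rintegral lebesgue_measure `[0, y] w2.
    by move=> /andP[y0 y1]; rewrite e2 ?v20 ?add0r// !ltW.
  (* Both classes equal [(1 - rho) f]; the primitives then agree at every [t]. *)
  have /(emb_eq i1 i2) ae12 : emb T (trunc T w1) = emb T (trunc T w2).
    by rewrite ((sol v1 w1 i1 E1).1 s1) ((sol v2 w2 i2 E2).1 s2).
  rewrite e1// e2// v10 v20; congr (_ + _).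
  rewrite (Rintegral_cc_trunc tT l1.1) (Rintegral_cc_trunc tT l2.1) /Rintegral; congr fine.
  apply: ae_eq_integral => //.
  - by apply/measurable_EFinP; apply: measurable_funTS; exact: inT_measurable i1.
  - by apply/measurable_EFinP; apply: measurable_funTS; exact: inT_measurable i2.
  - by move: ae12; apply: ae_imply => x -> _.
(* Given by a formula at every point, not as a representative of a class: the statement about the
   derivative of [w] is pointwise, up to [t = T]. *)
pose w t := f t - cv rho (trunc T f) t.
pose v t := Rintegral lebesgue_measure `[0, t] w.
have [tw l2w nw] := @L2_resolvent_image R T rho f w Q1 Q10 irho nurho l2f (fun=> erefl).
have iw := L2_inT l2w.
have v0 : v 0 = 0 by rewrite /v set_itv1 Rintegral_set1.
exists v, w; split => //.
- by split=> // t _; rewrite v0 add0r.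
- apply/(sol v w iw (fun t _ => erefl (v t))); rewrite tw.
  have it : inT T (tcv T rho (trunc T f)) by exact: inT_tcv.
  by rewrite (embB if0 it) (embM irho if0) mulrBl mul1r.
- have nv := L2norm_primitive T0 l2w (fun t _ => erefl (v t)).
  rewrite /H1norm -[leRHS]ger0_norm ?mulr_ge0 ?L2norm_ge0// -sqrtr_sqr.
  apply: ler_wsqrtr; rewrite exprMn.
  apply: (@le_trans _ _ (Qa * L2norm T f ^+ 2)); last by rewrite ler_wpM2r ?sqr_ge0.
  apply: (@le_trans _ _ ((T ^+ 2 + 1) * L2norm T w ^+ 2)); first by rewrite mulrDl mul1r lerD2r.
  by rewrite /Qa -[leRHS]mulrA ler_wpM2l// addr_ge0 ?sqr_ge0.
move=> f' h1.
pose z t := trunc T f' t - (f 0 * rho t + tcv (T + 1) rho (trunc T f') t).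
have [l2z nz] := @weighted_bound R T theta Q1 Q2 (lam `^ (1 - gamma)) (f 0) rho f' z
  th0 Q10 Q20 irho nurho sqrho h1.1 (fun=> erefl).
exists z; split => //.
  by move=> s t s0 st tT; exact: w_H1_formula.
set X := H1norm T f f'; set Y := lam `^ (1 - gamma) * `|f 0|.
have X0 : 0 <= X by exact: sqrtr_ge0.
have Y0 : 0 <= Y by rewrite mulr_ge0 ?powR_ge0.
have SX : L2norm T f' ^+ 2 <= X ^+ 2.
  have q : 0 <= L2norm T f ^+ 2 + L2norm T f' ^+ 2 by rewrite addr_ge0 ?sqr_ge0.
  by rewrite /X /H1norm (sqr_sqrtr q) lerDr sqr_ge0.
have XY0 : 0 <= Q * (X + Y) by rewrite mulr_ge0// addr_ge0.
(* Squares are compared, since the weighted estimate is available in squared form. *)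
rewrite -(@ler_pXn2r _ 2 isT) ?nnegrE//; last exact: L2norm_ge0.
have YE : (lam `^ (1 - gamma) * f 0) ^+ 2 = Y ^+ 2.
  by rewrite /Y !exprMn real_normK ?num_real.
apply: le_trans nz _; rewrite -/Qb YE [leRHS]exprMn; apply: ler_pM => //.
  by rewrite addr_ge0 ?sqr_ge0.
apply: (@le_trans _ _ (X ^+ 2 + Y ^+ 2)); first by rewrite lerD2r.
by rewrite sqrrD lerD2r lerDl mulrn_wge0// mulr_ge0.
Qed.
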